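(* Let $\Theta=\{\mu=(\mu_1,\mu_2)^\top\in\mathbb{R}^2:\mu_1\le\mu_2\}$ and $H=\{\mu\in\mathbb{R}^2:\mu_1=\mu_2\}$. Let $\alpha\in(0,1)$, let $\chi^2_{2,1-\alpha}$ be the $1-\alpha$ quantile of $\chi^2_2$, let $c_{12,1-\alpha}$ be the $1-\alpha$ quantile of the mixture distribution $\overline{\chi}^{\,2}_{1,2}$ with cdf $\tfrac12\mathbb{P}(\chi^2_1\le x)+\tfrac12\mathbb{P}(\chi^2_2\le x)$, $x\ge0$, and define $$C^{\mathrm{pt}}_{1-\alpha}=\{\mu\in\operatorname{int}(\Theta):\ell_{\Theta,n}(\mu)\le\chi^2_{2,1-\alpha}\}\cup\{\mu\in H:\ell_{\Theta,n}(\mu)\le c_{12,1-\alpha}\}.$$ Let $X_1,X_2,\ldots$ be i.i.d. random vectors in $\mathbb{R}^2$ with a fixed distribution $F$ having mean $\mu_0\in\Theta$ and positive definite covariance matrix $\Sigma$. Assume that (a) if $\mu_0\in\operatorname{int}(\Theta)$, then $\mathbb{E}\|X_i\|^2<\infty$; (b) if $\mu_0\in H$, then $\mathbb{E}\|X_i-\mu_0\|^3<\infty$ and, for every fixed $M<\infty$, $\mathbb{P}\big[\mu_0+n^{-1/2}\{h\in\mathbb{R}^2:\|h\|\le M\}\subset\operatorname{int}\operatorname{conv}(X_1,\ldots,X_n)\big]\to1$ as $n\to\infty$. Then $$\mathbb{P}_F\{\mu_0\in C^{\mathrm{pt}}_{1-\alpha}\}\to1-\alpha\qquad(n\to\inf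ty).$$
   Context: For $\mu\in\mathbb{R}^2$ the normalized empirical likelihood based on $X_1,\ldots,X_n$ is $$L_n(\mu)=\sup\Big\{\prod_{i=1}^n(np_i):\ p_i\ge0,\ \sum_{i=1}^np_i=1,\ \sum_{i=1}^np_i(X_i-\mu)=0\Big\},$$ where the supremum over the empty set is $0$. Put $\ell_n(\mu)=-2\log L_n(\mu)$, with value $+\infty$ if $L_n(\mu)=0$. Let $\mathcal{D}_{\Theta,n}$ be the event $\{\sup_{\nu\in\Theta}L_n(\nu)>0\}$. For $\mu\in\Theta$, on $\mathcal{D}_{\Theta,n}$ the constrained empirical log-likelihood ratio is $$\ell_{\Theta,n}(\mu)=-2\log\frac{L_n(\mu)}{\sup_{\nu\in\Theta}L_n(\nu)}=\ell_n(\mu)-\inf_{\nu\in\Theta}\ell_n(\nu),$$ and by convention $\ell_{\Theta,n}(\mu)=0$ on the complement of $\mathcal{D}_{\Theta,n}$. Here $\operatorname{conv}$ is the convex hull, $\operatorname{int}$ the interior, and $\chi^2_k$ the chi-square distribution with $k$ degrees of freedom. *)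

(* Defs.v *)
From HB Require Import structures.
From mathcomp Require Export all_boot all_order all_algebra finmap.
From mathcomp Require Export all_classical all_reals all_analysis measurable_realfun.
Export Order.TTheory GRing.Theory Num.Theory.
Export numFieldNormedType.Exports.

Set Implicit Arguments.
Unset Strict Implicit.
Unset Printing Implicit Defensive.

Local Open Scope classical_set_scope.
Local Open Scope ring_scope.

(* The plane is [R * R], with its product topology,
   product sigma-algebra and componentwise module structure.                *)

Section plane.
Context {R : realType}.

(* The library norm on [R * R] is the max norm; this is the Euclidean one.  *)
Definition enorm (x : R * R) : R := Num.sqrt (x.1 ^+ 2 + x.2 ^+ 2).

Definition coord2 (i : 'I_2) (x : R * R) : R := if i == 0 then x.1 else x.2.

Definition conv_hull (A : set (R * R)) : set (R * R) :=
  smallest (@convex_set R (R * R)%type) A.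

Definition Theta : set (R * R) := [set mu | mu.1 <= mu.2].
Definition Hdiag : set (R * R) := [set mu | mu.1 = mu.2].

End plane.

Section probability.
Context {R : realType}.

Definition mutually_independent d (T : measurableType d) d'
    (T' : measurableType d') (P : probability T R)
    (X : nat -> {RV P >-> T'}) : Prop :=
  forall (J : {fset nat}) (A : nat -> set T'),
    (forall j, j \in J -> measurable (A j)) ->
    P (\bigcap_(j in [set` J]) (X j @^-1` A j)) =
    (\prod_(j <- J) P (X j @^-1` A j))%E.

Definition is_mean (F : probability (R * R)%type R) (m : R * R) : Prop :=
  forall i, F.-integrable setT (EFin \o coord2 i) /\
            ('E_F[coord2 i] = (coord2 i m)%:E)%E.

(* For a law with a mean, finiteness of the diagonal covariances is exactly
   finiteness of the second moments.                                        *)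
Definition is_covariance_matrix (F : probability (R * R)%type R)
    (S : 'M[R]_2) : Prop :=
  forall i j, covariance F (coord2 i) (coord2 j) = (S i j)%:E.

Definition positive_definite n (S : 'M[R]_n) : Prop :=
  S^T = S /\ forall v : 'cV[R]_n, v != 0 -> 0 < (v^T *m S *m v) ord0 ord0.

End probability.

Section chi_square.
Context {R : realType}.

(* [normal_prob] lives on this copy of [R], which carries the same Borel
   sigma-algebra as [R] but another measure display.                        *)
Local Notation mR := (measurableTypeR R).

Definition add_sq (zs : mR * mR) : mR := zs.1 ^+ 2 + zs.2.

Lemma measurable_add_sq : measurable_fun [set: mR * mR] add_sq.
Proof.
apply: measurable_funD; last exact: measurable_snd.
by apply: measurable_funX; exact: measurable_fst.
Qed.

HB.instance Definition _ :=
  isMeasurableFun.Build _ _ _ _ add_sq measurable_add_sq.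

(* The law of a sum of squares of [k] independent standard normals. *)
Fixpoint chi2 (k : nat) : probability mR R :=
  if k is k'.+1 then
    distribution (normal_prob 0 1 \x chi2 k')%E (add_sq : {mfun _ >-> mR})
  else \d_(0 : mR).

Definition chi2_cdf (k : nat) (x : R) : \bar R := chi2 k `]-oo, x]%classic.

Definition chibar12_cdf (x : R) : \bar R :=
  ((2^-1)%:E * chi2_cdf 1 x + (2^-1)%:E * chi2_cdf 2 x)%E.

Definition quantile (F : R -> \bar R) (p : R) : R :=
  inf [set x | (p%:E <= F x)%E].

End chi_square.

Section empirical_likelihood.
Context {R : realType}.
Variables (n : nat) (x : 'I_n -> R * R).

(* The products are at most 1 by AM-GM, so this real [sup] is the true
   supremum whenever the set is nonempty, and [sup set0 = 0].               *)
Definition EL (mu : R * R) : R :=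
  sup [set r | exists p : 'I_n -> R,
    [/\ forall i, 0 <= p i,
        \sum_i p i = 1,
        \sum_i p i *: (x i - mu) = 0
      & r = \prod_i (n%:R * p i)]].

(* [-2 log r], equal to [+oo] at [r = 0] since [lne 0 = -oo]. *)
Definition neg2log (r : R) : \bar R := ((-2)%:E * lne r%:E)%E.

Definition max_EL (A : set (R * R)) : R := sup [set EL nu | nu in A].

Definition constrained_ELR (A : set (R * R)) (mu : R * R) : \bar R :=
  if 0 < max_EL A then neg2log (EL mu / max_EL A) else 0%E.

Definition C_pt (alpha : R) : set (R * R) :=
  [set mu | interior Theta mu /\
     (constrained_ELR Theta mu <=
        (quantile (chi2_cdf 2) (1 - alpha))%:E)%E] `|`
  [set mu | Hdiag mu /\
     (constrained_ELR Theta mu <=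
        (quantile chibar12_cdf (1 - alpha))%:E)%E].

End empirical_likelihood.

(* Main.v *)
(* Whitening the data turns [X i - mu0] into [(a i, b i)] with mean 0 and identity
   covariance, where [a i] is proportional to [(X i - mu0).1 - (X i - mu0).2].
   The constraint [nu \in Theta] on the mean becomes [\sum p a <= delta], with
   [delta] proportional to [mu0.2 - mu0.1], and [nu = mu0] becomes
   [\sum p a = \sum p b = 0]. With [Z] the normalized sum of the [(a i, b i)],
   AM-GM bounds the products of weights from above and explicit weights bound them
   from below, so that, up to a vanishing error,
   - [-2 ln (EL mu0) = Z.1 ^+ 2 + Z.2 ^+ 2];
   - [-2 ln (max_EL Theta)] is 0 if [delta > 0], and [(max Z.1 0) ^+ 2] if [delta = 0].
   The constrained ratio is thus close to [Z.1 ^+ 2 + Z.2 ^+ 2] in the interior and to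
   [(min Z.1 0) ^+ 2 + Z.2 ^+ 2] on the diagonal. By the central limit theorem, proved
   here with Lindeberg's replacement of convolution operators, their limit laws are
   [chi2_2] and the half-half mixture of [chi2_1] and [chi2_2]. These have no atoms,
   so the coverage tends to the value [1 - alpha] of the limit cdf at its quantile. *)

From HB Require Import structures.
Require Import Defs.
From mathcomp Require Import ring lra.

Set Implicit Arguments.
Unset Strict Implicit.
Unset Printing Implicit Defensive.

Local Open Scope classical_set_scope.
Local Open Scope ring_scope.

(** * Smooth test functions *)

(** Convolution operators commute and contract, so the exchange needs only a one-step comparison and
    no Gaussian variables on the space of the data; the normal law enters through the fact that its
    [n]-fold scaled convolution returns it exactly. The one-step error is a cubic remainder made
    quadratic at infinity, so that dominated convergence applies once squares are integrable. The
    smooth limit theorem concerns products [g x * h y], while the events of interest are sublevel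
    sets of a sum of two functions; these are squeezed between finite sums of products of
    indicators.

    The Lagrange equation of the likelihood is never solved: inserting its first-order solution
    already fixes the exponent up to a multiple of [K ^+ 3 * eps], where [K] bounds [Z] and [eps]
    bounds the deviation of the empirical second moments and the largest summand relative to the
    square root of [n]. These estimates are deterministic and hold outside the event [bad]. As the
    likelihoods are suprema over uncountably many weights, their measurability is a separate task,
    settled by compactness. *)

Section calculus.
Context {R : realType}.
Implicit Types (f g h : R -> R) (s u x C K : R).

Lemma derive_bound_increment f df u K :
  (forall x, is_derive x 1 f (df x)) ->
  (forall x, `|x| <= `|u| -> `|df x| <= K) -> `|f u - f 0| <= K * `|u|.
Proof.
move=> dfE dfK.
have cf a b : {within `[a, b], continuous f}.
  apply: continuous_subspaceT => x; apply/differentiable_continuous/derivable1_diffP.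
  by have := dfE x; case.
have [u0|u0|->] := ltgtP u 0; last by rewrite subrr !normr0 mulr0.
- have [c cu] := MVT u0 (fun x _ => dfE x) (cf _ _).
  rewrite distrC sub0r => ->; rewrite normrM normrN ler_wpM2r//; apply: dfK.
  by move: cu; rewrite in_itv/= => /andP[? ?]; rewrite !ltr0_norm//; lra.
- have [c cu] := MVT u0 (fun x _ => dfE x) (cf _ _).
  rewrite subr0 => ->; rewrite normrM ler_wpM2r//; apply: dfK.
  by move: cu; rewrite in_itv/= => /andP[? ?]; rewrite !gtr0_norm//; lra.
Qed.

(** Only what the exchange argument consumes: bounded coefficients and a uniform cubic remainder.
    With the derivatives hidden behind existentials, the class is visibly stable under linear
    combinations and affine substitutions. *)
Definition taylor2 g := exists (g1 g2 : R -> R) C, [/\ continuous g,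
  forall s, `|g s| <= C /\ `|g1 s| <= C /\ `|g2 s| <= C &
  forall s u, `|g (s + u) - g s - g1 s * u - g2 s / 2 * u ^+ 2| <= C * `|u| ^+ 3].

Lemma taylor2_continuous g : taylor2 g -> continuous g.
Proof. by move=> [? [? [? []]]]. Qed.

(** The mean value inequality is applied three times, to [g2], to the remainder of [g1] and to that
    of [g]. Each bound is monotone in the absolute value of the increment, so the constant remains
    [C]. *)
Lemma taylor2_of_derive3 g g1 g2 g3 C :
  (forall x, is_derive x 1 g (g1 x)) -> (forall x, is_derive x 1 g1 (g2 x)) ->
  (forall x, is_derive x 1 g2 (g3 x)) ->
  (forall x, [/\ `|g x| <= C, `|g1 x| <= C, `|g2 x| <= C & `|g3 x| <= C]) ->
  taylor2 g.
Proof.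
move=> d1 d2 d3 B; exists g1, g2, C; split.
- move=> x.
  by apply/differentiable_continuous/derivable1_diffP; have := d1 x; case.
- by move=> s; have [] := B s.
- move=> s u.
  have C0 : 0 <= C by apply: le_trans (normr_ge0 (g 0)) _; have [] := B 0.
  have sh h h1 : (forall x, is_derive x 1 h (h1 x)) ->
      forall x, is_derive x 1 (fun y => h (s + y)) (h1 (s + x)).
    move=> hd x; have D := hd (s + x).
    have E : is_derive x 1 (fun y : R => s + y) 1 by apply: is_derive_eq; rewrite add0r mulr1.
    by rewrite -[h1 _]mulr1; exact: (is_derive1_comp D E).
  have r1 x : `|g2 (s + x) - g2 s| <= C * `|x|.
    have := @derive_bound_increment (fun y => g2 (s + y)) (fun y => g3 (s + y)) x C (sh _ _ d3).
    by rewrite addr0; apply => y _; have [] := B (s + y).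
  have r2 x : `|g1 (s + x) - g1 s - g2 s * x| <= C * `|x| ^+ 2.
    have := @derive_bound_increment (fun y => g1 (s + y) - g2 s * y) (fun y => g2 (s + y) - g2 s) x (C * `|x|).
    rewrite addr0 mulr0 subr0 addrAC expr2 mulrA; apply.
      move=> y; have D := sh _ _ d2 y.
      by apply: is_derive_eq; rewrite scaler1.
    by move=> y yx; apply: le_trans (r1 y) _; rewrite ler_wpM2l.
  have := @derive_bound_increment (fun y => g (s + y) - g1 s * y - g2 s / 2 * y ^+ 2)
     (fun y => g1 (s + y) - g1 s - g2 s * y) u (C * `|u| ^+ 2).
  rewrite addr0 mulr0 expr0n mulr0 !subr0 -[X in _ <= X]mulrA -exprSr.
  have -> : g (s + u) - g1 s * u - g2 s / 2 * u ^+ 2 - g s =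
     g (s + u) - g s - g1 s * u - g2 s / 2 * u ^+ 2 by ring.
  apply.
    move=> y; have D := sh _ _ d1 y.
    by apply: is_derive_eq; rewrite /GRing.scale/=; field.
  move=> y yx; apply: le_trans (r2 y) _; rewrite ler_wpM2l// lerXn2r// nnegrE//.
Qed.

Lemma taylor2_lin g h (a b c : R) : taylor2 g -> taylor2 h ->
  taylor2 (fun x => a * g x + b * h x + c).
Proof.
move=> [g1 [g2 [C [mg gC gT]]]] [h1 [h2 [D [mh hD hT]]]].
exists (fun x => a * g1 x + b * h1 x), (fun x => a * g2 x + b * h2 x),
  (`|a| * C + `|b| * D + `|c|); split.
- move=> x; apply: cvgD; last exact: cvg_cst.
  by apply: cvgD; apply: cvgMl_tmp; [exact: mg|exact: mh].
- move=> s; have [? [? ?]] := gC s; have [? [? ?]] := hD s.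
  have t (x y : R) : `|x| <= C -> `|y| <= D -> `|a * x + b * y| <= `|a| * C + `|b| * D.
    by move=> ? ?; apply: le_trans (ler_normD _ _) _; rewrite !normrM lerD// ler_wpM2l.
  split; first by apply: le_trans (ler_normD _ _) _; rewrite lerD2r t.
  by split; apply: le_trans (t _ _ _ _) _ => //; rewrite lerDl.
- move=> s u.
  have -> : a * g (s + u) + b * h (s + u) + c - (a * g s + b * h s + c) -
     (a * g1 s + b * h1 s) * u - (a * g2 s + b * h2 s) / 2 * u ^+ 2 =
     a * (g (s + u) - g s - g1 s * u - g2 s / 2 * u ^+ 2) +
     b * (h (s + u) - h s - h1 s * u - h2 s / 2 * u ^+ 2) by ring.
  apply: le_trans (ler_normD _ _) _; rewrite !normrM.
  have := ler_wpM2l (normr_ge0 a) (gT s u); have := ler_wpM2l (normr_ge0 b) (hT s u).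
  have := mulr_ge0 (normr_ge0 c) (exprn_ge0 3 (normr_ge0 u)).
  by rewrite !mulrDl !mulrA; lra.
Qed.

Lemma taylor2_affine g (k a : R) : taylor2 g -> taylor2 (fun x => g (k * (x - a))).
Proof.
move=> [g1 [g2 [C [mg gC gT]]]].
have C0 : 0 <= C by apply: le_trans (normr_ge0 (g 0)) _; have [] := gC 0.
(* One constant for the value and both coefficients, scaled by powers of [k] up to the second, and
   for the remainder, scaled by the third. *)
pose K := 1 + `|k| + `|k| ^+ 2 + `|k| ^+ 3.
have kp n : 0 <= `|k| ^+ n by apply: exprn_ge0.
have [[k1 k2] k3] := (kp 1%N, kp 2%N, kp 3%N); rewrite expr1 in k1.
exists (fun x => k * g1 (k * (x - a))), (fun x => k ^+ 2 * g2 (k * (x - a))),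
  (K * C); split.
- move=> x; apply: (continuous_comp (f := fun x => k * (x - a)) (g := g)); last exact: mg.
  by apply: cvgMl_tmp; apply: cvgB; [exact: cvg_id|exact: cvg_cst].
- move=> s; have [? [? ?]] := gC (k * (s - a)); split; [|split].
  + by apply: le_trans (_ : 1 * C <= _); rewrite ?mul1r// ler_peMl// /K; lra.
  + rewrite normrM; apply: ler_pM => //; rewrite /K; lra.
  + rewrite normrM normrX; apply: ler_pM => //; rewrite /K; lra.
- move=> s u; have := gT (k * (s - a)) (k * u).
  have -> : k * (s - a) + k * u = k * (s + u - a) by ring.
  rewrite (normrM k) [(`|k| * _) ^+ 3]exprMn => H; rewrite [X in `|X| <= _](_ : _ =
    g (k * (s + u - a)) - g (k * (s - a)) - g1 (k * (s - a)) * (k * u) -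
      g2 (k * (s - a)) / 2 * (k * u) ^+ 2); last by ring.
  apply: le_trans H _; rewrite mulrA ler_wpM2r ?exprn_ge0// mulrC ler_wpM2r//.
  rewrite /K; lra.
Qed.

(** The decreasing logistic function. Its derivative is [sigm x ^+ 2 - sigm x], so all its
    derivatives are polynomials in [sigm]; as [sigm] lies between 0 and 1, they are bounded by the
    sums of the absolute values of their coefficients. The constants 50 and 200 below exceed these
    sums. *)
Definition sigm x : R := (1 + expR x)^-1.

Lemma sigm_gt0 x : 0 < sigm x.
Proof. by rewrite invr_gt0 addr_gt0// expR_gt0. Qed.

Lemma sigm_lt1 x : sigm x < 1.
Proof. by rewrite invf_lt1 ?addr_gt0 ?expR_gt0// ltrDl expR_gt0. Qed.

Lemma is_derive_sigm x : is_derive x 1 sigm (sigm x ^+ 2 - sigm x).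
Proof.
have e0 : 1 + expR x != 0 by rewrite gt_eqF// addr_gt0// expR_gt0.
have D : is_derive x 1 (fun y : R => 1 + expR y) (expR x).
  by apply: is_derive_eq; rewrite ?add0r ?mul1r.
have V := @is_deriveV _ (fun y : R => 1 + expR y) x _ _ e0 D.
rewrite (_ : _ - _ = - (1 + expR x) ^- 2 *: expR x)//.
by rewrite /sigm /GRing.scale/=; field.
Qed.

Lemma taylor2_sigm : taylor2 sigm.
Proof.
apply: (@taylor2_of_derive3 _ (fun x => sigm x ^+ 2 - sigm x)
  (fun x => 2 * sigm x ^+ 3 - 3 * sigm x ^+ 2 + sigm x)
  (fun x => 6 * sigm x ^+ 4 - 12 * sigm x ^+ 3 + 7 * sigm x ^+ 2 - sigm x) 50).
- exact: is_derive_sigm.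
- move=> x; have D := is_derive_sigm x; apply: is_derive_eq.
  by rewrite /GRing.scale/=; ring.
- move=> x; have D := is_derive_sigm x; apply: is_derive_eq.
  by rewrite /GRing.scale/=; ring.
- move=> x; have := sigm_lt1 x; have := sigm_gt0 x; set s := sigm x => s0 s1.
  have [s2 [s3 s4]] : 0 <= s ^+ 2 <= 1 /\ 0 <= s ^+ 3 <= 1 /\ 0 <= s ^+ 4 <= 1.
    by rewrite !exprn_ge0 ?exprn_ile1//; lra.
  split; rewrite ler_norml; lra.
Qed.

Lemma taylor2_sigm_sqr : taylor2 (fun x => sigm x ^+ 2).
Proof.
apply: (@taylor2_of_derive3 _ (fun x => 2 * sigm x ^+ 3 - 2 * sigm x ^+ 2)
  (fun x => 6 * sigm x ^+ 4 - 10 * sigm x ^+ 3 + 4 * sigm x ^+ 2)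
  (fun x => 24 * sigm x ^+ 5 - 54 * sigm x ^+ 4 + 38 * sigm x ^+ 3 - 8 * sigm x ^+ 2) 200).
- move=> x; have D := is_derive_sigm x; apply: is_derive_eq.
  by rewrite /GRing.scale/=; ring.
- move=> x; have D := is_derive_sigm x; apply: is_derive_eq.
  by rewrite /GRing.scale/=; ring.
- move=> x; have D := is_derive_sigm x; apply: is_derive_eq.
  by rewrite /GRing.scale/=; ring.
- move=> x; have := sigm_lt1 x; have := sigm_gt0 x; set s := sigm x => s0 s1.
  have [s2 [s3 [s4 s5]]] : 0 <= s ^+ 2 <= 1 /\ 0 <= s ^+ 3 <= 1 /\
      0 <= s ^+ 4 <= 1 /\ 0 <= s ^+ 5 <= 1.
    by rewrite !exprn_ge0 ?exprn_ile1//; lra.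
  split; rewrite ler_norml; lra.
Qed.

Lemma sigm0 : sigm 0 = 2^-1.
Proof. by rewrite /sigm expR0. Qed.

Lemma sigm_anti : {homo sigm : x y /~ x <= y}.
Proof.
by move=> x y xy; rewrite /sigm lef_pV2 ?posrE ?addr_gt0 ?expR_gt0// lerD2l ler_expR.
Qed.

Lemma sigm_anti_lt : {homo sigm : x y /~ x < y}.
Proof.
by move=> x y xy; rewrite /sigm ltf_pV2 ?posrE ?addr_gt0 ?expR_gt0// ltrD2l ltr_expR.
Qed.

Lemma sigmN x : sigm (- x) = 1 - sigm x.
Proof.
rewrite /sigm expRN; have := expR_gt0 x; set e := expR x => e0.
field; rewrite !gt_eqF ?addr_gt0//.
Qed.

(** For large [k], [soft_step] is a smooth version of the indicator of [x < a], and [soft_bump]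
    bounds its error. The bump is quadratic in the step, so it stays in [taylor2], and it
    concentrates near [a]. *)
Definition soft_step (k a x : R) := sigm (k * (x - a)).
Definition soft_bump (k a x : R) := 2 * (soft_step k a x - soft_step k a x ^+ 2).

Lemma taylor2_soft_step k a : taylor2 (soft_step k a).
Proof. exact: (taylor2_affine _ _ taylor2_sigm). Qed.

Lemma taylor2_ext g h : g =1 h -> taylor2 g -> taylor2 h.
Proof. by move=> /funext ->. Qed.

Lemma taylor2_soft_bump k a : taylor2 (soft_bump k a).
Proof.
apply: taylor2_ext (taylor2_lin 2 (-2) 0 (taylor2_soft_step k a)
  (taylor2_affine k a taylor2_sigm_sqr)) => x.
by rewrite /soft_bump/soft_step; ring.
Qed.

(* The error of smoothing a step is [minr s (1 - s) <= 2 * s * (1 - s)]. *)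
Lemma soft_step_approx (b : bool) k a x : 0 < k ->
  `| (if b then x < a else x <= a)%:R - soft_step k a x| <= soft_bump k a x.
Proof.
move=> k0; have s0 : 0 < soft_step k a x := sigm_gt0 _.
have s1 : soft_step k a x < 1 := sigm_lt1 _.
rewrite /soft_bump; have [xa|xa|->] := ltgtP x a.
- have sh : 1/2 <= soft_step k a x.
    rewrite mul1r -sigm0 /soft_step; apply: sigm_anti.
    by rewrite pmulr_rle0// subr_le0 ltW.
  rewrite if_same /= ?mulr1n ?mulr0n; move: s0 s1 sh; set s := soft_step k a x => *.
  have := mulr_ge0 (_ : 0 <= 1 - s) (_ : 0 <= 2 * s - 1).
  by rewrite ger0_norm; [nra|lra].
- have sh : soft_step k a x <= 1/2.
    rewrite mul1r -sigm0 /soft_step; apply: sigm_anti.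
    by rewrite pmulr_rge0// subr_ge0 ltW.
  rewrite if_same /= ?mulr1n ?mulr0n; move: s0 s1 sh; set s := soft_step k a x => *.
  by rewrite sub0r normrN ger0_norm; [nra|lra].
- rewrite /soft_step subrr mulr0 sigm0.
  by case: b; rewrite /= ?mulr1n ?mulr0n ?sub0r ?normrN ger0_norm; lra.
Qed.

Lemma soft_step_01 k a x : 0 <= soft_step k a x <= 1.
Proof. by rewrite !ltW// ?sigm_gt0// sigm_lt1. Qed.

Lemma soft_bump_01 k a x : 0 <= soft_bump k a x <= 1.
Proof.
have := soft_step_01 k a x; rewrite /soft_bump; set s := soft_step k a x => s01.
nra.
Qed.

(** An even bounded function, zero only at 0 and increasing with the distance to 0. Markov's
    inequality for it gives convergence in probability, while its expectation is accessible to the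
    convolution method. *)
Definition dist_test x := (sigm x - 2^-1) ^+ 2.

Lemma taylor2_dist_test : taylor2 dist_test.
Proof.
apply: taylor2_ext (taylor2_lin (-1) 1 4^-1 taylor2_sigm taylor2_sigm_sqr) => x.
by rewrite /dist_test; field.
Qed.

Lemma dist_test0 : dist_test 0 = 0.
Proof. by rewrite /dist_test sigm0 subrr expr0n. Qed.

Lemma dist_test_ge0 x : 0 <= dist_test x.
Proof. exact: sqr_ge0. Qed.

Lemma dist_test_gt0 x : 0 < x -> 0 < dist_test x.
Proof.
move=> x0; rewrite exprn_even_gt0//= subr_eq0.
by have := sigm_anti_lt x0; rewrite sigm0 => /lt_eqF ->.
Qed.

Lemma dist_test_mono (e x : R) : 0 <= e -> e <= `|x| -> dist_test e <= dist_test x.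
Proof.
move=> e0 ex.
have -> : dist_test x = dist_test `|x|.
  have [x0|x0] := leP 0 x; first by rewrite ger0_norm.
  by rewrite ltr0_norm// /dist_test sigmN; set s := sigm x; field.
rewrite /dist_test -sqrrN -[leRHS]sqrrN lerXn2r ?nnegrE ?lerN2 ?lerD2r ?sigm_anti//.
  by rewrite opprB subr_ge0 -sigm0 sigm_anti.
by rewrite opprB subr_ge0 -sigm0 sigm_anti.
Qed.

End calculus.

(** * Sums of independent vectors as iterated convolutions *)

Section bounded_measurable.
Context {R : realType}.

Definition bmeas d (T : measurableType d) (f : T -> R) :=
  measurable_fun setT f /\ exists C : R, forall x, `|f x| <= C.

Section one_measure.
Context d (T : measurableType d) (mu : probability T R).
Implicit Types f g : T -> R.

Lemma bmeas_integrable f : bmeas f -> mu.-integrable setT (EFin \o f).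
Proof.
move=> [mf [C fC]]; apply: measurable_bounded_integrable => //.
  exact: le_lt_trans (probability_le1 mu measurableT) (ltry _).
exists C; split; first exact: num_real.
by move=> y Cy x _; apply: le_trans (fC x) (ltW Cy).
Qed.

Lemma Rintegral_le f g : mu.-integrable setT (EFin \o f) ->
  mu.-integrable setT (EFin \o g) -> (forall x, f x <= g x) ->
  \int[mu]_x f x <= \int[mu]_x g x.
Proof. by move=> mf mg fg; apply: le_Rintegral. Qed.

Lemma Rintegral_cst1 (c : R) : \int[mu]_x c = c.
Proof.
rewrite Rintegral_cst// [X in fine X](_ : _ = 1%E) ?mulr1//.
exact: (@probability_setT _ _ _ mu).
Qed.

Lemma Rintegral_norm_le f (c : R) : mu.-integrable setT (EFin \o f) ->
  (forall x, `|f x| <= c) -> `|\int[mu]_x f x| <= c.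
Proof.
move=> mf fc; apply: le_trans (le_normr_Rintegral measurableT mf) _.
rewrite -[leRHS]Rintegral_cst1; apply: Rintegral_le => //.
  exact: (@integrable_norm _ _ _ _ _ _ mf).
by apply: bmeas_integrable; split => //; exists `|c|.
Qed.

Lemma bmeasD f g : bmeas f -> bmeas g -> bmeas (fun x => f x + g x).
Proof.
move=> [mf [C fC]] [mg [D gD]]; split; first exact: measurable_funD.
by exists (C + D) => x; apply: le_trans (ler_normD _ _) _; rewrite lerD.
Qed.

Lemma bmeasB f g : bmeas f -> bmeas g -> bmeas (fun x => f x - g x).
Proof.
move=> [mf [C fC]] [mg [D gD]]; split; first exact: measurable_funB.
by exists (C + D) => x; apply: le_trans (ler_normB _ _) _; rewrite lerD.
Qed.

Lemma bmeasM f g : bmeas f -> bmeas g -> bmeas (fun x => f x * g x).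
Proof.
move=> [mf [C fC]] [mg [D gD]]; split; first exact: measurable_funM.
by exists (C * D) => x; rewrite normrM ler_pM.
Qed.

Lemma bmeas_cst (c : R) : bmeas (fun _ : T => c).
Proof. by split => //; exists `|c|. Qed.

Lemma Rintegral_indic (A : set T) : measurable A ->
  \int[mu]_x (\1_A x : R) = fine (mu A).
Proof. by move=> mA; rewrite /Rintegral integral_indic// setIT. Qed.

End one_measure.

Lemma bmeas_comp d d' (T : measurableType d) (T' : measurableType d')
  (h : T -> T') (f : T' -> R) : measurable_fun setT h -> bmeas f ->
  bmeas (fun x => f (h x)).
Proof.
by move=> mh [mf [C fC]]; split; [exact: measurableT_comp|exists C].
Qed.

Section two_measures.
Context d1 d2 (T1 : measurableType d1) (T2 : measurableType d2).
Variables (mu : probability T1 R) (nu : probability T2 R).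
Variable f : T1 * T2 -> R.
Hypothesis bf : bmeas f.

Let slice_int x : nu.-integrable setT (EFin \o (fun y => f (x, y))).
Proof.
apply: bmeas_integrable; apply: (bmeas_comp (h := fun y => (x, y))) bf.
exact: pair1_measurable.
Qed.

Let inner x : (\int[nu]_y (f (x, y))%:E)%E = (\int[nu]_y f (x, y))%:E.
Proof. by rewrite /Rintegral fineK//; exact: (integrable_fin_num measurableT (slice_int x)). Qed.

Lemma bmeas_Rintegral : bmeas (fun x => \int[nu]_y f (x, y)).
Proof.
have [mf [C fC]] := bf; split; last first.
  by exists C => x; apply: Rintegral_norm_le.
apply/measurable_EFinP => /=.
have := measurable_fubini_F (bmeas_integrable (mu \x nu)%E bf).
rewrite [X in measurable_fun _ X -> _](_ : _ = EFin \o (fun x => \int[nu]_y f (x, y)))//.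
by apply/funext => x /=; rewrite -inner.
Qed.

Lemma Rintegral_prod :
  \int[(mu \x nu)%E]_z f z = \int[mu]_x \int[nu]_y f (x, y).
Proof.
rewrite /Rintegral -(integral12_prod_meas1 (bmeas_integrable (mu \x nu)%E bf)).
by congr fine; apply: eq_integral => x _; rewrite /fubini_F /= inner.
Qed.

End two_measures.

Lemma Rfubini d1 d2 (T1 : measurableType d1) (T2 : measurableType d2)
  (mu : probability T1 R) (nu : probability T2 R) (f : T1 * T2 -> R) : bmeas f ->
  \int[mu]_x \int[nu]_y f (x, y) = \int[nu]_y \int[mu]_x f (x, y).
Proof.
move=> bf; have F := Fubini (bmeas_integrable (mu \x nu)%E bf).
have i1 x : nu.-integrable setT (EFin \o (fun y => f (x, y))).
  apply: bmeas_integrable; apply: (bmeas_comp (h := fun y => (x, y))) bf.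
  exact: pair1_measurable.
have i2 y : mu.-integrable setT (EFin \o (fun x => f (x, y))).
  apply: bmeas_integrable; apply: (bmeas_comp (h := fun x => (x, y))) bf.
  exact: pair2_measurable.
rewrite /Rintegral; congr fine.
transitivity (\int[mu]_x \int[nu]_y (f (x, y))%:E)%E.
  by apply: eq_integral => x _; rewrite fineK//; exact: (integrable_fin_num measurableT (i1 x)).
rewrite -[LHS]/(\int[mu]_x \int[nu]_y (EFin \o f) (x, y))%E F.
by apply: eq_integral => x _; rewrite fineK//; exact: (integrable_fin_num measurableT (i2 x)).
Qed.

Lemma Rintegral_distribution d d' (T : measurableType d) (T' : measurableType d')
  (P : probability T R) (X : {RV P >-> T'}) (f : T' -> R) : bmeas f ->
  \int[distribution P X]_y f y = \int[P]_x f (X x).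
Proof.
move=> bf; rewrite /Rintegral -[RHS]/(fine (\int[P]_x ((EFin \o f) \o X) x)%E).
rewrite -integral_distribution//; last first.
  by apply: (bmeas_integrable P (f := f \o X)); exact: bmeas_comp bf.
by apply/measurable_EFinP; case: bf.
Qed.

End bounded_measurable.

(** * Convolution operators on bounded functions *)

Section convolution.
Context {R : realType}.
Local Notation V := (R * R)%type.
Implicit Types (mu nu : probability V R) (f g : V -> R) (s : V).

(** Convolution acts on test functions instead of measures, so [n] iterations give the expectation
    over [n] independent increments as a function of the starting point, without a product space of
    [n] factors. *)
Definition conv mu f (s : V) : R := \int[mu]_x f (s + x).

Lemma measurable_addV : measurable_fun [set: V * V] (fun z => z.1 + z.2).
Proof.
have m1 := @measurable_fst _ _ V V; have m2 := @measurable_snd _ _ V V.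
apply: measurable_fun_pair => /=; apply: measurable_funD.
- exact: (measurableT_comp (@measurable_fst _ _ R R) m1).
- exact: (measurableT_comp (@measurable_fst _ _ R R) m2).
- exact: (measurableT_comp (@measurable_snd _ _ R R) m1).
- exact: (measurableT_comp (@measurable_snd _ _ R R) m2).
Qed.

Lemma measurable_funDV d (T : measurableType d) (f g : T -> V) :
  measurable_fun setT f -> measurable_fun setT g ->
  measurable_fun setT (fun x => f x + g x).
Proof.
move=> mf mg.
exact: (measurableT_comp measurable_addV (measurable_fun_pair mf mg)).
Qed.

Lemma bmeas_shift f s : bmeas f -> bmeas (fun x => f (s + x)).
Proof. by move=> bf; apply: bmeas_comp bf; exact: measurable_funDV. Qed.

Lemma bmeas_conv mu f : bmeas f -> bmeas (conv mu f).
Proof.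
move=> bf; apply: (@bmeas_Rintegral _ _ _ _ _ mu mu (fun z => f (z.1 + z.2))).
exact: bmeas_comp measurable_addV bf.
Qed.

Lemma bmeas_iter_conv mu f n : bmeas f -> bmeas (iter n (conv mu) f).
Proof. by move=> bf; elim: n => //= n; exact: bmeas_conv. Qed.

Lemma conv_norm_le mu f (c : R) s : bmeas f -> (forall x, `|f x| <= c) ->
  `|conv mu f s| <= c.
Proof.
by move=> bf fc; apply: Rintegral_norm_le => //; exact/bmeas_integrable/bmeas_shift.
Qed.

Lemma convB mu f g s : bmeas f -> bmeas g ->
  conv mu (fun x => f x - g x) s = conv mu f s - conv mu g s.
Proof.
move=> bf bg; rewrite /conv RintegralB//; exact/bmeas_integrable/bmeas_shift.
Qed.

Lemma convC mu nu f s : bmeas f -> conv mu (conv nu f) s = conv nu (conv mu f) s.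
Proof.
move=> bf; rewrite /conv.
have B : bmeas (fun z : V * V => f (s + z.1 + z.2)).
  apply: (bmeas_comp (h := fun z : V * V => s + z.1 + z.2)) bf.
  by apply: measurable_funDV => //; exact: measurable_funDV.
rewrite (Rfubini mu nu B); apply: eq_Rintegral => y _; apply: eq_Rintegral => x _ /=.
by rewrite addrAC.
Qed.

Lemma iter_convC mu nu f n s : bmeas f ->
  conv mu (iter n (conv nu) f) s = iter n (conv nu) (conv mu f) s.
Proof.
move=> bf; elim: n s => //= n IH s.
rewrite convC; last exact: bmeas_iter_conv.
by congr (conv _ _ _); apply/funext => x; exact: IH.
Qed.

Lemma iter_conv_norm_le mu f (c : R) n s : bmeas f -> (forall x, `|f x| <= c) ->
  `|iter n (conv mu) f s| <= c.
Proof.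
move=> bf fc; elim: n s => //= n IH s.
by apply: conv_norm_le IH; exact: bmeas_iter_conv.
Qed.

Lemma iter_convB mu f g n s : bmeas f -> bmeas g ->
  iter n (conv mu) (fun x => f x - g x) s = iter n (conv mu) f s - iter n (conv mu) g s.
Proof.
move=> bf bg; elim: n s => //= n IH s; rewrite -convB; [|exact: bmeas_iter_conv..].
by congr (conv _ _ _); apply/funext.
Qed.

(* Lindeberg replacement: as convolution operators commute and are contractions,
   only the difference of one step, applied to [f] itself, has to be estimated. *)
Lemma iter_conv_dist mu nu f (c : R) n s : bmeas f ->
  (forall x, `|conv mu f x - conv nu f x| <= c) ->
  `|iter n (conv mu) f s - iter n (conv nu) f s| <= n%:R * c.
Proof.
move=> bf fc; elim: n s => [s|n IH s]; first by rewrite subrr normr0 mul0r.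
have bm m k : bmeas (iter k (conv m) f) by exact: bmeas_iter_conv.
have -> : iter n.+1 (conv mu) f s - iter n.+1 (conv nu) f s =
    conv mu (fun x => iter n (conv mu) f x - iter n (conv nu) f x) s +
    iter n (conv nu) (fun x => conv mu f x - conv nu f x) s.
  rewrite convB// iter_convB; [|exact: bmeas_conv..].
  by rewrite -iter_convC// -iterSr /=; ring.
rewrite -natr1 mulrDl mul1r; apply: le_trans (ler_normD _ _) _; apply: lerD.
  by apply: conv_norm_le => //; exact: bmeasB.
by apply: iter_conv_norm_le => //; apply: bmeasB; exact: bmeas_conv.
Qed.

End convolution.

(** * Expectations of partial sums of the data *)

Section sums_of_independent.
Context {R : realType} d (Omega : measurableType d) (P : probability Omega R).
Local Notation V := (R * R)%type.
Variables (X : nat -> {RV P >-> V}) (F : probability V R).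
Hypothesis X_indep : mutually_independent X.
Hypothesis X_law : forall (i : nat) (A : set V),
  measurable A -> distribution P (X i) A = F A.
Variable W : {mfun V >-> V}.

Definition psum n (w : Omega) : V := \sum_(i < n) W (X i w).

Lemma psumS n w : psum n.+1 w = psum n w + W (X n w).
Proof. by rewrite /psum big_ord_recr. Qed.

Lemma measurable_psum n : measurable_fun setT (psum n).
Proof.
elim: n => [|n IH].
  by rewrite (_ : psum 0 = cst 0)//; apply/funext => w; rewrite /psum big_ord0.
rewrite (_ : psum n.+1 = fun w => psum n w + (W \o X n) w); last first.
  by apply/funext => w; rewrite psumS.
by apply: measurable_funDV => //; exact: measurableT_comp.
Qed.

HB.instance Definition _ n := isMeasurableFun.Build _ _ _ _ (psum n) (measurable_psum n).

Let cylinder (J : {fset nat}) (A : nat -> set V) :=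
  \bigcap_(j in [set` J]) (X j @^-1` A j).

Let measurable_cylinder J A : (forall j, j \in J -> measurable (A j)) ->
  measurable (cylinder J A).
Proof.
move=> mA; apply: bigcap_measurableType => // j Jj.
by rewrite -[_ @^-1` _]setTI; apply: measurable_funPT => //; exact: mA.
Qed.

Definition pair_psum n (w : Omega) : V * V := (psum n w, X n w).

Lemma measurable_pair_psum n : measurable_fun setT (pair_psum n).
Proof. by apply: measurable_fun_pair => //; exact: measurable_psum. Qed.

HB.instance Definition _ n :=
  isMeasurableFun.Build _ _ _ _ (pair_psum n) (measurable_pair_psum n).

Local Open Scope ereal_scope.

(** Independence is given on rectangles, whereas an event about [psum n w + W (X n w)] is in general
    not a rectangle. Both sides are finite measures in [G] that agree on rectangles, and uniqueness
    of the product measure extends the equality. The independence of [psum n] is a premise because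
    this statement is also the inductive step that proves it. *)
Let joint_law n (J : {fset nat}) A :
  (forall (J : {fset nat}) A E, (forall j, j \in J -> (n <= j)%N) ->
    (forall j, j \in J -> measurable (A j)) -> measurable E ->
    P (psum n @^-1` E `&` cylinder J A) = P (psum n @^-1` E) * P (cylinder J A)) ->
  (forall j, j \in J -> (n < j)%N) -> (forall j, j \in J -> measurable (A j)) ->
  forall G, measurable G -> P (pair_psum n @^-1` G `&` cylinder J A) =
    (distribution P (psum n) \x F) G * P (cylinder J A).
Proof.
move=> IH Jn mA; set C := cylinder J A => G mG.
have mC : measurable C by exact: measurable_cylinder.
have mpG G' : measurable G' -> measurable (pair_psum n @^-1` G').
  by move=> mG'; rewrite -[_ @^-1` _]setTI; exact: measurable_pair_psum.
(* Uniqueness is invoked for a measure normalized by [P C], so a null cylinder is treated apart;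
   there both sides vanish. *)
have [PC0|PC0] := eqVneq (P C) 0.
  rewrite PC0 mule0; apply/eqP; rewrite eq_le measure_ge0 andbT -PC0.
  have mI : measurable (pair_psum n @^-1` G `&` C) by apply: measurableI => //; exact: mpG.
  by apply: le_measure; rewrite ?inE.
have Pfin : P C \is a fin_num by exact: fin_num_measure.
have c0 : (0 <= (fine (P C))^-1)%R by rewrite invr_ge0 fine_ge0.
pose m0 : {measure set (V * V) -> \bar R} :=
  measure_function_pushforward__canonical__measure_function_Measure
    (mrestr P mC) (measurable_pair_psum n).
pose m' := mscale (NngNum c0) m0.
suff -> : (distribution P (psum n) \x F) G = m' G.
  rewrite /m' /mscale/= /m0/= /pushforward /mrestr muleAC -{2}(fineK Pfin) -EFinM mulVf ?mul1e//.
  by rewrite fine_eq0.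
apply: (@product_measure_unique _ _ _ _ R (distribution P (psum n)) F
  (mscale (NngNum c0) m0)) => // A1 B1 mA1 mB1.
(* The condition on [X n] joins the cylinder, as a new index because all indices in [J] exceed
   [n]. *)
pose J' := (n |` J)%fset; pose A' j := if j == n then B1 else A j.
have nJ : n \notin J by apply/negP => /Jn; rewrite ltnn.
have AA' j : j \in J -> A' j = A j.
  by rewrite /A'; case: eqP => // -> nJ'; rewrite nJ' in nJ.
have mA' j : j \in J' -> measurable (A' j).
  by rewrite !inE => /orP[/eqP ->|jJ]; [rewrite /A' eqxx|rewrite AA'//; exact: mA].
have CE : cylinder J' A' = X n @^-1` B1 `&` C.
  rewrite /cylinder /J' set_fsetU1 bigcap_setU1 /A' eqxx; congr (_ `&` _).
  by apply: eq_bigcapr => j /= jJ; rewrite -/(A' j) AA'.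
have PCE : P (cylinder J' A') = F B1 * P C.
  rewrite [LHS]X_indep// big_fsetU1//= {1}/A' eqxx; congr (_ * _).
    by rewrite -(X_law n).
  rewrite [RHS]X_indep//.
  by rewrite big_seq [RHS]big_seq; apply: eq_bigr => j jJ; rewrite AA'.
transitivity ((fine (P C))^-1%:E * P (pair_psum n @^-1` (A1 `*` B1) `&` C)) => //.
have -> : pair_psum n @^-1` (A1 `*` B1) `&` C = psum n @^-1` A1 `&` cylinder J' A'.
  by rewrite CE setIA.
rewrite IH//; last first.
  by move=> j; rewrite !inE => /orP[/eqP ->//|/Jn/ltnW].
rewrite PCE muleCA; congr (_ * _); rewrite muleCA -{2}(fineK Pfin) -EFinM mulVf ?mule1//.
by rewrite fine_eq0.
Qed.

(** A whole cylinder of later variables is carried along: each induction step spends [X n] and must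
    remain independent of the others. *)
Let psum_indep n : forall (J : {fset nat}) A E, (forall j, j \in J -> (n <= j)%N) ->
    (forall j, j \in J -> measurable (A j)) -> measurable E ->
    P (psum n @^-1` E `&` cylinder J A) = P (psum n @^-1` E) * P (cylinder J A).
Proof.
elim: n => [|n IH] J A E Jn mA mE.
  have S0 w : psum 0 w = 0%R by rewrite /psum big_ord0.
  have [E0|E0] := pselect (E 0%R).
    rewrite (_ : psum 0 @^-1` E = setT) ?setTI ?probability_setT ?mul1e//.
    by apply/seteqP; split => // w _ /=; rewrite S0.
  rewrite (_ : psum 0 @^-1` E = set0) ?set0I ?measure0 ?mul0e//.
  by apply/seteqP; split => // w /=; rewrite S0.
pose G := [set z : V * V | E (z.1 + W z.2)%R].
have mG : measurable G.
  rewrite -[G]setTI; apply: measurable_funDV => //.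
  exact: (measurableT_comp (@measurable_funPT _ _ _ _ W) measurable_snd).
have -> : psum n.+1 @^-1` E = pair_psum n @^-1` G.
  by apply/seteqP; split => w; rewrite /G /= psumS.
rewrite (joint_law IH)//; congr (_ * _).
have := @joint_law n fset0 (fun=> setT) IH _ _ G mG.
rewrite (_ : cylinder fset0 _ = setT) ?setIT ?probability_setT ?mule1; first by move=> ->.
by rewrite /cylinder (_ : [set` fset0] = set0) ?bigcap_set0//; apply/seteqP; split.
Qed.

Lemma psum_joint_law n G : measurable G ->
  P ((fun w => (psum n w, X n w)) @^-1` G) = (distribution P (psum n) \x F) G.
Proof.
move=> mG; have := @joint_law n fset0 (fun=> setT) (@psum_indep n) _ _ G mG.
rewrite (_ : cylinder fset0 _ = setT) ?setIT ?probability_setT ?mule1; first by move=> ->.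
by rewrite /cylinder (_ : [set` fset0] = set0) ?bigcap_set0//; apply/seteqP; split.
Qed.

Local Close Scope ereal_scope.

(** Integrating out the last summand replaces [f] by its convolution, so the induction on [n] runs
    over all [f]; the value is taken at 0, the empty sum. *)
Lemma Rintegral_psum n (f : V -> R) : bmeas f ->
  \int[P]_w f (psum n w) = iter n (conv (distribution F W)) f 0.
Proof.
elim: n f => [|n IH] f bf.
  rewrite /= -[RHS](Rintegral_cst1 P); apply: eq_Rintegral => w _.
  by rewrite /psum big_ord0.
rewrite iterSr -IH; last exact: bmeas_conv.
pose h (z : V * V) := f (z.1 + W z.2).
have bh : bmeas h.
  apply: (bmeas_comp (h := fun z : V * V => z.1 + W z.2)) bf.
  apply: measurable_funDV => //.
  exact: (measurableT_comp (@measurable_funPT _ _ _ _ W) measurable_snd).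
transitivity (\int[(distribution P (psum n) \x F)%E]_z h z).
  transitivity (\int[P]_w h (pair_psum n w)).
    by apply: eq_Rintegral => w _; rewrite /h/= psumS.
  rewrite -[LHS](@Rintegral_distribution _ _ _ _ _ P (pair_psum n : {mfun _ >-> _}) h)//.
  rewrite /Rintegral; congr fine; apply: eq_measure_integral => A mA _.
  exact: (psum_joint_law n mA).
rewrite Rintegral_prod// Rintegral_distribution.
  apply: eq_Rintegral => w _; rewrite /conv Rintegral_distribution//.
  exact: bmeas_shift.
exact: (bmeas_Rintegral (distribution P (psum n)) F bh).
Qed.

End sums_of_independent.

(** * Lindeberg's comparison *)

Section real_integrable.
Context {R : realType} d (T : measurableType d) (mu : probability T R).
Implicit Types f g : T -> R.

Definition rint f := mu.-integrable setT (EFin \o f).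

Lemma rintD f g : rint f -> rint g -> rint (fun x => f x + g x).
Proof. by move=> rf rg; exact: (integrableD measurableT rf rg). Qed.

Lemma rintB f g : rint f -> rint g -> rint (fun x => f x - g x).
Proof. by move=> rf rg; exact: (integrableB measurableT rf rg). Qed.

Lemma rintZ (c : R) f : rint f -> rint (fun x => c * f x).
Proof. by move=> rf; exact: (integrableZl measurableT c rf). Qed.

Lemma rint_cst (c : R) : rint (fun _ => c).
Proof. exact/bmeas_integrable/bmeas_cst. Qed.

Lemma rint_norm f : rint f -> rint (fun x => `|f x|).
Proof. by move=> rf; exact: (integrable_norm rf). Qed.

Lemma rint_le f g : measurable_fun setT f -> rint g ->
  (forall x, `|f x| <= g x) -> rint f.
Proof.
move=> mf rg fg; apply: le_integrable rg => //; first exact/measurable_EFinP.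
move=> x _ /=; rewrite lee_fin; apply: le_trans (fg x) _; exact: ler_norm.
Qed.

Lemma rint_measurable f : rint f -> measurable_fun setT f.
Proof. by move=> /integrableP[/measurable_EFinP]. Qed.

Lemma rintegralD f g : rint f -> rint g ->
  \int[mu]_x (f x + g x) = \int[mu]_x f x + \int[mu]_x g x.
Proof. by move=> *; exact: RintegralD. Qed.

Lemma rintegralZ (c : R) f : rint f -> \int[mu]_x (c * f x) = c * \int[mu]_x f x.
Proof. by move=> *; exact: RintegralZl. Qed.

(** Dominated convergence with majorant [q]. It serves twice: with [q] the square of [m] for
    Lindeberg's condition, and with [q = m] for the law of large numbers. *)
Lemma trunc_integral_cvg0 (q m : T -> R) (c : nat -> R) : rint q ->
  measurable_fun setT m -> (forall x, 0 <= q x) -> (forall x, 0 <= m x) ->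
  (forall n, 0 <= c n) -> c n @[n --> \oo] --> 0 ->
  \int[mu]_x (q x * Num.min 1 (c n * m x)) @[n --> \oo] --> 0.
Proof.
move=> rq mm q0 m0 c0 cc.
have mf n : measurable_fun setT (fun x => q x * Num.min 1 (c n * m x)).
  apply: measurable_funM; first exact: rint_measurable.
  by apply: measurable_minr => //; exact: measurable_funM.
have b n x : 0 <= q x * Num.min 1 (c n * m x) <= q x.
  rewrite mulr_ge0//=; last by rewrite le_min ler01 mulr_ge0.
  by rewrite ler_piMr// ge_min lexx.
have H0 : {ae mu, forall x, setT x ->
    (q x * Num.min 1 (c n * m x))%:E @[n --> \oo] --> (0%:E : \bar R)}.
  apply: aeW => x _; apply: cvg_EFin; first exact: nearW.
  have L : q x * (c n * m x) @[n --> \oo] --> (0 : R).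
    rewrite -[X in _ --> X](mulr0 (q x)); apply: cvgMl_tmp => //.
    by rewrite -[X in _ --> X](mul0r (m x)); apply: cvgMr_tmp.
  apply: squeeze_cvgr (cvg_cst 0) L; apply: nearW => n /=.
  by have /andP[-> _] /= := b n x; rewrite ler_wpM2l// ge_min lexx orbT.
have H1 : {ae mu, forall x, forall n, setT x ->
    (`|(q x * Num.min 1 (c n * m x))%:E| <= (EFin \o q) x)%E}.
  by apply: aeW => x n _ /=; rewrite lee_fin ger0_norm; have /andP[] := b n x.
have mfE n : measurable_fun setT (fun x => (q x * Num.min 1 (c n * m x))%:E).
  exact/measurable_EFinP.
have [_ _ H] := dominated_convergence measurableT mfE (measurable_cst _) H0 rq H1.
rewrite integral0 in H; exact: (fine_cvg H).
Qed.

End real_integrable.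

Section expansion.
Context {R : realType}.
Local Notation V := (R * R)%type.

(** For [m >= 0], the minimum of the square and the cube: negligible near 0 against second-order
    terms, and integrable as soon as the square is. *)
Definition cube_trunc (m : R) : R := m ^+ 2 * Num.min 1 m.

Definition expandable (f : V -> R) := bmeas f /\
  exists (f1 f2 f11 f12 f22 : V -> R) (C : R), 0 <= C /\ forall s u v,
    `|f (s + (u, v)) - f s - f1 s * u - f2 s * v - f11 s / 2 * u ^+ 2
       - f12 s * (u * v) - f22 s / 2 * v ^+ 2| <= C * cube_trunc (`|u| + `|v|).

Lemma cube_trunc_small (m : R) : m <= 1 -> cube_trunc m = m ^+ 3.
Proof. by move=> m1; rewrite /cube_trunc min_r// -exprSr. Qed.

Lemma cube_trunc_large (m : R) : 1 <= m -> cube_trunc m = m ^+ 2.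
Proof. by move=> m1; rewrite /cube_trunc min_l// mulr1. Qed.

Let ler_norm_sum7 (x1 x2 x3 x4 x5 x6 x7 q : R) : `|x1| <= q -> `|x2| <= q ->
  `|x3| <= q -> `|x4| <= q -> `|x5| <= q -> `|x6| <= q -> `|x7| <= q ->
  `|x1 + (x2 + (x3 + (x4 + (x5 + (x6 + x7)))))| <= 10 * q.
Proof. by rewrite !ler_norml; lra. Qed.

Lemma expandable_prod (g h : R -> R) : taylor2 g -> taylor2 h ->
  expandable (fun z => g z.1 * h z.2).
Proof.
move=> [g1 [g2 [C [mg gC gT]]]] [h1 [h2 [D [mh hD hT]]]].
have mg' := continuous_measurable_fun mg; have mh' := continuous_measurable_fun mh.
have C0 : 0 <= C by apply: le_trans (normr_ge0 (g 0)) _; have [] := gC 0.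
have D0 : 0 <= D by apply: le_trans (normr_ge0 (h 0)) _; have [] := hD 0.
split.
  apply: bmeasM; split; [exact: measurableT_comp| |exact: measurableT_comp|].
    by exists C => x; have [] := gC x.1.
  by exists D => x; have [] := hD x.2.
exists (fun s => g1 s.1 * h s.2), (fun s => g s.1 * h1 s.2),
  (fun s => g2 s.1 * h s.2), (fun s => g1 s.1 * h1 s.2), (fun s => g s.1 * h2 s.2),
  (10 * (C * D)); split; first by rewrite !mulr_ge0.
move=> [s r] u v /=.
have [G0 [G1 G2]] := gC s; have [H0 [H1 H2]] := hD r.
have [G0' _] := gC (s + u); have [H0' _] := hD (r + v).
have TG := gT s u; have TH := hT r v.
have [u0 v0] : 0 <= `|u| /\ 0 <= `|v| by split.
have CD : 0 <= C * D by exact: mulr_ge0.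
have P (x y : R) : `|x| <= C -> `|y| <= D -> `|x * y| <= C * D.
  by move=> *; rewrite normrM ler_pM.
set m := `|u| + `|v|.
have m0 : 0 <= m by rewrite addr_ge0.
have um : `|u| <= m by rewrite lerDl.
have vm : `|v| <= m by rewrite lerDr.
(* Small increments: multiplying the two Taylor expansions leaves seven terms of degree at least 3.
   Large increments: each of the seven terms of the difference is at most [C * D * m ^+ 2] by
   itself. *)
have [m1|m1] := leP m 1.
- rewrite cube_trunc_small//.
  set Rg := g (s + u) - g s - g1 s * u - g2 s / 2 * u ^+ 2 in TG.
  set Rh := h (r + v) - h r - h1 r * v - h2 r / 2 * v ^+ 2 in TH.
  have -> : g (s + u) * h (r + v) - g s * h r - g1 s * h r * u - g s * h1 r * v
     - g2 s * h r / 2 * u ^+ 2 - g1 s * h1 r * (u * v) - g s * h2 r / 2 * v ^+ 2 =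
     Rg * h (r + v) + (g s * Rh + (g1 s * Rh * u + (g2 s / 2 * Rh * u ^+ 2 +
     (g1 s * h2 r / 2 * (u * v ^+ 2) + (g2 s * h1 r / 2 * (u ^+ 2 * v) +
     g2 s * h2 r / 4 * (u ^+ 2 * v ^+ 2)))))).
    by rewrite /Rg /Rh; field.
  have u3 : `|u| ^+ 3 <= m ^+ 3 by rewrite lerXn2r// nnegrE.
  have v3 : `|v| ^+ 3 <= m ^+ 3 by rewrite lerXn2r// nnegrE.
  have m3 : 0 <= m ^+ 3 by rewrite exprn_ge0.
  have u1 : `|u| <= 1 by lra.
  have v1 : `|v| <= 1 by lra.
  have uu1 : `|u ^+ 2| <= 1 by rewrite normrX exprn_ile1.
  have RgE : `|Rg| <= C * m ^+ 3 by apply: le_trans TG _; rewrite ler_wpM2l.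
  have RhE : `|Rh| <= D * m ^+ 3 by apply: le_trans TH _; rewrite ler_wpM2l.
  have t1 : `|Rg * h (r + v)| <= C * D * m ^+ 3.
    by rewrite normrM mulrAC; apply: ler_pM.
  have t2 : `|g s * Rh| <= C * D * m ^+ 3.
    by rewrite normrM -mulrA; apply: ler_pM.
  have t3 : `|g1 s * Rh * u| <= C * D * m ^+ 3.
    rewrite normrM -[leRHS]mulr1 normrM -mulrA.
    by rewrite mulrA -(mulrA C) ler_pM// ?mulr_ge0// ler_pM.
  have half (x c : R) : `|x| <= c -> `|x / 2| <= c.
    move=> xc; rewrite normrM (ger0_norm (_ : 0 <= 2^-1))//.
    by have := normr_ge0 x; lra.
  have quarter (x c : R) : `|x| <= c -> `|x / 4| <= c.
    move=> xc; rewrite normrM (ger0_norm (_ : 0 <= 4^-1))//.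
    by have := normr_ge0 x; lra.
  have t4 : `|g2 s / 2 * Rh * u ^+ 2| <= C * D * m ^+ 3.
    rewrite normrM -[leRHS]mulr1 normrM.
    by rewrite -(mulrA C) ler_pM// ?mulr_ge0// ler_pM// half.
  have pw i j : (i <= 2)%N -> (j <= 2)%N -> (i + j >= 3)%N -> `|u ^+ i * v ^+ j| <= m ^+ 3.
    move=> i2 j2 ij; rewrite normrM !normrX.
    apply: (@le_trans _ _ (m ^+ i * m ^+ j)).
      by rewrite ler_pM ?exprn_ge0// lerXn2r// nnegrE.
    by rewrite -exprD; apply: ler_wiXn2l.
  have t5 : `|g1 s * h2 r / 2 * (u * v ^+ 2)| <= C * D * m ^+ 3.
    by rewrite normrM ler_pM// ?half ?P//; exact: (pw 1%N 2%N).
  have t6 : `|g2 s * h1 r / 2 * (u ^+ 2 * v)| <= C * D * m ^+ 3.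
    by rewrite normrM ler_pM// ?half ?P//; exact: (pw 2%N 1%N).
  have t7 : `|g2 s * h2 r / 4 * (u ^+ 2 * v ^+ 2)| <= C * D * m ^+ 3.
    by rewrite normrM ler_pM// ?quarter ?P//; exact: (pw 2%N 2%N).
  by rewrite -[leRHS]mulrA; exact: ler_norm_sum7.
- rewrite cube_trunc_large ?(ltW m1)//.
  have m2 : 1 <= m ^+ 2 by rewrite exprn_ege1// ltW.
  have mm : m <= m ^+ 2 by rewrite expr2 ler_peMl// ltW.
  have q0 : 0 <= C * D * m ^+ 2 by rewrite mulr_ge0// exprn_ge0.
  have B (x y z : R) : `|x| <= C -> `|y| <= D -> `|z| <= m ^+ 2 ->
      `|x * y * z| <= C * D * m ^+ 2.
    by move=> *; rewrite normrM ler_pM// P.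
  have hB (x y z : R) : `|x| <= C -> `|y| <= D -> `|z| <= m ^+ 2 ->
      `|x * y / 2 * z| <= C * D * m ^+ 2.
    move=> *; rewrite mulrAC normrM (ger0_norm (_ : 0 <= 2^-1))//.
    by have := B x y z; have := normr_ge0 (x * y * z); lra.
  rewrite (_ : _ - _ = g (s + u) * h (r + v) * 1 + (- (g s * h r * 1) +
     (- (g1 s * h r * u) + (- (g s * h1 r * v) + (- (g2 s * h r / 2 * u ^+ 2) +
     (- (g1 s * h1 r * (u * v)) + - (g s * h2 r / 2 * v ^+ 2))))))); last by ring.
  have u2 : `|u ^+ 2| <= m ^+ 2 by rewrite normrX lerXn2r// nnegrE.
  have v2 : `|v ^+ 2| <= m ^+ 2 by rewrite normrX lerXn2r// nnegrE.
  have uv : `|u * v| <= m ^+ 2 by rewrite normrM expr2 ler_pM.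
  have um2 := le_trans um mm; have vm2 := le_trans vm mm.
  by rewrite -[leRHS]mulrA; apply: ler_norm_sum7; rewrite ?normrN; (apply: hB || apply: B) => //; rewrite ?normr1.
Qed.

End expansion.

Section lindeberg.
Context {R : realType} d (T : measurableType d) (mu : probability T R).
Local Notation V := (R * R)%type.
Implicit Types a b : {mfun T >-> R}.

Definition scaled_pair (c : R) (a b : T -> R) (x : T) : V := (c * a x, c * b x).

Lemma measurable_scaled_pair c a b : measurable_fun setT (scaled_pair c a b).
Proof. by apply: measurable_fun_pair; apply: measurable_funM. Qed.

HB.instance Definition _ c a b :=
  isMeasurableFun.Build _ _ _ _ (scaled_pair c a b) (measurable_scaled_pair c a b).

Definition scaled_law (c : R) a b : probability V R :=
  distribution mu (scaled_pair c a b : {mfun T >-> V}).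

Lemma conv_scaled_law c a b (f : V -> R) s : bmeas f ->
  conv (scaled_law c a b) f s = \int[mu]_x f (s + (c * a x, c * b x)).
Proof.
move=> bf; rewrite /conv /scaled_law.
by rewrite Rintegral_distribution//; exact: bmeas_shift.
Qed.

Definition standard_pair a b :=
  [/\ rint mu (fun x => a x ^+ 2), rint mu (fun x => b x ^+ 2),
      \int[mu]_x a x = 0 & \int[mu]_x b x = 0] /\
  [/\ \int[mu]_x (a x ^+ 2) = 1, \int[mu]_x (b x ^+ 2) = 1 &
      \int[mu]_x (a x * b x) = 0].

Lemma rint_mul a b : rint mu (fun x => a x ^+ 2) -> rint mu (fun x => b x ^+ 2) ->
  rint mu (fun x => a x * b x).
Proof.
move=> ra rb; apply: rint_le (rintD ra rb) _; first exact: measurable_funM.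
move=> x; rewrite normrM -(real_normK (num_real (a x))) -(real_normK (num_real (b x))).
by have := sqr_ge0 (`|a x| - `|b x|); have := sqr_ge0 (`|a x|); have := sqr_ge0 (`|b x|); nra.
Qed.

Lemma rint_of_sqr a : rint mu (fun x => a x ^+ 2) -> rint mu a.
Proof.
move=> ra; apply: rint_le (rintD ra (rint_cst _ 1)) _ => // x.
rewrite -(real_normK (num_real (a x))).
by have := sqr_ge0 (`|a x| - 1); nra.
Qed.

(** The integral involves only the moments fixed by [standard_pair], so it is the same for every
    standard pair; this is why two such laws can be exchanged to second order. *)
Lemma standard_quadratic a b (k0 k1 k2 k3 k4 k5 : R) : standard_pair a b ->
  let Q x := k0 + (k1 * a x + (k2 * b x + (k3 * a x ^+ 2 +
               (k4 * (a x * b x) + k5 * b x ^+ 2)))) in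
  rint mu Q /\ \int[mu]_x Q x = k0 + k3 + k5.
Proof.
move=> [[ra rb a0 b0] [a1 b1 ab]] Q.
have rab := rint_mul ra rb; have ra' := rint_of_sqr ra; have rb' := rint_of_sqr rb.
have r5 := rintZ k5 rb; have r4 := rintZ k4 rab; have r3 := rintZ k3 ra.
have r2 := rintZ k2 rb'; have r1 := rintZ k1 ra'; have r0 := rint_cst mu k0.
have r45 := rintD r4 r5; have r345 := rintD r3 r45; have r2345 := rintD r2 r345.
have r12345 := rintD r1 r2345.
split; first exact: rintD.
rewrite /Q rintegralD// rintegralD// rintegralD// rintegralD// rintegralD//.
by rewrite !rintegralZ// a0 b0 a1 b1 ab Rintegral_cst1; ring.
Qed.

(** Lindeberg's functional with a continuous truncation: [c ^+ 2] times it is the integral of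
    [cube_trunc] of the increment scaled by [c]. *)
Definition lind a b (c : R) : R :=
  \int[mu]_x ((`|a x| + `|b x|) ^+ 2 * Num.min 1 (c * (`|a x| + `|b x|))).

Lemma rint_norm_add_sqr a b : standard_pair a b ->
  rint mu (fun x => (`|a x| + `|b x|) ^+ 2).
Proof.
move=> [[ra rb _ _] _].
apply: rint_le (rintZ 2 (rintD ra rb)) _.
  by apply: measurable_funX; apply: measurable_funD; exact: measurableT_comp.
move=> x; rewrite ger0_norm ?sqr_ge0//.
rewrite -(real_normK (num_real (a x))) -(real_normK (num_real (b x))).
by have := sqr_ge0 (`|a x| - `|b x|); nra.
Qed.

Lemma measurable_norm_add a b : measurable_fun setT (fun x => `|a x| + `|b x|).
Proof. by apply: measurable_funD; exact: measurableT_comp. Qed.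

Lemma rint_lind a b c : 0 <= c -> standard_pair a b ->
  rint mu (fun x => (`|a x| + `|b x|) ^+ 2 * Num.min 1 (c * (`|a x| + `|b x|))).
Proof.
move=> c0 st; have mn := measurable_norm_add a b.
apply: rint_le (rint_norm_add_sqr st) _.
  apply: measurable_funM; first exact: measurable_funX.
  by apply: measurable_minr => //; exact: measurable_funM.
move=> x; rewrite ger0_norm.
  by rewrite ler_piMr ?sqr_ge0// ge_min lexx.
by rewrite mulr_ge0 ?sqr_ge0// le_min ler01 mulr_ge0// addr_ge0.
Qed.

Lemma lind_cvg0 a b : standard_pair a b ->
  lind a b (Num.sqrt n%:R)^-1 @[n --> \oo] --> 0.
Proof.
move=> st; apply: trunc_integral_cvg0.
- exact: rint_norm_add_sqr.
- exact: measurable_norm_add.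
- by move=> x; exact: sqr_ge0.
- by move=> x; rewrite addr_ge0.
- by move=> n; rewrite invr_ge0.
- apply/cvgrPdist_lt => e e0; near=> n.
  have n0 : (0 : R) < n%:R by rewrite ltr0n; near: n; exact: nbhs_infty_gt.
  rewrite sub0r normrN ger0_norm ?invr_ge0// -(invrK e).
  rewrite ltf_pV2 ?posrE ?invr_gt0 ?sqrtr_gt0//.
  rewrite -(@gtr0_norm _ e^-1) ?invr_gt0// -sqrtr_sqr ltr_sqrt//.
  by near: n; exact: nbhs_infty_gtr.
Unshelve. all: by end_near. Qed.

End lindeberg.

Section lindeberg_comparison.
Context {R : realType}.
Local Notation V := (R * R)%type.

(** The comparison value is one step of a discrete heat flow and does not depend on [mu]. Linear and
    mixed terms vanish by centering and lack of correlation, which leaves only the integrated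
    remainder. *)
Lemma conv_taylor d (T : measurableType d) (mu : probability T R) (a b : {mfun T >-> R})
    (c : R) (f f1 f2 f11 f12 f22 : V -> R) (C : R) s :
  0 <= c -> 0 <= C -> standard_pair mu a b -> bmeas f ->
  (forall s u v,
    `|f (s + (u, v)) - f s - f1 s * u - f2 s * v - f11 s / 2 * u ^+ 2
       - f12 s * (u * v) - f22 s / 2 * v ^+ 2| <= C * cube_trunc (`|u| + `|v|)) ->
  `|conv (scaled_law mu c a b) f s - (f s + c ^+ 2 * ((f11 s + f22 s) / 2))| <=
     C * c ^+ 2 * lind mu a b c.
Proof.
move=> c0 C0 st bf fT.
have [rQ iQ] := standard_quadratic (f s) (c * f1 s) (c * f2 s) (c ^+ 2 * f11 s / 2)
  (c ^+ 2 * f12 s) (c ^+ 2 * f22 s / 2) st.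
set Q := (fun x => _) in rQ iQ.
have rl := rint_lind c0 st.
have bfs : rint mu (fun x => f (s + (c * a x, c * b x))).
  apply: bmeas_integrable; apply: (bmeas_comp (h := fun x => s + scaled_pair c a b x)) bf.
  by apply: measurable_funDV => //; exact: measurable_scaled_pair.
rewrite conv_scaled_law// (_ : f s + _ = \int[mu]_x Q x); last by rewrite iQ; field.
rewrite -RintegralB//.
apply: le_trans (le_normr_Rintegral measurableT (rintB bfs rQ)) _.
rewrite -rintegralZ//; apply: Rintegral_le.
- exact: rint_norm (rintB bfs rQ).
- exact: rintZ.
move=> x; rewrite (_ : f _ - Q x = f (s + (c * a x, c * b x)) - f s - f1 s * (c * a x)
   - f2 s * (c * b x) - f11 s / 2 * (c * a x) ^+ 2
   - f12 s * ((c * a x) * (c * b x)) - f22 s / 2 * (c * b x) ^+ 2); last first.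
  by rewrite /Q; field.
apply: le_trans (fT _ _ _) _.
rewrite !normrM (ger0_norm c0) -mulrDr /cube_trunc exprMn.
by rewrite !mulrA lexx.
Qed.

Lemma lindeberg_comparison d1 d2 (T1 : measurableType d1) (T2 : measurableType d2)
    (mu1 : probability T1 R) (mu2 : probability T2 R) (a1 b1 : {mfun T1 >-> R})
    (a2 b2 : {mfun T2 >-> R}) (f : V -> R) :
  standard_pair mu1 a1 b1 -> standard_pair mu2 a2 b2 -> expandable f ->
  (iter n (conv (scaled_law mu1 (Num.sqrt n%:R)^-1 a1 b1)) f 0 -
   iter n (conv (scaled_law mu2 (Num.sqrt n%:R)^-1 a2 b2)) f 0) @[n --> \oo] --> 0.
Proof.
move=> st1 st2 [bf [f1 [f2 [f11 [f12 [f22 [C [C0 fT]]]]]]]].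
have L : C * (lind mu1 a1 b1 (Num.sqrt n%:R)^-1 + lind mu2 a2 b2 (Num.sqrt n%:R)^-1)
    @[n --> \oo] --> 0.
  rewrite -[X in _ --> X](mulr0 C) -[X in _ --> C * X](addr0 0); apply: cvgMl_tmp.
  by apply: cvgD; exact: lind_cvg0.
apply/norm_cvg0P; apply: squeeze_cvgr (cvg_cst 0) L.
near=> n; rewrite normr_ge0/=.
have n0 : (0 < n)%N by near: n; exact: nbhs_infty_gt.
set c := (Num.sqrt n%:R)^-1.
have c0 : 0 <= c by rewrite invr_ge0.
(* There are [n] exchanges, each costing [c ^+ 2 = n%:R^-1] times a quantity that tends to 0. *)
apply: le_trans (iter_conv_dist n 0 bf _) (_ : n%:R * (C * c ^+ 2 * (lind mu1 a1 b1 c + lind mu2 a2 b2 c)) <= _).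
  move=> x; have := conv_taylor x c0 C0 st1 bf fT; have := conv_taylor x c0 C0 st2 bf fT.
  by rewrite !ler_norml; lra.
rewrite exprVn sqr_sqrtr//; set l := _ + lind _ _ _ _.
have nn : (n%:R : R) != 0 by rewrite pnatr_eq0 -lt0n.
by rewrite (_ : _ * (_ * l) = C * l)//; field.
Unshelve. all: by end_near. Qed.

End lindeberg_comparison.

(** * The standard normal law *)

Section gaussian.
Context {R : realType}.
Local Notation mR := (measurableTypeR R).
Local Notation leb := (@lebesgue_measure R).

Definition to_R : mR -> R := id.

Lemma measurable_to_R : measurable_fun setT to_R.
Proof. by move=> _ Y mY; rewrite setTI; exact: mY. Qed.

HB.instance Definition _ := isMeasurableFun.Build _ _ _ _ to_R measurable_to_R.

(* [normal_prob] is a law on [measurableTypeR R], whose measure display differs from that of [R]. *)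
Definition gauss : probability R R :=
  distribution (normal_prob (0 : R) 1) (to_R : {mfun mR >-> R}).

Lemma ge0_integral_gauss (f : R -> \bar R) : measurable_fun setT f ->
  (forall x, (0 <= f x)%E) ->
  (\int[gauss]_x f x = \int[normal_prob 0 1]_x f (to_R x))%E.
Proof. by move=> mf f0; rewrite /gauss ge0_integral_distribution. Qed.

Lemma gaussE (A : set R) : gauss A = normal_prob 0 1 A.
Proof. by []. Qed.

Local Open Scope ereal_scope.

(** The Radon-Nikodym derivative of the normal law and [normal_pdf] have the same integrals over
    measurable sets, hence agree almost everywhere. *)
Lemma integral_gauss (f : R -> \bar R) : measurable_fun setT f ->
  (forall x, 0 <= f x) ->
  \int[gauss]_x f x = \int[leb]_x (f x * (normal_pdf 0 1 x)%:E).
Proof.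
move=> mf f0; rewrite /gauss ge0_integral_distribution//.
rewrite -(Radon_Nikodym_SigmaFinite.change_of_variables (normal_prob_dominates 0 1))//.
set g := Radon_Nikodym_SigmaFinite.f _ _.
have ig : leb.-integrable setT g.
  by apply: Radon_Nikodym_SigmaFinite.f_integrable; exact: normal_prob_dominates.
apply: ge0_ae_eq_integral => //.
- by apply: emeasurable_funM => //; exact: measurable_int ig.
- apply: emeasurable_funM => //; apply/measurable_EFinP; exact: measurable_normal_pdf.
- by move=> x _; rewrite mule_ge0// Radon_Nikodym_SigmaFinite.f_ge0//; exact: normal_prob_dominates.
- by move=> x _; rewrite mule_ge0// lee_fin normal_pdf_ge0.
apply: ae_eqe_mul2l; apply: integral_ae_eq => //.
- by apply/measurable_EFinP; exact: measurable_normal_pdf.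
- move=> E _ mE; rewrite -Radon_Nikodym_SigmaFinite.f_integral//.
  exact: normal_prob_dominates.
Qed.

Lemma gauss_set1 (x : R) : gauss [set x] = 0.
Proof.
rewrite gaussE; have /null_content_dominatesP := normal_prob_dominates (0 : R) 1.
by apply => //; exact: lebesgue_measure_set1.
Qed.

Lemma ge0_integral_lebesgueN (f : R -> \bar R) : measurable_fun setT f ->
  (forall x, 0 <= f x) -> \int[leb]_x f (- x)%R = \int[leb]_x f x.
Proof.
move=> mf f0.
have mN : measurable_fun setT (-%R : mR -> mR).
  exact: (@measurable_funN _ _ _ _ (fun x : mR => x) (@measurable_id _ _ _)).
rewrite -[LHS](@ge0_integral_pushforward _ _ _ _ _ (-%R : mR -> mR) mN leb setT f)//.
by apply: eq_measure_integral => A mA _; exact: lebesgue_measureN.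
Qed.

Lemma normal_pdfN (x : R) : normal_pdf 0 1 (- x) = normal_pdf 0 1 x.
Proof. by rewrite normal_pdfE ?oner_neq0// /normal_fun !subr0 sqrrN. Qed.

Lemma integral_gaussN (f : R -> \bar R) : measurable_fun setT f ->
  (forall x, 0 <= f x) -> \int[gauss]_x f (- x)%R = \int[gauss]_x f x.
Proof.
move=> mf f0; rewrite !integral_gauss//; last exact: measurableT_comp.
rewrite -[RHS]ge0_integral_lebesgueN.
- by apply: eq_integral => x _; rewrite normal_pdfN.
- by apply: emeasurable_funM => //; apply/measurable_EFinP; exact: measurable_normal_pdf.
- by move=> x; rewrite mule_ge0// lee_fin normal_pdf_ge0.
Qed.

Local Close Scope ereal_scope.

Lemma normal_pdf_affine (m s y : R) : 0 < s ->
  normal_pdf m s (m + s * y) * s = normal_pdf 0 1 y.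
Proof.
move=> s0; rewrite !normal_pdfE ?gt_eqF ?oner_neq0//.
have -> : normal_peak s = normal_peak (1 : R) / s.
  rewrite /normal_peak -invfM -mulrnAr sqrtrM ?sqr_ge0// sqrtr_sqr gtr0_norm//.
  by rewrite expr1n mul1r mulrC.
rewrite /normal_fun.
have -> : - (m + s * y - m) ^+ 2 / (s ^+ 2 *+ 2) = - (y - 0) ^+ 2 / (1 ^+ 2 *+ 2) :> R.
  by field; rewrite gt_eqF.
by field; rewrite gt_eqF.
Qed.

(** Passing to the density of [m + s * y] makes the argument of [G] the variable of integration, as
    the exchange of integrals in the stability proof requires. *)
Lemma integral_gauss_affine (G : R -> R) (m s : R) : continuous G ->
  (forall x, 0 <= G x) -> 0 < s ->
  (\int[gauss]_y (G (m + s * y))%:E = \int[leb]_z (G z * normal_pdf m s z)%:E)%E.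
Proof.
move=> cG G0 s0; pose F (y : R) : R := m + s * y.
have dF (x : R) : is_derive x (1 : R) F s by apply: is_derive_eq; rewrite /GRing.scale/= ?add0r ?mulr1 ?mul1r. 
have F'E : F^`()%classic = cst s.
  by apply/funext => x; rewrite derive1E; have := dF x; case.
have cF : continuous F.
  by move=> x; apply: cvgD; [exact: cvg_cst|apply: cvgMl_tmp; exact: cvg_id].
have cGF : continuous (fun y => G (F y)).
  by move=> x; exact: (continuous_comp (cF x) (cG _)).
rewrite integral_gauss; last 2 first.
- by apply/measurable_EFinP; exact: continuous_measurable_fun.
- by move=> x; rewrite lee_fin.
rewrite (@increasing_ge0_integration_by_substitutionT _ F (fun z => G z * normal_pdf m s z)).
- apply: eq_integral => y _ /=; rewrite F'E /= -EFinM; congr (_%:E).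
  by rewrite -(normal_pdf_affine m y s0) mulrA.
- by move=> x y xy; rewrite ltrD2l ltr_pM2l.
- by rewrite F'E => x; exact: cvg_cst.
- by rewrite F'E; exact: is_cvg_cst.
- by rewrite F'E; exact: is_cvg_cst.
- by move=> x; have := dF x; case.
- apply/cvgrNyPle => A.
  apply: filterS (nbhs_ninfty_le (num_real ((A - m) / s))) => x.
  by rewrite ler_pdivlMr// /F => ?; lra.
- apply/cvgryPge => A.
  apply: filterS (nbhs_pinfty_ge (num_real ((A - m) / s))) => x.
  by rewrite ler_pdivrMr// /F => ?; lra.
- move=> x; apply: cvgM; first exact: cG.
  by apply: continuous_normal_pdf; rewrite gt_eqF.
- by move=> x; rewrite mulr_ge0// normal_pdf_ge0.
Qed.

(** For independent standard normal [x] and [y], the joint density of [x] and [z = a * x + b * y] is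
    factored in both orders: [z] given [x] on the left, [x] given [z] on the right. The exponents
    agree by completing the square. *)
Lemma normal_pdf_mul (a b x z : R) : 0 < a -> 0 < b ->
  let s := Num.sqrt (a ^+ 2 + b ^+ 2) in
  normal_pdf (a * x) b z * normal_pdf 0 1 x =
  normal_pdf 0 s z * normal_pdf (a * z / s ^+ 2) (b / s) x.
Proof.
move=> a0 b0 s.
have ss : s ^+ 2 = a ^+ 2 + b ^+ 2 by rewrite sqr_sqrtr// addr_ge0// sqr_ge0.
have s0 : 0 < s by rewrite sqrtr_gt0 addr_gt0// exprn_gt0.
have bs : 0 < b / s by rewrite divr_gt0.
rewrite !normal_pdfE ?gt_eqF ?oner_neq0//.
have pk c : 0 < c -> normal_peak c = (c * Num.sqrt (pi *+ 2))^-1 :> R.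
  by move=> c0; rewrite /normal_peak -mulrnAr sqrtrM ?sqr_ge0// sqrtr_sqr gtr0_norm.
have rp : Num.sqrt (pi *+ 2) != 0 :> R by rewrite gt_eqF// sqrtr_gt0 mulrn_wgt0// pi_gt0.
rewrite !pk// /normal_fun [LHS]mulrACA [RHS]mulrACA -!expRD; congr (_ * expR _).
  by field; rewrite rp !gt_eqF.
have s2 : s ^+ 2 != 0 by rewrite gt_eqF// exprn_gt0.
have b2 : b != 0 by rewrite gt_eqF.
rewrite expr_div_n; move: s2; rewrite ss => s2.
by field; rewrite b2 s2.
Qed.

End gaussian.

(** * Stability of the normal law under sums *)

Section gaussian_stability.
Context {R : realType}.
Local Notation mR := (measurableTypeR R).
Local Notation leb := (@lebesgue_measure R).
Local Notation gauss := (@gauss R).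

Lemma ge0_gauss_stable (G : R -> R) (a b : R) : continuous G ->
  (forall x, 0 <= G x) -> 0 < a -> 0 < b ->
  (\int[gauss]_x \int[gauss]_y (G (a * x + b * y))%:E =
   \int[gauss]_z (G (Num.sqrt (a ^+ 2 + b ^+ 2) * z))%:E)%E.
Proof.
move=> cG G0 a0 b0; set s := Num.sqrt _.
have s0 : 0 < s by rewrite sqrtr_gt0 addr_gt0// exprn_gt0.
have mG : measurable_fun [set: mR] (G : mR -> R) := continuous_measurable_fun cG.
under eq_integral do rewrite integral_gauss_affine//.
pose K1 (z : mR * mR) : R := G z.2 * normal_pdf (a * z.1) b z.2.
pose K (z : mR * mR) : R := K1 z * normal_pdf 0 1 z.1.
have K10 z : 0 <= K1 z by rewrite mulr_ge0// normal_pdf_ge0.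
have K0 z : 0 <= K z by rewrite mulr_ge0// normal_pdf_ge0.
have mK1 : measurable_fun setT K1.
  apply: measurable_funM; first exact: (measurableT_comp mG measurable_snd).
  rewrite (_ : (fun z : mR * mR => normal_pdf (a * z.1) b z.2) = fun z =>
     normal_peak b * expR (- (z.2 - a * z.1) ^+ 2 / (b ^+ 2 *+ 2))); last first.
    by apply/funext => z; rewrite normal_pdfE// gt_eqF.
  apply: measurable_funM => //; apply: measurableT_comp => //.
  apply: measurable_funM => //; apply: measurableT_comp => //.
  apply: measurable_funX; apply: measurable_funB; first exact: measurable_snd.
  by apply: measurable_funM => //; exact: measurable_fst.
have mK : measurable_fun setT K.
  apply: measurable_funM => //.
  exact: measurableT_comp (measurable_normal_pdf _ _) measurable_fst.
have mKE : measurable_fun setT (EFin \o K) by exact/measurable_EFinP.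
have inner x : (\int[leb]_z (G z * normal_pdf (a * x) b z)%:E * (normal_pdf 0 1 x)%:E =
    \int[leb]_z (EFin \o K) (x, z))%E.
  rewrite -ge0_integralZr//.
  - apply/measurable_EFinP/measurable_funM => //; exact: measurable_normal_pdf.
  - by move=> z _; rewrite lee_fin mulr_ge0// normal_pdf_ge0.
  - by rewrite lee_fin normal_pdf_ge0.
rewrite [LHS]integral_gauss; last 2 first.
- apply: (@measurable_fun_fubini_tonelli_F _ _ _ _ _ leb (EFin \o K1)).
    exact/measurable_EFinP.
  by move=> z; rewrite lee_fin.
- by move=> x; apply: integral_ge0 => z _; rewrite lee_fin mulr_ge0// normal_pdf_ge0.
transitivity (\int[leb]_x \int[leb]_z (EFin \o K) (x, z))%E.
  by apply: eq_integral => x _; refine (eq_trans _ (inner x)).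
(* With [z] on the outside, the conditional density of [x] given [z] integrates to 1 and only the
   density of [z] remains. *)
rewrite (@fubini_tonelli _ _ _ _ _ leb leb (EFin \o K) mKE)//.
transitivity (\int[leb]_z (G z * normal_pdf 0 s z)%:E)%E.
  apply: eq_integral => z _.
  transitivity (\int[leb]_x ((G z * normal_pdf 0 s z)%:E *
     (normal_pdf (a * z / s ^+ 2) (b / s) x)%:E))%E.
    apply: eq_integral => x _ /=; rewrite /K /K1 /= -EFinM -!mulrA; congr (_ * _)%:E.
    by rewrite [a * (z / _)]mulrA; exact: (normal_pdf_mul x z a0 b0).
  rewrite ge0_integralZl//.
  - by rewrite integral_normal_pdf mule1.
  - by apply/measurable_EFinP; exact: measurable_normal_pdf.
  - by move=> x _; rewrite lee_fin normal_pdf_ge0.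
  - by rewrite lee_fin mulr_ge0// normal_pdf_ge0.
by rewrite -integral_gauss_affine//; apply: eq_integral => z _; rewrite add0r.
Qed.

Lemma gauss_stable (g : R -> R) (a b : R) : continuous g ->
  (exists C, forall x, `|g x| <= C) -> 0 < a -> 0 < b ->
  \int[gauss]_x \int[gauss]_y g (a * x + b * y) =
  \int[gauss]_z g (Num.sqrt (a ^+ 2 + b ^+ 2) * z).
Proof.
move=> cg [C gC] a0 b0.
have mg := continuous_measurable_fun cg.
have bg : bmeas g by split => //; exists C.
have bgl (m s : R) : bmeas (fun y => g (m + s * y)).
  by apply: (bmeas_comp (h := fun y => m + s * y)) bg; apply: measurable_funD => //; apply: measurable_funM.
have bgl0 (s : R) : bmeas (fun y => g (s * y)).
  by apply: (bmeas_comp (h := fun y => s * y)) bg; apply: measurable_funM.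
(* Adding the bound [C] makes the integrand nonnegative; the constant is cancelled at the end. *)
have cg' : continuous (fun x => g x + C) by move=> x; apply: cvgD; [exact: cg|exact: cvg_cst].
have g0 x : 0 <= g x + C by have := gC x; rewrite ler_norml => /andP[]; lra.
have bin : bmeas (fun x => \int[gauss]_y g (a * x + b * y)).
  apply: (@bmeas_Rintegral _ _ _ _ _ gauss gauss (fun z => g (a * z.1 + b * z.2))).
  apply: (bmeas_comp (h := fun z : R * R => a * z.1 + b * z.2)) bg.
  by apply: measurable_funD; apply: measurable_funM.
have E1 x : (\int[gauss]_y (g (a * x + b * y) + C)%:E)%E =
    (\int[gauss]_y g (a * x + b * y) + C)%:E.
  rewrite -[in RHS](Rintegral_cst1 gauss C) -rintegralD; [|exact: bmeas_integrable|exact: rint_cst].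
  rewrite /Rintegral fineK//.
  apply: (integrable_fin_num measurableT); apply: rintD; [exact: bmeas_integrable|exact: rint_cst].
have := ge0_gauss_stable cg' g0 a0 b0.
under eq_integral do rewrite E1.
move=> /(congr1 fine).
rewrite -!/(Rintegral _ _ _) -[X in X = _ -> _]/(\int[gauss]_x (\int[gauss]_y g (a * x + b * y) + C)).
rewrite -[X in _ = X -> _]/(\int[gauss]_z (g (Num.sqrt (a ^+ 2 + b ^+ 2) * z) + C)).
rewrite !rintegralD; [|exact: bmeas_integrable|exact: rint_cst|exact: bmeas_integrable|exact: rint_cst].
by move/addIr.
Qed.

End gaussian_stability.

Section gaussian_iterates.
Context {R : realType}.
Local Notation V := (R * R)%type.
Local Notation gauss := (@gauss R).

Definition gauss2 : probability V R := (gauss \x gauss)%E.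

Definition pr1 : V -> R := fst.
Definition pr2 : V -> R := snd.
HB.instance Definition _ := isMeasurableFun.Build _ _ _ _ pr1 measurable_fst.
HB.instance Definition _ := isMeasurableFun.Build _ _ _ _ pr2 measurable_snd.

Lemma Rintegral_gauss2_prod (u v : R -> R) : bmeas u -> bmeas v ->
  \int[gauss2]_z (u z.1 * v z.2) = \int[gauss]_x u x * \int[gauss]_y v y.
Proof.
move=> bu bv; rewrite (@Rintegral_prod _ _ _ _ _ gauss gauss (fun z => u z.1 * v z.2))/=.
  rewrite -RintegralZr//; last exact: bmeas_integrable.
  by apply: eq_Rintegral => x _; rewrite RintegralZl//; exact: bmeas_integrable.
by apply: bmeasM; [exact: (bmeas_comp measurable_fst bu)|exact: (bmeas_comp measurable_snd bv)].
Qed.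

Lemma gauss_stable_shift (g : R -> R) (s a b : R) : continuous g ->
  (exists C, forall x, `|g x| <= C) -> 0 < a -> 0 < b ->
  \int[gauss]_x \int[gauss]_y g (s + a * x + b * y) =
  \int[gauss]_z g (s + Num.sqrt (a ^+ 2 + b ^+ 2) * z).
Proof.
move=> cg [C gC] a0 b0.
rewrite -(@gauss_stable _ (fun t => g (s + t)) a b)//.
- by apply: eq_Rintegral => x _; apply: eq_Rintegral => y _; rewrite addrA.
- move=> x; apply: (continuous_comp (f := fun t => s + t) (g := g)); last exact: cg.
  by apply: cvgD; [exact: cvg_cst|exact: cvg_id].
- by exists C.
Qed.

Definition gscale (c : R) (k : nat) := c * Num.sqrt k.+1%:R.

Lemma bmeas_gauss_shift (g : R -> R) (c : R) : bmeas g ->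
  bmeas (fun s : R => \int[gauss]_x g (s + c * x)).
Proof.
move=> bg; apply: (@bmeas_Rintegral _ _ _ _ _ gauss gauss (fun z => g (z.1 + c * z.2))).
apply: (bmeas_comp (h := fun z : R * R => z.1 + c * z.2)) bg.
by apply: measurable_funD => //; apply: measurable_funM.
Qed.

(** With independent coordinates, a product test function remains a product after each step, so
    stability on the line suffices. The count starts at [k.+1] because [gauss_stable] combines two
    positive scales. *)
Lemma iter_conv_gauss (g h : R -> R) (c : R) k (s : V) :
  continuous g -> (exists C, forall x, `|g x| <= C) ->
  continuous h -> (exists C, forall x, `|h x| <= C) -> 0 < c ->
  iter k.+1 (conv (scaled_law gauss2 c pr1 pr2)) (fun z => g z.1 * h z.2) s =
  (\int[gauss]_x g (s.1 + gscale c k * x)) * (\int[gauss]_y h (s.2 + gscale c k * y)).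
Proof.
move=> cg gC ch hC c0.
have bg : bmeas g by split; [exact: continuous_measurable_fun|].
have bh : bmeas h by split; [exact: continuous_measurable_fun|].
have bsh (u : R -> R) (t e : R) : bmeas u -> bmeas (fun x => u (t + e * x)).
  move=> bu; apply: (bmeas_comp (h := fun x : R => t + e * x)) bu.
  by apply: measurable_funD => //; apply: measurable_funM.
have step (u v : R -> R) (t : V) : bmeas u -> bmeas v ->
    conv (scaled_law gauss2 c pr1 pr2) (fun z => u z.1 * v z.2) t =
    (\int[gauss]_x u (t.1 + c * x)) * (\int[gauss]_y v (t.2 + c * y)).
  move=> bu bv; rewrite conv_scaled_law; last first.
    by apply: bmeasM; [exact: (bmeas_comp measurable_fst bu)|exact: (bmeas_comp measurable_snd bv)].
  by rewrite -Rintegral_gauss2_prod//; exact: bsh.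
elim: k s => [|k IH] s.
  by rewrite /= step// /gscale sqrtr1 mulr1.
rewrite iterS; under [X in conv _ X]funext do rewrite IH.
rewrite (step (fun t => \int[gauss]_x g (t + gscale c k * x))
   (fun t => \int[gauss]_x h (t + gscale c k * x))); [|exact: bmeas_gauss_shift..].
have k0 : 0 < gscale c k by rewrite mulr_gt0// sqrtr_gt0 ltr0n.
have sE : Num.sqrt (c ^+ 2 + gscale c k ^+ 2) = gscale c k.+1.
  rewrite /gscale (_ : _ + _ = c ^+ 2 * k.+2%:R).
    by rewrite sqrtrM ?sqr_ge0// sqrtr_sqr gtr0_norm.
  by rewrite exprMn sqr_sqrtr// -[k.+2%:R]natr1; ring.
by rewrite !gauss_stable_shift// sE.
Qed.

End gaussian_iterates.

(** * Moments of the normal law *)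

Section gaussian_moments.
Context {R : realType}.
Local Notation gauss := (@gauss R).
Local Notation leb := (@lebesgue_measure R).

Lemma gauss_preimageN (A : set R) : measurable A -> gauss (-%R @^-1` A) = gauss A.
Proof.
move=> mA; have mN : measurable (-%R @^-1` A).
  by rewrite -[_ @^-1` _]setTI; exact: (@oppr_measurable R setT).
have mI : measurable_fun setT (fun x => (\1_A x)%:E : \bar R).
  by apply/measurable_EFinP; exact: measurable_indic.
have I0 x : (0 <= (\1_A x)%:E :> \bar R)%E by [].
transitivity (\int[gauss]_x (\1_(-%R @^-1` A) x)%:E)%E.
  by rewrite integral_indic// setIT.
transitivity (\int[gauss]_x (\1_A x)%:E)%E; last by rewrite integral_indic// setIT.
exact: (integral_gaussN mI I0).
Qed.

Lemma Rintegral_gaussN (f : R -> R) : rint gauss f ->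
  \int[gauss]_x f (- x) = \int[gauss]_x f x.
Proof.
move=> rf; rewrite /Rintegral; congr fine.
have mN := @oppr_measurable R setT.
have mf : measurable_fun setT (EFin \o f) by apply/measurable_EFinP; exact: rint_measurable rf.
pose N := mfun_Sub (mem_set mN : (-%R : R -> R) \in mfun).
have E (A : set R) : measurable A -> distribution gauss N A = gauss A.
  by move=> mA; exact: gauss_preimageN.
rewrite -[LHS](@integral_distribution _ _ _ _ _ gauss N (EFin \o f))//.
  by apply: eq_measure_integral => A mA _; exact: E.
have /integrableP[_ H] := rf; apply/integrableP; split.
  exact: measurableT_comp.
apply: le_lt_trans H.
rewrite -[leRHS](integral_gaussN (f := fun x => `|(EFin \o f) x|%E)).
- exact: lexx.
- exact: measurableT_comp.
- by [].
Qed.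

(** The standard density times this exponential is [r^-1] times the normal density with standard
    deviation [r^-1]. Taking [r] below 1 yields integrability of powers, and letting [r] tend to 1
    yields the variance. *)
Lemma integral_gauss_expR (r : R) : 0 < r ->
  (\int[gauss]_x (expR (- (r ^+ 2 - 1) * x ^+ 2 / 2))%:E = (r^-1)%:E)%E.
Proof.
move=> r0; have r1 : 0 < r^-1 by rewrite invr_gt0.
rewrite integral_gauss; last 2 first.
- apply/measurable_EFinP; apply: measurableT_comp => //.
  by apply: measurable_funM => //; apply: measurable_funM.
- by move=> x; rewrite lee_fin expR_ge0.
transitivity (\int[leb]_x ((r^-1)%:E * (normal_pdf 0 r^-1 x)%:E))%E.
  apply: eq_integral => x _; rewrite -!EFinM; congr EFin.
  rewrite !normal_pdfE ?gt_eqF// /normal_fun.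
  have -> : normal_peak r^-1 = normal_peak (1 : R) * r.
    rewrite /normal_peak -mulrnAr sqrtrM ?sqr_ge0// sqrtr_sqr gtr0_norm//.
    by rewrite expr1n mul1r invfM invrK mulrC.
  set p := normal_peak 1; set C := expR (- _ / (r^-1 ^+ 2 *+ 2)).
  have -> : r^-1 * (p * r * C) = p * C by field; rewrite gt_eqF.
  rewrite mulrCA -expRD; congr (_ * expR _).
  by field; rewrite gt_eqF.
rewrite ge0_integralZl//.
- by rewrite integral_normal_pdf mule1.
- by apply/measurable_EFinP; exact: measurable_normal_pdf.
- by move=> x _; rewrite lee_fin normal_pdf_ge0.
- by rewrite lee_fin ltW.
Qed.

Lemma rint_gauss_expR (r : R) : 0 < r ->
  rint gauss (fun x => expR (- (r ^+ 2 - 1) * x ^+ 2 / 2)).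
Proof.
move=> r0; apply/integrableP; split.
  apply/measurable_EFinP; apply: measurableT_comp => //.
  by apply: measurable_funM => //; apply: measurable_funM.
under eq_integral do rewrite /= ger0_norm ?expR_ge0//.
by rewrite integral_gauss_expR// ltry.
Qed.

(** The case [r = 1 / 2], as [(1 - 1 / 4) / 2 = 3 / 8]. *)
Let rint_gauss_dom : rint gauss (fun x => expR (3 / 8 * x ^+ 2)).
Proof.
have := @rint_gauss_expR (1 / 2) _; rewrite (_ : (fun x => _) = (fun x : R => expR (3 / 8 * x ^+ 2))).
  by apply; lra.
by apply/funext => x; congr expR; field.
Qed.

Lemma rint_gauss_sqr : rint gauss (fun x => x ^+ 2).
Proof.
apply: rint_le (rintZ (8 / 3) rint_gauss_dom) _ => [|x]; first exact: measurable_funX.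
rewrite ger0_norm ?sqr_ge0//; have := expR_ge1Dx (3 / 8 * x ^+ 2).
by have := sqr_ge0 x; lra.
Qed.

Lemma rint_gauss_pow4 : rint gauss (fun x => x ^+ 4).
Proof.
(* [256 / 9] is the square of [16 / 3]: the inequality [u <= expR u] at [u = 3 / 16 * x ^+ 2] is
   squared. *)
apply: rint_le (rintZ (256 / 9) rint_gauss_dom) _ => [|x]; first exact: measurable_funX.
have x4 : x ^+ 4 = (x ^+ 2) ^+ 2 by rewrite -exprM.
rewrite ger0_norm; last by rewrite x4 sqr_ge0.
have -> : expR (3 / 8 * x ^+ 2) = expR (3 / 16 * x ^+ 2) ^+ 2.
  by rewrite -expRM_natl; congr expR; field.
have := expR_ge1Dx (3 / 16 * x ^+ 2); rewrite x4.
have := sqr_ge0 x; set t := x ^+ 2; set e := expR _ => t0 te.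
have : (3 / 16 * t) ^+ 2 <= e ^+ 2 by rewrite lerXn2r ?nnegrE//; lra.
by rewrite exprMn; lra.
Qed.

(** The variance is read off from the known value [r^-1] by differentiation at [r = 1]. With
    [y = (r ^+ 2 - 1) / 2 * x ^+ 2], the bounds [y - y ^+ 2 <= 1 - expR (- y) <= y] are integrated
    and divided by [r - 1] before [r] tends to 1; the fourth moment only controls the error. *)
Lemma gauss_variance : \int[gauss]_x (x ^+ 2) = 1.
Proof.
have mB (r : R) : 1 < r -> (r ^+ 2 - 1) / 2 * \int[gauss]_x (x ^+ 2) - (r ^+ 2 - 1) ^+ 2 / 4 *
    \int[gauss]_x (x ^+ 4) <= 1 - r^-1 <= (r ^+ 2 - 1) / 2 * \int[gauss]_x (x ^+ 2).
  move=> r1; have r0 : 0 < r by lra.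
  have re := rint_gauss_expR r0.
  have -> : 1 - r^-1 = \int[gauss]_x (1 - expR (- (r ^+ 2 - 1) * x ^+ 2 / 2)).
    rewrite RintegralB//; [|exact: rint_cst].
    by rewrite Rintegral_cst1 [X in _ = _ - X]/Rintegral integral_gauss_expR.
  have r2 := rint_gauss_sqr; have r4 := rint_gauss_pow4.
  have y0 x : 0 <= (r ^+ 2 - 1) / 2 * x ^+ 2 :> R.
    by rewrite mulr_ge0 ?sqr_ge0// divr_ge0//; nra.
  have bd x : (r ^+ 2 - 1) / 2 * x ^+ 2 - (r ^+ 2 - 1) ^+ 2 / 4 * x ^+ 4 <=
     1 - expR (- (r ^+ 2 - 1) * x ^+ 2 / 2) <= (r ^+ 2 - 1) / 2 * x ^+ 2.
    have -> : (r ^+ 2 - 1) ^+ 2 / 4 * x ^+ 4 = ((r ^+ 2 - 1) / 2 * x ^+ 2) ^+ 2 by field.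
    have -> : - (r ^+ 2 - 1) * x ^+ 2 / 2 = - ((r ^+ 2 - 1) / 2 * x ^+ 2) by field.
    have := y0 x; set y := _ * x ^+ 2 => yp.
    have := expR_ge1Dx (- y); have := expR_ge1Dx y.
    rewrite expRN; have := expR_gt0 y; set e := expR y => e0 ye yN.
    have : e^-1 <= (1 + y)^-1 by rewrite lef_pV2 ?posrE; lra.
    have : (1 + y)^-1 <= 1 - y + y ^+ 2.
      rewrite -[leLHS]mul1r ler_pdivrMr; last by lra.
      have := mulr_ge0 yp (sqr_ge0 y); nra.
    by move=> *; apply/andP; split; lra.
  rewrite -!rintegralZ// -RintegralB; [|exact: measurableT|exact: rintZ..].
  apply/andP; split; apply: Rintegral_le => [| |x].
  - by apply: rintB; exact: rintZ.
  - by apply: rintB => //; exact: rint_cst.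
  - by have /andP[] := bd x.
  - by apply: rintB => //; exact: rint_cst.
  - exact: rintZ.
  - by have /andP[] := bd x.
set A := \int[gauss]_x (x ^+ 2) in mB *; set B := \int[gauss]_x (x ^+ 4) in mB.
have A0 : 0 <= A by apply: Rintegral_ge0 => x _; exact: sqr_ge0.
have B0 : 0 <= B by apply: Rintegral_ge0 => x _; rewrite (exprM x 2 2) sqr_ge0.
(* Here [r = 1 + e] and both bounds are divided by [e]; the factor [9 / 4] comes from
   [(2 + e) ^+ 2 <= 9]. *)
have up (e : R) : 0 < e <= 1 -> A <= 1 + 9 / 4 * B * e /\ 1 - 3 / 2 * e <= A.
  move=> /andP[e0 e1]; have := mB (1 + e) (ltac:(lra)).
  have -> : 1 - (1 + e)^-1 = e / (1 + e) by field; lra.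
  have -> : (1 + e) ^+ 2 - 1 = e * (2 + e) by ring.
  have -> : e * (2 + e) / 2 * A = e * ((2 + e) / 2 * A) by field.
  have -> : (e * (2 + e)) ^+ 2 / 4 * B = e * (e * (2 + e) ^+ 2 / 4 * B) by field.
  rewrite -mulrBr !ler_pM2l//; move=> /andP[H1 H2].
  have i1 : (1 + e)^-1 <= 1 by rewrite invf_le1; lra.
  have i2 : 1 - e <= (1 + e)^-1.
    rewrite -[leRHS]mul1r ler_pdivlMr; [nra|lra].
  have q : e * (2 + e) ^+ 2 / 4 * B <= 9 / 4 * B * e.
    have -> : 9 / 4 * B * e = e * 9 / 4 * B by field.
    rewrite ler_wpM2r// ler_pM2r// ler_pM2l//; nra.
  split; first nra.
  have : (1 - e) * 2 <= A * (2 + e) by lra.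
  move=> H; rewrite -(@ler_pM2r _ (2 + e)); last by lra.
  nra.
apply/eqP; rewrite eq_le; apply/andP; split.
- apply/ler_addgt0Pr => e e0.
  pose t := Num.min 1 (e / (9 / 4 * B + 1)).
  have D0 : 0 < 9 / 4 * B + 1 by lra.
  have t0 : 0 < t by rewrite lt_min ltr01 divr_gt0.
  have [|+ _] := up t; first by rewrite t0 ge_min lexx.
  move=> /le_trans; apply; rewrite lerD2l.
  apply: (@le_trans _ _ ((9 / 4 * B + 1) * t)); first by rewrite ler_wpM2r ?(ltW t0)//; lra.
  by rewrite mulrC -ler_pdivlMr// ge_min lexx orbT.
- apply/ler_addgt0Pr => e e0.
  pose t := Num.min 1 (e / 2).
  have t0 : 0 < t by rewrite lt_min ltr01 divr_gt0.
  have te : t <= e / 2 by rewrite ge_min lexx orbT.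
  have [|_] := up t; first by rewrite t0 ge_min lexx.
  lra.
Qed.

Lemma rint_gauss_id : rint gauss id.
Proof.
apply: rint_le (rintD rint_gauss_sqr (rint_cst _ 1)) _ => // x.
by rewrite -(real_normK (num_real x)); have := sqr_ge0 (`|x| - 1); nra.
Qed.

Lemma gauss_mean : \int[gauss]_x x = 0.
Proof.
have := Rintegral_gaussN rint_gauss_id.
under eq_Rintegral do rewrite -mulN1r.
rewrite rintegralZ; last exact: rint_gauss_id.
set m := \int[gauss]_x x => H; have : -1 * m = m by [].
lra.
Qed.

End gaussian_moments.

Section product_rint.
Context {R : realType} d1 d2 (T1 : measurableType d1) (T2 : measurableType d2).
Variables (mu : probability T1 R) (nu : probability T2 R).

Lemma Rintegral_prod_rint (f : T1 * T2 -> R) : rint (mu \x nu)%E f ->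
  (forall x, rint nu (fun y => f (x, y))) ->
  \int[(mu \x nu)%E]_z f z = \int[mu]_x \int[nu]_y f (x, y).
Proof.
move=> rf rfx; rewrite /Rintegral -(integral12_prod_meas1 rf); congr fine.
apply: eq_integral => x _; rewrite /fubini_F fineK//.
exact: (integrable_fin_num measurableT (rfx x)).
Qed.

Lemma rint_fst (f : T1 -> R) : rint mu f ->
  rint (mu \x nu)%E (fun z => f z.1) /\ \int[(mu \x nu)%E]_z f z.1 = \int[mu]_x f x.
Proof.
move=> rf; have mf := rint_measurable rf.
have mff : measurable_fun setT (fun z : T1 * T2 => f z.1).
  exact: measurableT_comp mf measurable_fst.
have r : rint (mu \x nu)%E (fun z => f z.1).
  apply/(integrable12ltyP mu nu); first exact/measurable_EFinP.
  under eq_integral do rewrite /= integral_cst// [X in (_ * X)%E](@probability_setT _ _ _ nu) mule1.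
  by have /integrableP[] := rf.
split => //; rewrite Rintegral_prod_rint//=; last by move=> x; exact: rint_cst.
by apply: eq_Rintegral => x _; rewrite Rintegral_cst1.
Qed.

Lemma rint_snd (f : T2 -> R) : rint nu f ->
  rint (mu \x nu)%E (fun z => f z.2) /\ \int[(mu \x nu)%E]_z f z.2 = \int[nu]_x f x.
Proof.
move=> rf; have mf := rint_measurable rf.
have mff : measurable_fun setT (fun z : T1 * T2 => f z.2).
  exact: measurableT_comp mf measurable_snd.
have r : rint (mu \x nu)%E (fun z => f z.2).
  apply/(integrable12ltyP mu nu); first exact/measurable_EFinP.
  rewrite /= integral_cst// [X in (_ * X)%E](@probability_setT _ _ _ mu) mule1.
  by have /integrableP[] := rf.
split => //; rewrite Rintegral_prod_rint//=.
by rewrite Rintegral_cst1.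
Qed.

End product_rint.

Section gauss2_facts.
Context {R : realType}.
Local Notation gauss := (@gauss R).
Local Notation gauss2 := (@gauss2 R).

Lemma standard_pair_gauss2 : standard_pair gauss2 pr1 pr2.
Proof.
have [r1 i1] := rint_fst gauss (@rint_gauss_sqr R).
have [r2 i2] := rint_snd gauss (@rint_gauss_sqr R).
have [r3 i3] := rint_fst gauss (@rint_gauss_id R).
have [r4 i4] := rint_snd gauss (@rint_gauss_id R).
rewrite gauss_variance in i1 i2; rewrite gauss_mean in i3 i4.
split; split => //.
have r12 : rint gauss2 (fun z => pr1 z * pr2 z) by exact: rint_mul.
rewrite [LHS](Rintegral_prod_rint r12); last first.
  by move=> x; apply: rintZ; exact: rint_gauss_id.
rewrite -[RHS](Rintegral_cst1 gauss); apply: eq_Rintegral => x _ /=.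
by rewrite rintegralZ ?gauss_mean ?mulr0//; exact: rint_gauss_id.
Qed.

Lemma bmeas_taylor2 (g : R -> R) : taylor2 g -> bmeas g.
Proof.
move=> [g1 [g2 [C [cg gC _]]]]; split; first exact: continuous_measurable_fun.
by exists C => x; have [] := gC x.
Qed.

Lemma soft_bump_far (k a x : R) : 0 < k -> x != a ->
  soft_bump k a x <= 2 / (k * `|x - a|).
Proof.
move=> k0 xa; have xa0 : 0 < `|x - a| by rewrite normr_gt0 subr_eq0.
have y0 : 0 < k * `|x - a| by rewrite mulr_gt0.
have s01 := soft_step_01 k a x.
have key (y : R) : 0 < y -> sigm y <= y^-1.
  move=> yp; rewrite /sigm lef_pV2 ?posrE ?addr_gt0 ?expR_gt0//.
  by have := expR_ge1Dx y; lra.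
have [xa1|xa1] := ltP a x.
- have sk : soft_step k a x <= (k * `|x - a|)^-1.
    by rewrite /soft_step gtr0_norm ?subr_gt0//; apply: key; rewrite mulr_gt0// subr_gt0.
  rewrite /soft_bump; move: s01 sk; set s := soft_step _ _ _; set t := _^-1.
  nra.
- have xa2 : x < a by rewrite lt_neqAle xa.
  have sk : 1 - soft_step k a x <= (k * `|x - a|)^-1.
    rewrite /soft_step -sigmN ltr0_norm ?subr_lt0// -mulrN; apply: key.
    by rewrite mulr_gt0// oppr_gt0 subr_lt0.
  rewrite /soft_bump; move: s01 sk; set s := soft_step _ _ _; set t := _^-1.
  nra.
Qed.

(** The bump tends to 0 pointwise except at [a], where it equals 1/2 whatever the slope; this point
    is null for the normal law. *)
Lemma soft_bump_gauss_cvg (a : R) :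
  \int[gauss]_x soft_bump n.+1%:R a x @[n --> \oo] --> 0.
Proof.
have b01 n x := soft_bump_01 (n.+1%:R : R) a x.
have mf n : measurable_fun setT (fun x => (soft_bump n.+1%:R a x)%:E).
  by apply/measurable_EFinP; have [] := bmeas_taylor2 (taylor2_soft_bump n.+1%:R a).
have H0 : {ae gauss, forall x, setT x ->
    (soft_bump n.+1%:R a x)%:E @[n --> \oo] --> (0%:E : \bar R)}.
  exists [set a]; split => //; first exact: gauss_set1.
  move=> x /= nH; apply: contrapT => /eqP xa; apply: nH => _.
  apply: cvg_EFin; first exact: nearW.
  have L : 2 / `|x - a| * n.+1%:R^-1 @[n --> \oo] --> (0 : R).
    rewrite -[X in _ --> X](mulr0 (2 / `|x - a|)); apply: cvgMl_tmp.
    exact: cvg_harmonic.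
  apply: squeeze_cvgr (cvg_cst 0) L; apply: nearW => n /=.
  have /andP[-> _] /= := b01 n x; apply: le_trans (soft_bump_far _ xa) _ => //.
  by rewrite invfM mulrCA mulrC.
have H1 : {ae gauss, forall x, forall n, setT x ->
    (`|(soft_bump n.+1%:R a x)%:E| <= (1 : R)%R%:E)%E}.
  by apply: aeW => x n _ /=; rewrite lee_fin; have /andP[? ?] := b01 n x; rewrite ger0_norm.
have [_ _ H] := dominated_convergence measurableT mf (measurable_cst _) H0 (rint_cst gauss 1) H1.
rewrite integral0 in H; exact: (fine_cvg H).
Qed.

End gauss2_facts.

(** * Central limit theorem *)

Section gapprox.
Context {R : realType}.
Local Notation gauss := (@gauss R).

(* The smooth limit theorem extends to this class, which contains the indicators of half lines. *)
Definition gapprox (u : R -> R) := bmeas u /\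
  forall e : R, 0 < e -> exists g w : R -> R, [/\ taylor2 g, taylor2 w,
    forall x, `|u x - g x| <= w x & \int[gauss]_x w x <= e].

Lemma gapprox_lin (u v : R -> R) (a b c : R) : gapprox u -> gapprox v ->
  gapprox (fun x => a * u x + b * v x + c).
Proof.
move=> [bu uA] [bv vA]; split.
  apply: bmeasD; last exact: bmeas_cst.
  by apply: bmeasD; apply: bmeasM => //; exact: bmeas_cst.
move=> e e0; pose K := `|a| + `|b| + 1.
have K0 : 0 < K by rewrite ltr_wpDl// addr_ge0.
have [g [w [tg tw uw iw]]] := uA (e / K) (divr_gt0 e0 K0).
have [g' [w' [tg' tw' vw' iw']]] := vA (e / K) (divr_gt0 e0 K0).
exists (fun x => a * g x + b * g' x + c), (fun x => `|a| * w x + `|b| * w' x + 0).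
split; [exact: taylor2_lin|exact: taylor2_lin|move=> x|].
- rewrite addr0 (_ : _ - _ = a * (u x - g x) + b * (v x - g' x)); last by ring.
  apply: le_trans (ler_normD _ _) _; rewrite !normrM.
  by apply: lerD; rewrite ler_wpM2l.
- have rw : rint gauss w by exact/bmeas_integrable/bmeas_taylor2.
  have rw' : rint gauss w' by exact/bmeas_integrable/bmeas_taylor2.
  under eq_Rintegral do rewrite addr0.
  rewrite rintegralD; [|exact: rintZ..]; rewrite !rintegralZ//.
  have := ler_wpM2l (normr_ge0 a) iw; have := ler_wpM2l (normr_ge0 b) iw'.
  have eK : e = K * (e / K) by rewrite mulrC divfK// gt_eqF.
  have : 0 <= e / K by rewrite divr_ge0// ltW.
  by rewrite {4}eK /K; nra.
Qed.

(** Strict and weak half lines are both kept so that an open interval is exactly a difference of two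
    step functions. *)
Definition stepf (b : bool) (a x : R) : R := (if b then x < a else x <= a)%:R.

Lemma measurable_stepf b a : measurable_fun setT (stepf b a).
Proof.
have mi := @measurable_id _ R setT; have mc := @measurable_cst _ _ R R setT a.
rewrite /stepf; case: b.
- apply: (measurableT_comp (f := fun c : bool => c%:R : R)) => //.
  exact: measurable_fun_ltr mi mc.
- apply: (measurableT_comp (f := fun c : bool => c%:R : R)) => //.
  exact: measurable_fun_ler mi mc.
Qed.

Lemma gapprox_stepf b a : gapprox (stepf b a).
Proof.
split.
  split; first exact: measurable_stepf.
  by exists 1 => x; rewrite /stepf; case: (if b then _ else _); rewrite ?normr1 ?normr0.
move=> e e0; have /cvgrPdist_lt/(_ e e0) [N _ NH] := @soft_bump_gauss_cvg R a.
exists (soft_step N.+1%:R a), (soft_bump N.+1%:R a); split.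
- exact: taylor2_soft_step.
- exact: taylor2_soft_bump.
- by move=> x; exact: soft_step_approx.
- have := NH N (leqnn N); rewrite sub0r normrN => /ltW; apply: le_trans.
  exact: ler_norm.
Qed.

Lemma gapprox_ext (u v : R -> R) : u =1 v -> gapprox u -> gapprox v.
Proof. by move=> /funext ->. Qed.

Lemma gapprox_cst (c : R) : gapprox (fun _ => c).
Proof.
apply: gapprox_ext (gapprox_lin 0 0 c (gapprox_stepf true 0) (gapprox_stepf true 0)) => x.
by rewrite !mul0r !add0r.
Qed.

End gapprox.

Section clt.
Context {R : realType} d (Omega : measurableType d) (P : probability Omega R).
Local Notation V := (R * R)%type.
Local Notation gauss := (@gauss R).
Local Notation gauss2 := (@gauss2 R).
Variables (X : nat -> {RV P >-> V}) (F : probability V R).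
Hypothesis X_indep : mutually_independent X.
Hypothesis X_law : forall (i : nat) (A : set V),
  measurable A -> distribution P (X i) A = F A.
Variables a b : {mfun V >-> R}.
Hypothesis ab_std : standard_pair F a b.

Definition zsum n : Omega -> V := psum X (scaled_pair (Num.sqrt n%:R)^-1 a b) n.

Lemma measurable_zsum n : measurable_fun setT (zsum n).
Proof. exact: measurable_psum. Qed.

(** For [n > 0] the Gaussian side of the comparison does not depend on [n], because the scale
    accumulated over [n] steps is exactly 1. *)
Lemma clt_smooth (g h : R -> R) : taylor2 g -> taylor2 h ->
  \int[P]_w (g (zsum n w).1 * h (zsum n w).2) @[n --> \oo] -->
    (\int[gauss]_x g x) * (\int[gauss]_y h y).
Proof.
move=> tg th; have ex := expandable_prod tg th.
have H := lindeberg_comparison ab_std (@standard_pair_gauss2 R) ex.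
have [bg bh] := (bmeas_taylor2 tg, bmeas_taylor2 th).
rewrite -[X in _ --> X]add0r.
have -> : (fun n => \int[P]_w (g (zsum n w).1 * h (zsum n w).2)) = fun n =>
  iter n (conv (scaled_law F (Num.sqrt n%:R)^-1 a b)) (fun z => g z.1 * h z.2) 0.
  apply/funext => n; have [bf _] := ex.
  exact: (Rintegral_psum X_indep X_law (scaled_pair (Num.sqrt n%:R)^-1 a b) n bf).
apply: (cvg_trans _ (cvgD H (cvg_cst ((\int[gauss]_x g x) * (\int[gauss]_y h y))))).
apply: near_eq_cvg; near=> n.
have n0 : (0 < n)%N by near: n; exact: nbhs_infty_gt.
have G : iter n (conv (scaled_law gauss2 (Num.sqrt n%:R)^-1 pr1 pr2))
    (fun z => g z.1 * h z.2) 0 = (\int[gauss]_x g x) * (\int[gauss]_y h y).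
  rewrite -[n in iter n](prednK n0) iter_conv_gauss//; first last.
  - by rewrite invr_gt0 sqrtr_gt0 ltr0n.
  - by case: bh.
  - exact: (taylor2_continuous th).
  - by case: bg.
  - exact: (taylor2_continuous tg).
  rewrite /gscale prednK// mulVf ?gt_eqF ?sqrtr_gt0 ?ltr0n//.
  by congr (_ * _); apply: eq_Rintegral => x _; rewrite add0r mul1r.
by rewrite !fctE G subrK.
Unshelve. all: by end_near. Qed.

Let taylor2_cst1 : taylor2 (fun _ : R => 1).
Proof.
apply: taylor2_ext (taylor2_lin 0 0 1 (taylor2_soft_step 0 0) (taylor2_soft_step 0 0)) => x.
by rewrite !mul0r !add0r.
Qed.

Lemma clt_gapprox (u v : R -> R) : gapprox u -> gapprox v ->
  \int[P]_w (u (zsum n w).1 * v (zsum n w).2) @[n --> \oo] -->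
    (\int[gauss]_x u x) * (\int[gauss]_y v y).
Proof.
move=> [bu uA] [bv vA]; apply/cvgrPdist_lt => e e0.
have [_ [V0 vV0]] := bv; pose V := `|V0|.
have vV x : `|v x| <= V by apply: le_trans (vV0 x) (ler_norm _).
(* Seven shares: 2 for the approximation under the normal law, 1 for the limit of the product of [g]
   and [h], and 4 for the approximation under [P], where the integrals of [W1] and [W2] are known up
   to one further share each. *)
pose e' := e / 7; have e'0 : 0 < e' by rewrite divr_gt0.
have V1 : 0 < V + 1 by rewrite ltr_wpDl// normr_ge0.
have [g [w [tg tw ug iw]]] := uA (e' / (V + 1)) (divr_gt0 e'0 V1).
have bg := bmeas_taylor2 tg; have [_ [C0 gC0]] := bg; pose C := `|C0|.
have gC x : `|g x| <= C by apply: le_trans (gC0 x) (ler_norm _).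
have C1 : 0 < C + 1 by rewrite ltr_wpDl// normr_ge0.
have [h [w' [th tw' vh iw']]] := vA (e' / (C + 1)) (divr_gt0 e'0 C1).
have bh := bmeas_taylor2 th.
(* The error bound is itself a sum of products of smooth functions, so the smooth theorem transfers
   its smallness from the normal law to [P]. *)
pose W1 x := V * w x + 0 * w x + 0; pose W2 x := C * w' x + 0 * w' x + 0.
have tW1 : taylor2 W1 by exact: taylor2_lin.
have tW2 : taylor2 W2 by exact: taylor2_lin.
have W1E x : W1 x = V * w x by rewrite /W1 mul0r !addr0.
have W2E x : W2 x = C * w' x by rewrite /W2 mul0r !addr0.
have bW1 := bmeas_taylor2 tW1; have bW2 := bmeas_taylor2 tW2.
have scale (K : R) (y : R) : 0 <= K -> y <= e' / (K + 1) -> K * y <= e'.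
  move=> K0 ye; apply: le_trans (ler_wpM2l K0 ye) _.
  rewrite mulrCA -[leRHS]mulr1 ler_pM2l// ler_pdivrMr ?mul1r; lra.
have iW1 : \int[gauss]_x W1 x <= e'.
  under eq_Rintegral do rewrite W1E.
  by rewrite rintegralZ; [exact: scale (normr_ge0 _) iw|exact/bmeas_integrable/bmeas_taylor2].
have iW2 : \int[gauss]_x W2 x <= e'.
  under eq_Rintegral do rewrite W2E.
  by rewrite rintegralZ; [exact: scale (normr_ge0 _) iw'|exact/bmeas_integrable/bmeas_taylor2].
have key x y : `|u x * v y - g x * h y| <= W1 x * 1 + 1 * W2 y.
  rewrite mulr1 mul1r W1E W2E (_ : _ - _ = v y * (u x - g x) + g x * (v y - h y)); last by ring.
  apply: le_trans (ler_normD _ _) _; rewrite !normrM.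
  by apply: lerD; apply: ler_pM.
have gap d' (T : measurableType d') (Q : probability T R) (z : T -> R * R) :
    measurable_fun setT z ->
    `|\int[Q]_t (u (z t).1 * v (z t).2) - \int[Q]_t (g (z t).1 * h (z t).2)| <=
    \int[Q]_t (W1 (z t).1 * 1) + \int[Q]_t (1 * W2 (z t).2).
  move=> mz; have m1 := measurableT_comp measurable_fst mz.
  have m2 := measurableT_comp measurable_snd mz.
  have bB (p q : R -> R) : bmeas p -> bmeas q -> bmeas (fun t => p (z t).1 * q (z t).2).
    by move=> bp bq; apply: bmeasM; [exact: (bmeas_comp m1 bp)|exact: (bmeas_comp m2 bq)].
  have b1 := bB _ _ bu bv; have b2 := bB _ _ bg bh.
  have b3 := bB _ (fun _ => 1) bW1 (bmeas_cst _ _); have b4 := bB (fun _ => 1) _ (bmeas_cst _ _) bW2.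
  rewrite -RintegralB//; [|exact: bmeas_integrable..].
  rewrite -rintegralD; [|exact: bmeas_integrable..].
  apply: le_trans (le_normr_Rintegral measurableT _) _.
    by apply: bmeas_integrable; exact: bmeasB.
  apply: Rintegral_le => [| |t]; last exact: key.
    by apply: rint_norm; apply: bmeas_integrable; exact: bmeasB.
  by apply: bmeas_integrable; exact: bmeasD.
have Cgh := clt_smooth tg th; have CW1 := clt_smooth tW1 taylor2_cst1.
have CW2 := clt_smooth taylor2_cst1 tW2.
move/cvgrPdist_lt/(_ e' e'0) : Cgh => Cgh.
move/cvgrPdist_lt/(_ e' e'0) : CW1 => CW1.
move/cvgrPdist_lt/(_ e' e'0) : CW2 => CW2.
near=> n.
have c1 : `|\int[gauss]_x g x * \int[gauss]_y h y -
    \int[P]_w (g (zsum n w).1 * h (zsum n w).2)| < e' by near: n; exact: Cgh.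
have c2 : `|\int[gauss]_x W1 x * \int[gauss]_y 1 -
    \int[P]_w (W1 (zsum n w).1 * 1)| < e' by near: n; exact: CW1.
have c3 : `|\int[gauss]_x 1 * \int[gauss]_y W2 y -
    \int[P]_w (1 * W2 (zsum n w).2)| < e' by near: n; exact: CW2.
have := gap _ _ P (zsum n) (measurable_zsum n).
have := gap _ _ gauss2 id (@measurable_id _ _ _).
have q1 : \int[gauss2]_t (W1 t.1 * 1) = \int[gauss]_x W1 x.
  by rewrite (Rintegral_gauss2_prod bW1 (bmeas_cst _ 1)) Rintegral_cst1 mulr1.
have q2 : \int[gauss2]_t (1 * W2 t.2) = \int[gauss]_x W2 x.
  by rewrite (Rintegral_gauss2_prod (bmeas_cst _ 1) bW2) Rintegral_cst1 mul1r.
rewrite /= q1 q2 (Rintegral_gauss2_prod bu bv) (Rintegral_gauss2_prod bg bh).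
move: c1 c2 c3; rewrite !Rintegral_cst1 mulr1 mul1r => c1 c2 c3 c4 c5.
have e7 : e = 7 * e' by rewrite /e'; field.
move: c1 c2 c3 c4 c5; rewrite e7 !ltr_norml !ler_norml.
lra.
Unshelve. all: by end_near. Qed.

End clt.

Section rintegral_sum.
Context {R : realType} d (T : measurableType d) (mu : probability T R).

Lemma rintegral_sum m (f : nat -> T -> R) : (forall i, rint mu (f i)) ->
  rint mu (fun x => \sum_(i < m) f i x) /\
  \int[mu]_x (\sum_(i < m) f i x) = \sum_(i < m) \int[mu]_x f i x.
Proof.
move=> rf; elim: m => [|m [IH1 IH2]].
  have E : (fun x : T => \sum_(i < 0) f i x) = fun=> 0.
    by apply/funext => x; rewrite big_ord0.
  by rewrite E Rintegral_cst1 big_ord0; split => //; exact: rint_cst.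
have E : (fun x : T => \sum_(i < m.+1) f i x) = fun x => \sum_(i < m) f i x + f m x.
  by apply/funext => x; rewrite big_ord_recr.
by rewrite E rintegralD// IH2 big_ord_recr; split => //; exact: rintD.
Qed.

Lemma measurable_boolset (b : T -> bool) : measurable_fun setT b ->
  measurable [set x | b x].
Proof.
move=> mb; rewrite (_ : [set x | b x] = setT `&` b @^-1` [set true]) ?setTI//.
by rewrite -[X in measurable X]setTI; exact: mb.
Qed.

Lemma bmeas_bool (b : T -> bool) :
  measurable_fun setT b -> bmeas (fun t => (b t)%:R : R).
Proof.
move=> mb; split; last by exists 1 => t; case: (b t); rewrite ?normr1 ?normr0.
exact: (measurableT_comp (f := fun c : bool => c%:R : R)).
Qed.

Lemma Rintegral_bool (b : T -> bool) : measurable_fun setT b ->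
  \int[mu]_x ((b x)%:R : R) = fine (mu [set x | b x]).
Proof.
move=> mb; rewrite -Rintegral_indic; last exact: measurable_boolset.
apply: eq_Rintegral => x _; rewrite indicE.
by case: (boolP (b x)) => bx; [rewrite mem_set|rewrite memNset//=; exact/negP].
Qed.

End rintegral_sum.

(** * Approximation of sublevel sets by rectangles *)

Section grid.
Context {R : realType} (psi chi : R -> R) (eta q : R) (m : nat).
Hypothesis psi0 : forall x, 0 <= psi x.
Hypothesis eta0 : 0 < eta.
Hypothesis qm : q <= m%:R * eta.

(* In the form of a combination to which [gapprox_lin] applies. *)
Definition cell (i : nat) (x : R) : R :=
  1 * (psi x < i.+1%:R * eta)%R%:R + (-1) * (psi x < i%:R * eta)%R%:R + 0.
Definition slice (i : nat) (y : R) : R := (chi y < q - i.+1%:R * eta)%R%:R.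
(** The indicator of a staircase inside [psi x + chi y < q] with steps of size [eta]. Each term is a
    function of [x] times a function of [y], the form covered by the limit theorem. *)
Definition grid_sum (x y : R) : R := \sum_(i < m) (cell i x * slice i y).

Let cell_sum x : \sum_(i < m) cell i x = (psi x < m%:R * eta)%R%:R.
Proof.
rewrite -(big_mkord xpredT (fun i => cell i x)).
rewrite (eq_bigr (fun i => (psi x < i.+1%:R * eta)%R%:R - (psi x < i%:R * eta)%R%:R)).
  rewrite (telescope_sumr (fun i => (psi x < i%:R * eta)%R%:R))//.
  by rewrite (_ : psi x < 0%:R * eta = false) ?subr0// mul0r ltNge psi0.
by move=> i _; rewrite /cell mul1r mulN1r addr0.
Qed.

Let cellE i x : cell i x = ((i%:R * eta <= psi x) && (psi x < i.+1%:R * eta))%:R.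
Proof.
rewrite /cell mul1r mulN1r addr0; have [h|h] := ltP (psi x) (i%:R * eta).
  by rewrite (lt_trans h) ?subrr// ltr_pM2r// ltr_nat.
by rewrite subr0.
Qed.

Lemma grid_sum_ub x y : grid_sum x y <= (psi x + chi y < q)%R%:R.
Proof.
apply: (@le_trans _ _ (\sum_(i < m) cell i x * (psi x + chi y < q)%R%:R)).
  apply: ler_sum => i _; rewrite cellE /slice; case: andP => [[h1 h2]|_]; last by rewrite !mul0r.
  rewrite !mul1r ler_nat; case: ltP => // h3.
  by rewrite (_ : (psi x + chi y < q) = true)//; lra.
rewrite -mulr_suml cell_sum; case: (_ < _); rewrite ?mul1r ?mul0r//.
Qed.

(** On cell [i] the value of [psi x] is rounded up to [i.+1%:R * eta], which loses at most [eta];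
    the cells reach far enough because [q <= m%:R * eta]. *)
Lemma grid_sum_lb x y : (forall y, 0 <= chi y) ->
  (psi x + chi y < q - eta)%R%:R <= grid_sum x y.
Proof.
move=> chi0.
apply: (@le_trans _ _ (\sum_(i < m) cell i x * (psi x + chi y < q - eta)%R%:R)).
  rewrite -mulr_suml cell_sum; case: (ltP _ (q - eta)) => h; last by rewrite mulr0.
  have -> : psi x < m%:R * eta.
    by apply: lt_le_trans qm; have := chi0 y; move: h eta0; lra.
  by rewrite mulr1.
apply: ler_sum => i _; rewrite cellE /slice; case: andP => [[h1 h2]|_]; last by rewrite !mul0r.
rewrite !mul1r ler_nat; case: ltP => // h3.
by rewrite (_ : (chi y < _) = true)//; move: h1; rewrite -natr1 mulrDl; lra.
Qed.

End grid.

Section portmanteau.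
Context {R : realType} d (Omega : measurableType d) (P : probability Omega R).
Local Notation V := (R * R)%type.
Local Notation gauss2 := (@gauss2 R).
Variables (X : nat -> {RV P >-> V}) (F : probability V R).
Hypothesis X_indep : mutually_independent X.
Hypothesis X_law : forall (i : nat) (A : set V),
  measurable A -> distribution P (X i) A = F A.
Variables a b : {mfun V >-> R}.
Hypothesis ab_std : standard_pair F a b.
Variables psi chi : R -> R.
Hypotheses (psi0 : forall x, 0 <= psi x) (chi0 : forall x, 0 <= chi x).
Hypotheses (mpsi : measurable_fun setT psi) (mchi : measurable_fun setT chi).
Hypothesis gpsi : forall c, gapprox (fun x => (psi x < c)%R%:R).
Hypothesis gchi : forall c, gapprox (fun x => (chi x < c)%R%:R).

Lemma measurable_sublevel d' (T : measurableType d') (z : T -> V) (q : R) :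
  measurable_fun setT z ->
  measurable_fun setT (fun t => psi (z t).1 + chi (z t).2 < q).
Proof.
move=> mz; apply: measurable_fun_ltr => //; apply: measurable_funD.
  exact: (measurableT_comp mpsi (measurableT_comp measurable_fst mz)).
exact: (measurableT_comp mchi (measurableT_comp measurable_snd mz)).
Qed.

Let arith (g1 g2 l1 l2 i1 i2 p e : R) : g1 <= l1 -> i1 <= p -> p <= i2 -> l2 <= g2 ->
  `|l1 - i1| <= e -> `|l2 - i2| <= e -> g1 - e <= p <= g2 + e.
Proof.
by move=> ? ? ? ?; rewrite !ler_norml => /andP[? ?] /andP[? ?]; apply/andP; split; lra.
Qed.

(** The staircases for [q] and [q + eta] squeeze the events under [P] and under the normal law
    alike, and their expectations converge. Keeping the loss [eta] explicit postpones the continuity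
    of the limit law. One [m], large enough for [q + eta], serves both levels. *)
Lemma portmanteau (q eta e : R) : 0 < eta -> 0 < e -> \forall n \near \oo,
  fine (gauss2 [set z | psi z.1 + chi z.2 < q - eta]) - e <=
  fine (P [set w | psi (zsum X a b n w).1 + chi (zsum X a b n w).2 < q]) <=
  fine (gauss2 [set z | psi z.1 + chi z.2 < q + eta]) + e.
Proof.
move=> eta0 e0.
have [m qm] : exists m : nat, q + eta <= m%:R * eta.
  exists (Num.bound `|(q + eta) / eta|); rewrite -ler_pdivrMr// ltW//.
  by apply: le_lt_trans (ler_norm _) _; exact: archi_boundP.
have gcell i : gapprox (cell psi eta i) by exact: gapprox_lin.
have gslice p i : gapprox (slice chi eta p i) by exact: gchi.
have bcell i : bmeas (cell psi eta i) by case: (gcell i).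
have bslice p i : bmeas (slice chi eta p i) by case: (gslice p i).
have bterm d' (T : measurableType d') (z : T -> V) p i : measurable_fun setT z ->
    bmeas (fun t => cell psi eta i (z t).1 * slice chi eta p i (z t).2).
  move=> mz; apply: bmeasM.
    exact: (bmeas_comp (measurableT_comp measurable_fst mz) (bcell i)).
  exact: (bmeas_comp (measurableT_comp measurable_snd mz) (bslice p i)).
pose L p := grid_sum psi chi eta p m.
have LE d' (T : measurableType d') (Q : probability T R) (z : T -> V) p :
    measurable_fun setT z -> rint Q (fun t => L p (z t).1 (z t).2) /\
    \int[Q]_t L p (z t).1 (z t).2 =
    \sum_(i < m) \int[Q]_t (cell psi eta i (z t).1 * slice chi eta p i (z t).2).
  move=> mz; apply: (@rintegral_sum _ _ _ _ m
     (fun i t => cell psi eta i (z t).1 * slice chi eta p i (z t).2)).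
  by move=> i; exact/bmeas_integrable/bterm.
have mz n := measurable_zsum X a b n.
have mid := @measurable_id _ V setT.
have LC p : \int[P]_w L p (zsum X a b n w).1 (zsum X a b n w).2 @[n --> \oo] -->
    \int[gauss2]_z L p z.1 z.2.
  rewrite (LE _ _ gauss2 id p mid).2.
  rewrite (_ : (fun n => _) = fun n => \sum_(i < m) \int[P]_t
     (cell psi eta i (zsum X a b n t).1 * slice chi eta p i (zsum X a b n t).2)); last first.
    by apply/funext => n; rewrite (LE _ _ P (zsum X a b n) p (mz n)).2.
  apply: cvg_big => [|i _]; first exact: add_continuous.
  rewrite Rintegral_gauss2_prod//.
  exact: (clt_gapprox X_indep X_law ab_std (gcell i) (gslice p i)).
have bdL p d' (T : measurableType d') (Q : probability T R) (z : T -> V) :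
    measurable_fun setT z -> p <= q + eta ->
    fine (Q [set t | psi (z t).1 + chi (z t).2 < p - eta]) <=
    \int[Q]_t L p (z t).1 (z t).2 <= fine (Q [set t | psi (z t).1 + chi (z t).2 < p]).
  move=> mz' pq; have [rL _] := LE _ _ Q z p mz'.
  have bb p' : bmeas (fun t => (psi (z t).1 + chi (z t).2 < p')%R%:R : R).
    split; last by exists 1 => t; case: (_ < _); rewrite ?normr1 ?normr0.
    apply: (measurableT_comp (f := fun c : bool => c%:R : R)) => //.
    exact: measurable_sublevel.
  rewrite -!Rintegral_bool; [|exact: measurable_sublevel..].
  apply/andP; split; apply: Rintegral_le => //; try exact: bmeas_integrable.
  - by move=> t; apply: grid_sum_lb => //; exact: le_trans qm.
  - by move=> t; apply: grid_sum_ub.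
have := LC q; move=> /cvgrPdist_le/(_ e e0) C1.
have := LC (q + eta); move=> /cvgrPdist_le/(_ e e0) C2.
near=> n.
have c1 : `|\int[gauss2]_z L q z.1 z.2 - \int[P]_w L q (zsum X a b n w).1 (zsum X a b n w).2| <= e.
  by near: n; exact: C1.
have c2 : `|\int[gauss2]_z L (q + eta) z.1 z.2 -
    \int[P]_w L (q + eta) (zsum X a b n w).1 (zsum X a b n w).2| <= e.
  by near: n; exact: C2.
have qq : q <= q + eta by rewrite lerDl ltW.
have /andP[_ b1] := bdL q _ _ P (zsum X a b n) (mz n) qq.
have /andP[b2 _] := bdL q _ _ gauss2 id mid qq.
have /andP[b3 _] := bdL (q + eta) _ _ P (zsum X a b n) (mz n) (lexx _).
have /andP[_ b4] := bdL (q + eta) _ _ gauss2 id mid (lexx _).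
rewrite addrK in b3.
apply: (arith b2 b1 b3 b4 c1 c2).
Unshelve. all: by end_near. Qed.

End portmanteau.

(** * Quantiles and limit laws *)

Section distribution_function.
Context {R : realType} d (T : measurableType d) (Q : probability T R) (f : T -> R).
Hypothesis mf : measurable_fun setT f.

Definition dfun (x : R) : R := fine (Q [set t | f t <= x]).

Let mle x : measurable [set t | f t <= x].
Proof. by apply: measurable_boolset; apply: measurable_fun_ler. Qed.

Let mlt x : measurable [set t | f t < x].
Proof. by apply: measurable_boolset; apply: measurable_fun_ltr. Qed.

Lemma fine_le_mu (A B : set T) : measurable A -> measurable B -> A `<=` B ->
  fine (Q A) <= fine (Q B).
Proof.
move=> mA mB AB; apply: fine_le; rewrite ?fin_num_measure//.
by apply: le_measure; rewrite ?inE.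
Qed.

Lemma dfun_mono x y : x <= y -> dfun x <= dfun y.
Proof.
by move=> xy; apply: fine_le_mu => // t /= /le_trans; apply.
Qed.

Let near_lb (u : nat -> R) (l e : R) (N : nat) :
  (forall n, (N <= n)%N -> `|l - u n| < e) -> l - e <= u N /\ u N <= l + e.
Proof. by move=> /(_ N (leqnn N)); rewrite ltr_norml => /andP[]; lra. Qed.

Let harmonic_lt (h : R) : 0 < h -> exists n : nat, n.+1%:R^-1 < h.
Proof.
move=> h0; have /cvgrPdist_lt/(_ h h0) [N _ NH] := @cvg_harmonic R.
by exists N; have := NH N (leqnn N); rewrite /harmonic /= sub0r normrN ger0_norm.
Qed.

Lemma dfun_right (x e : R) : 0 < e -> exists2 eta : R, 0 < eta & dfun (x + eta) <= dfun x + e.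
Proof.
move=> e0; pose A n := [set t | f t <= x + n.+1%:R^-1].
have IA : \bigcap_n A n = [set t | f t <= x].
  apply/seteqP; split => t /=; last first.
    by move=> ftx n _ /=; apply: le_trans ftx _; rewrite lerDl.
  move=> H; apply/ler_addgt0Pr => h h0.
  have [n nh] := harmonic_lt h0.
  by apply: le_trans (H n I) _; rewrite lerD2l ltW.
have := @nonincreasing_cvg_mu _ _ _ Q A.
rewrite IA => H.
have /fine_cvg/cvgrPdist_lt/(_ e e0) [N _ NH] : Q (A n) @[n --> \oo] --> (fine (Q [set t | f t <= x]))%:E.
  rewrite fineK ?fin_num_measure//; apply: H => //; try (by move=> *; exact: mle); try exact: mle; try exact: mlt.
  - by apply: le_lt_trans (probability_le1 Q (mle _)) (ltry _).
  - move=> m n mn; apply/subsetPset => t /= /le_trans; apply.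
    by rewrite lerD2l lef_pV2 ?posrE// ler_nat.
exists N.+1%:R^-1; first by rewrite invr_gt0.
exact: (near_lb NH).2.
Qed.

(** Left limits see the strict sublevel set; they become values of [dfun] once atoms are
    excluded. *)
Lemma dfun_left (x e : R) : 0 < e ->
  exists2 eta : R, 0 < eta & fine (Q [set t | f t < x]) - e <= dfun (x - eta).
Proof.
move=> e0; pose A n := [set t | f t <= x - n.+1%:R^-1].
have UA : \bigcup_n A n = [set t | f t < x].
  apply/seteqP; split => t /=.
    by move=> [n _ /=] /le_lt_trans; apply; rewrite ltrBlDr ltrDl.
  move=> H; have h0 : 0 < x - f t by rewrite subr_gt0.
  have [n nh] := harmonic_lt h0.
  by exists n => //; rewrite /A /= lerBrDr -lerBrDl ltW.
have := @nondecreasing_cvg_mu _ _ _ Q A; rewrite UA => H.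
have /fine_cvg/cvgrPdist_lt/(_ e e0) [N _ NH] : Q (A n) @[n --> \oo] --> (fine (Q [set t | f t < x]))%:E.
  rewrite fineK ?fin_num_measure//; apply: H => //; try (by move=> *; exact: mle); try exact: mle; try exact: mlt.
  move=> m n mn; apply/subsetPset => t /= /le_trans; apply.
  by rewrite lerD2l lerN2 lef_pV2 ?posrE// ler_nat.
exists N.+1%:R^-1; first by rewrite invr_gt0.
exact: (near_lb NH).1.
Qed.

Lemma dfun_to1 (e : R) : 0 < e -> exists x, 1 - e <= dfun x.
Proof.
move=> e0; pose A n := [set t | f t <= n%:R].
have UA : \bigcup_n A n = setT.
  apply/seteqP; split => t //= _; exists (Num.bound `|f t|) => //=.
  by apply: le_trans (ler_norm _) _; rewrite ltW// archi_boundP.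
have := @nondecreasing_cvg_mu _ _ _ Q A; rewrite UA => H.
have /fine_cvg/cvgrPdist_lt/(_ e e0) [N _ NH] : Q (A n) @[n --> \oo] --> (1:R)%:E.
  rewrite -(@probability_setT _ _ _ Q); apply: H => //; try (by move=> *; exact: mle); try exact: mle; try exact: mlt.
  move=> m n mn; apply/subsetPset => t /= /le_trans; apply.
  by rewrite ler_nat.
by exists N%:R; exact: (near_lb NH).1.
Qed.

Hypothesis f0 : forall t, 0 <= f t.
Hypothesis atomless : forall x, Q [set t | f t = x] = 0%E.

Lemma fine_lt_dfun x : fine (Q [set t | f t < x]) = dfun x.
Proof.
have meq : measurable [set t | f t = x].
  rewrite (_ : [set t | f t = x] = [set t | f t <= x] `\` [set t | f t < x]).
    exact: measurableD.
  apply/seteqP; split => t /=; first by move=> ->; split; rewrite ?lexx// ltxx.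
  by move=> [h /negP]; rewrite -leNgt => h'; apply/eqP; rewrite eq_le h.
rewrite /dfun (_ : [set t | f t <= x] = [set t | f t < x] `|` [set t | f t = x]).
  rewrite measureU//.
    by congr fine; rewrite -[LHS]adde0; congr (_ + _)%E; exact/esym/atomless.
  by apply/seteqP; split => t //= [h1 h2]; rewrite h2 ltxx in h1.
apply/seteqP; split => t /=.
  by rewrite le_eqVlt => /orP[/eqP ->|]; [right|left].
by move=> [/ltW//|->].
Qed.

(** If the value at the infimum exceeded [p], left continuity, available without atoms, would
    produce a smaller element of the set; if it were below [p], right continuity would produce a
    larger lower bound. *)
Lemma quantileP (p : R) (G : R -> \bar R) : 0 < p < 1 ->
  (forall x, G x = (dfun x)%:E) ->
  0 <= quantile G p /\ dfun (quantile G p) = p.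
Proof.
move=> /andP[p0 p1] GE; set q := quantile G p.
pose S := [set x | (p%:E <= G x)%E].
have SE x : S x <-> p <= dfun x by rewrite /S /= GE lee_fin.
(* [inf] is meaningful only for a nonempty set bounded below: the lower bound 0 uses [p > 0],
   nonemptiness uses [p < 1]. *)
have Slb : lbound S 0.
  move=> x /SE px; rewrite leNgt; apply/negP => x0.
  have D0 : dfun x = 0.
    rewrite /dfun (_ : [set t | f t <= x] = set0) ?measure0//.
    by apply/seteqP; split => t //= h; have := le_lt_trans h x0; rewrite ltNge f0.
  by move: px; rewrite D0 leNgt p0.
have Sne : S !=set0.
  have [|x h] := @dfun_to1 (1 - p); first by rewrite subr_gt0.
  by exists x; apply/SE; apply: le_trans h; rewrite opprB addrCA subrr addr0.
have hS : has_inf S by split => //; exists 0.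
have q0 : 0 <= q by exact: lb_le_inf.
have rt (u v : R) : u < v -> 0 < (v - u) / 2 by move=> uv; rewrite divr_gt0// subr_gt0.
have half (u v w : R) : u < v -> w <= u + (v - u) / 2 -> w < v by move=> *; lra.
split => //; apply/eqP; rewrite eq_le; apply/andP; split.
- rewrite leNgt; apply/negP => h.
  have [|eta eta0] := @dfun_left q (dfun q - p); first by rewrite subr_gt0.
  rewrite fine_lt_dfun subKr => h'.
  have /(ge_inf (proj2 hS)) : S (q - eta) by apply/SE.
  by rewrite -[inf S]/q lerBrDr gerDl leNgt eta0.
- rewrite leNgt; apply/negP => h.
  have [|eta eta0 h'] := @dfun_right q ((p - dfun q) / 2); first exact: rt.
  have : q + eta <= q.
    apply: lb_le_inf => // x /SE px; rewrite leNgt; apply/negP => xq.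
    have := half _ _ _ h (le_trans (dfun_mono (ltW xq)) h').
    by rewrite ltNge px.
  by rewrite gerDl leNgt eta0.
Qed.

End distribution_function.

Section limit_laws.
Context {R : realType}.
Local Notation mR := (measurableTypeR R).
Local Notation gauss := (@gauss R).
Local Notation gauss2 := (@gauss2 R).

Definition sqr (x : R) : R := x ^+ 2.
(** The squared distance from [x] to the nonnegative half line, the usual source of chi-bar-square
    laws. *)
Definition neg_sqr (x : R) : R := Num.min x 0 ^+ 2.

Lemma sqr_ge (x : R) : 0 <= sqr x. Proof. exact: sqr_ge0. Qed.
Lemma neg_sqr_ge (x : R) : 0 <= neg_sqr x. Proof. exact: sqr_ge0. Qed.

Lemma measurable_sqr : measurable_fun setT sqr.
Proof. exact: measurable_funX. Qed.

Lemma measurable_neg_sqr : measurable_fun setT neg_sqr.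
Proof. by apply: measurable_funX; exact: measurable_minr. Qed.

Lemma sqr_ltE (c x : R) : 0 < c -> (sqr x < c) = (- Num.sqrt c < x < Num.sqrt c).
Proof.
by move=> c0; rewrite /sqr -ltr_norml -(@ltr_sqrt _ (x ^+ 2))// sqrtr_sqr.
Qed.

Lemma neg_sqr_ltE (c x : R) : 0 < c -> (neg_sqr x < c) = (- Num.sqrt c < x).
Proof.
move=> c0; have s0 : 0 < Num.sqrt c by rewrite sqrtr_gt0.
rewrite /neg_sqr -/(sqr _) sqr_ltE//; have [x0|x0] := leP x 0.
  by rewrite (le_lt_trans x0)// andbT.
by rewrite oppr_lt0 s0/= (lt_trans _ x0)// oppr_lt0.
Qed.

Lemma gapprox_sqr (c : R) : gapprox (fun x => (sqr x < c)%R%:R).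
Proof.
have [c0|c0] := leP c 0.
  apply: gapprox_ext (gapprox_cst 0) => x.
  by rewrite ltNge (le_trans c0)// sqr_ge0.
apply: gapprox_ext (gapprox_lin 1 (-1) 0 (gapprox_stepf true (Num.sqrt c))
  (gapprox_stepf false (- Num.sqrt c))) => x.
have s0 : 0 < Num.sqrt c by rewrite sqrtr_gt0.
rewrite sqr_ltE// /stepf mul1r mulN1r addr0.
have [h|h] := leP x (- Num.sqrt c); last by rewrite subr0.
by rewrite (le_lt_trans h) ?subrr// -subr_gt0 opprK addr_gt0.
Qed.

Lemma gapprox_neg_sqr (c : R) : gapprox (fun x => (neg_sqr x < c)%R%:R).
Proof.
have [c0|c0] := leP c 0.
  apply: gapprox_ext (gapprox_cst 0) => x.
  by rewrite ltNge (le_trans c0)// sqr_ge0.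
apply: gapprox_ext (gapprox_lin 0 (-1) 1 (gapprox_stepf true (Num.sqrt c))
  (gapprox_stepf false (- Num.sqrt c))) => x.
rewrite neg_sqr_ltE// /stepf mul0r add0r mulN1r addrC.
by have [h|h] := leP x (- Num.sqrt c); rewrite ?subrr ?subr0.
Qed.

Definition quad (psi : R -> R) (z : R * R) : R := psi z.1 + sqr z.2.

Section quad.
Variable psi : R -> R.
Hypotheses (psi0 : forall x, 0 <= psi x) (mpsi : measurable_fun setT psi).

Lemma measurable_quad : measurable_fun setT (quad psi).
Proof.
apply: measurable_funD.
  exact: (measurableT_comp mpsi measurable_fst).
exact: (measurableT_comp measurable_sqr measurable_snd).
Qed.

Lemma quad_ge0 z : 0 <= quad psi z.
Proof. by rewrite addr_ge0// sqr_ge0. Qed.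

Lemma gauss_sqr_eq0 (c : R) : gauss [set y | sqr y = c] = 0%E.
Proof.
have m1 (r : R) : measurable [set r] by exact: measurable_set1.
apply/eqP; rewrite eq_le measure_ge0 andbT.
apply: (@le_trans _ _ (gauss ([set Num.sqrt c] `|` [set - Num.sqrt c]))).
  apply: le_measure; rewrite ?inE.
  - rewrite (_ : [set y | sqr y = c] = sqr @^-1` [set c])//.
    by rewrite -[X in measurable X]setTI; exact: measurable_sqr.
  - exact: measurableU.
  move=> y /= yc; have : `|y| = Num.sqrt c by rewrite -yc sqrtr_sqr.
  have [y0|y0] := leP 0 y; first by rewrite ger0_norm// => ->; left.
  by rewrite ltr0_norm// => <-; right; rewrite opprK.
apply: le_trans (measureU2 _ _ _) _ => //.
by rewrite [leLHS](_ : _ = 0%E)// -[RHS]adde0; congr (_ + _)%E; exact: gauss_set1.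
Qed.

(** Each section in the second coordinate is a level set of [sqr], with at most two points. The
    second coordinate alone excludes atoms, which matters for [neg_sqr]: its own law has an atom at
    0. *)
Lemma quad_atomless x : gauss2 [set z | quad psi z = x] = 0%E.
Proof.
rewrite /gauss2/= /product_measure1; apply: integral0_eq => a _ /=.
rewrite -[RHS](gauss_sqr_eq0 (x - psi a)); congr (gauss _).
apply/seteqP; split => y; rewrite /xsection /= inE /quad /=.
  by move=> <-; rewrite addrC addKr.
by move=> ->; rewrite addrC subrK.
Qed.

Definition sqr_cdf (c : R) : R := fine (gauss [set y | sqr y <= c]).

Let mle (c : R) : measurable_fun setT (fun y => sqr y <= c).
Proof. by apply: measurable_fun_ler => //; exact: measurable_sqr. Qed.

Lemma sqr_cdfE c : sqr_cdf c = \int[gauss]_y (sqr y <= c)%R%:R.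
Proof. by rewrite Rintegral_bool. Qed.

Let mquad x : measurable_fun setT (fun z => quad psi z <= x).
Proof. by apply: measurable_fun_ler => //; exact: measurable_quad. Qed.

Lemma quad_dfunE x : dfun gauss2 (quad psi) x = \int[gauss]_a sqr_cdf (x - psi a).
Proof.
rewrite /dfun -Rintegral_bool//.
rewrite (Rintegral_prod gauss gauss (bmeas_bool (mquad x))).
apply: eq_Rintegral => a _; rewrite sqr_cdfE; apply: eq_Rintegral => y _.
by rewrite /quad/= addrC -lerBrDr.
Qed.

Lemma bmeas_sqr_cdf x : bmeas (fun a => sqr_cdf (x - psi a)).
Proof.
have := bmeas_Rintegral gauss gauss (bmeas_bool (mquad x)).
rewrite (_ : (fun a => _) = (fun a => sqr_cdf (x - psi a)))//.
apply/funext => a; rewrite sqr_cdfE; apply: eq_Rintegral => y _.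
by rewrite /quad/= addrC -lerBrDr.
Qed.

End quad.

Lemma measurable_sqr_le (c : R) : measurable [set y | sqr y <= c].
Proof.
apply: measurable_boolset; apply: measurable_fun_ler => //; exact: measurable_sqr.
Qed.

Lemma chi2_1E (c : R) : chi2 1 `]-oo, c]%classic = (sqr_cdf c)%:E.
Proof.
rewrite /sqr_cdf fineK; last by apply: fin_num_measure; exact: measurable_sqr_le.
rewrite [LHS]/= /distribution /pushforward /product_measure1.
transitivity (\int[normal_prob 0 1]_z (\1_[set y : mR | sqr y <= c] z)%:E)%E.
  apply: eq_integral => z _ /=; rewrite /dirac /= !indicE; congr (nat_of_bool _)%:R%:E.
  by apply/idP/idP; rewrite !inE /xsection /= inE /= in_itv /= /add_sq /= addr0.
rewrite integral_indic ?setIT//; exact: measurable_sqr_le.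
Qed.

Lemma chi2_cdf1E (x : R) : chi2_cdf 1 x = (sqr_cdf x)%:E.
Proof. exact: chi2_1E. Qed.

(** Conditionally on the first normal variable [a], both sides reduce to the law of one square
    evaluated at [x - a ^+ 2]. *)
Lemma chi2_cdf2E (x : R) : chi2_cdf 2 x = (dfun gauss2 (quad sqr) x)%:E.
Proof.
have bK := bmeas_sqr_cdf measurable_sqr x.
rewrite quad_dfunE; last exact: measurable_sqr.
have -> : (\int[gauss]_a sqr_cdf (x - sqr a))%:E = (\int[gauss]_a (sqr_cdf (x - sqr a))%:E)%E.
  rewrite /Rintegral fineK//; apply: (integrable_fin_num measurableT).
  exact: (bmeas_integrable gauss bK).
rewrite ge0_integral_gauss; last 2 first.
- by apply/measurable_EFinP; case: bK.
- by move=> y; rewrite lee_fin fine_ge0.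
rewrite /chi2_cdf -[LHS]/((normal_prob 0 1 \x chi2 1)%E (@add_sq R @^-1` `]-oo, x]%classic)).
rewrite /product_measure1; apply: eq_integral => z _.
rewrite -[RHS]chi2_1E; congr (chi2 1 _).
apply/seteqP; split => t; rewrite /xsection /= inE /= !in_itv /= /add_sq /= /sqr /to_R.
  by rewrite addrC -lerBrDr.
by rewrite lerBrDr addrC.
Qed.

(* [neg_sqr] is [sqr] on one half line and 0 on the other: hence the weights 1/2 of [chibar12_cdf]. *)
Lemma gauss_half_even (h : R -> R) : bmeas h -> (forall x, h (- x) = h x) ->
  \int[gauss]_x ((x < 0)%R%:R * h x) = 2^-1 * \int[gauss]_x h x /\
  \int[gauss]_x ((0 <= x)%R%:R * h x) = 2^-1 * \int[gauss]_x h x.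
Proof.
move=> bh hE.
have mi := @measurable_id _ R setT.
have m0 := @measurable_cst _ _ R R setT 0.
have bl : bmeas (fun x : R => (x < 0)%R%:R * h x).
  by apply: bmeasM => //; apply: bmeas_bool; exact: measurable_fun_ltr.
have bg : bmeas (fun x : R => (0 <= x)%R%:R * h x).
  by apply: bmeasM => //; apply: bmeas_bool; exact: measurable_fun_ler.
have bp : bmeas (fun x : R => (0 < x)%R%:R * h x).
  by apply: bmeasM => //; apply: bmeas_bool; exact: measurable_fun_ltr.
have sum : \int[gauss]_x ((x < 0)%R%:R * h x) + \int[gauss]_x ((0 <= x)%R%:R * h x) =
    \int[gauss]_x h x.
  rewrite -rintegralD; [|exact: bmeas_integrable..].
  by apply: eq_Rintegral => x _; case: leP => _; rewrite ?mul0r ?mul1r ?addr0 ?add0r.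
have neg : \int[gauss]_x ((x < 0)%R%:R * h x) = \int[gauss]_x ((0 < x)%R%:R * h x).
  rewrite -Rintegral_gaussN; last exact: bmeas_integrable.
  by apply: eq_Rintegral => x _; rewrite oppr_lt0 hE.
have pos : \int[gauss]_x ((0 < x)%R%:R * h x) = \int[gauss]_x ((0 <= x)%R%:R * h x).
  rewrite /Rintegral; congr fine; apply: ae_eq_integral => //.
  - by apply/measurable_EFinP; case: bp.
  - by apply/measurable_EFinP; case: bg.
  exists [set 0]; split => //; first exact: gauss_set1.
  move=> x /= nH; apply: contrapT => x0; apply: nH => _.
  by rewrite le_eqVlt (_ : (0 == x) = false)//; apply/eqP => x0'; exact: x0.
move: sum neg pos; set A := \int[gauss]_x _; set B := \int[gauss]_x _.
set C := \int[gauss]_x _; set D := \int[gauss]_x _ => sum neg pos.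
by move: A B C D sum neg pos => A B C D; split; lra.
Qed.

Lemma chibar12_cdfE (x : R) : chibar12_cdf x = (dfun gauss2 (quad neg_sqr) x)%:E.
Proof.
rewrite /chibar12_cdf chi2_cdf1E chi2_cdf2E.
rewrite (quad_dfunE measurable_sqr) (quad_dfunE measurable_neg_sqr).
rewrite -!EFinM -EFinD; congr EFin.
have bK := bmeas_sqr_cdf measurable_sqr x.
have [H1 _] := gauss_half_even bK (fun a => congr1 (fun t => sqr_cdf (x - t)) (sqrrN a)).
have [_ H2] := gauss_half_even (bmeas_cst _ (sqr_cdf x)) (fun=> erefl).
rewrite Rintegral_cst1 in H2; rewrite -H1 -H2 addrC -rintegralD.
- apply: eq_Rintegral => a _; rewrite /neg_sqr; have [a0|a0] := leP 0 a.
    by rewrite mul0r mul1r add0r expr0n subr0.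
  by rewrite mul0r mul1r addr0.
- apply: bmeas_integrable; apply: bmeasM bK; apply: bmeas_bool.
  exact: measurable_fun_ltr.
- apply: bmeas_integrable; apply: bmeasM (bmeas_cst _ _); apply: bmeas_bool.
  exact: measurable_fun_ler.
Qed.

End limit_laws.

(** * Weak law of large numbers *)

Section weak_law.
Context {R : realType} d (Omega : measurableType d) (P : probability Omega R).
Local Notation V := (R * R)%type.
Variables (X : nat -> {RV P >-> V}) (F : probability V R).
Hypothesis X_indep : mutually_independent X.
Hypothesis X_law : forall (i : nat) (A : set V),
  measurable A -> distribution P (X i) A = F A.

Lemma psum_scaled_pair (c : R) (a b : {mfun V >-> R}) n w :
  psum X (scaled_pair c a b) n w =
  (c * \sum_(i < n) a (X i w), c * \sum_(i < n) b (X i w)).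
Proof.
elim: n => [|n IH]; first by rewrite /psum !big_ord0 !mulr0.
by rewrite psumS IH !big_ord_recr/= !mulrDr.
Qed.

(** One order less than [taylor2] and again truncated, so that integrability alone controls the
    error; the law of large numbers is applied to [a ^+ 2], [b ^+ 2] and [a * b]. The factor 3
    covers [g (s + u)], [g s] and [g1 s * u] separately when the increment exceeds 1. *)
Lemma taylor2_first_order (g : R -> R) : taylor2 g ->
  exists (g1 : R -> R) (C : R), 0 <= C /\
    forall s u, `|g (s + u) - g s - g1 s * u| <= C * (`|u| * Num.min 1 `|u|).
Proof.
move=> [g1 [g2 [C [_ gC gT]]]]; exists g1, (3 * C).
have C0 : 0 <= C by apply: le_trans (normr_ge0 (g 0)) _; have [] := gC 0.
split; first by rewrite mulr_ge0.
move=> s u; have [G0 [G1 G2]] := gC s; have [G0' _] := gC (s + u).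
have T := gT s u.
have [u1|u1] := leP `|u| 1.
- have q : `|g2 s / 2 * u ^+ 2| <= C * `|u| ^+ 2.
    rewrite normrM normrX normrM (ger0_norm (_ : 0 <= 2^-1))// ler_wpM2r ?exprn_ge0//.
    by have := normr_ge0 (g2 s); lra.
  have c : C * `|u| ^+ 3 <= C * `|u| ^+ 2.
    by rewrite ler_wpM2l// exprS ler_piMl// exprn_ge0.
  rewrite -expr2 (_ : _ - _ = (g (s + u) - g s - g1 s * u - g2 s / 2 * u ^+ 2) + g2 s / 2 * u ^+ 2); last by ring.
  apply: le_trans (ler_normD _ _) _.
  have := mulr_ge0 C0 (exprn_ge0 2 (normr_ge0 u)).
  by rewrite -(mulrA 3); move: q c T; set A := C * `|u| ^+ 2 => q c T; lra.
- rewrite mulr1.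
  have q : `|g1 s * u| <= C * `|u| by rewrite normrM ler_wpM2r.
  have c : C <= C * `|u| by rewrite ler_peMr// ltW.
  rewrite -(mulrA 3); apply: le_trans (ler_normB _ _) _.
  by have := ler_normB (g (s + u)) (g s); move: q c; set A := C * `|u|; lra.
Qed.

Lemma conv_dirac0 (f : V -> R) s : bmeas f -> conv (\d_(0 : V)) f s = f s.
Proof.
move=> bf; rewrite /conv /Rintegral integral_dirac//.
  by rewrite diracT mul1e/= addr0.
by apply/measurable_EFinP; have [] := bmeas_shift s bf.
Qed.

Variable xi : {mfun V >-> R}.
Hypothesis rxi : rint F xi.
Local Notation m := (\int[F]_x xi x).

Let a (x : V) : R := xi x - m.
Let ma : measurable_fun setT a.
Proof. exact: measurable_funB. Qed.
HB.instance Definition _ := isMeasurableFun.Build _ _ _ _ a ma.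
(** A dummy second coordinate lets the planar operators handle a scalar average. *)
Let b (x : V) : R := 0.
Let mb : measurable_fun setT b.
Proof. exact: measurable_cst. Qed.
HB.instance Definition _ := isMeasurableFun.Build _ _ _ _ b mb.

Let ra : rint F a.
Proof. by apply: rintB => //; exact: rint_cst. Qed.

Let ia : \int[F]_x a x = 0.
Proof. by rewrite RintegralB//; [rewrite Rintegral_cst1 subrr|exact: rint_cst]. Qed.

Let dev (n : nat) (w : Omega) : R := n%:R^-1 * \sum_(i < n) xi (X i w) - m.

Let devE n w : (0 < n)%N -> (psum X (scaled_pair n%:R^-1 a b) n w).1 = dev n w.
Proof.
move=> n0; rewrite psum_scaled_pair/= /dev /a sumrB mulrBr sumr_const card_ord.
have nn : (n%:R : R) != 0 by rewrite pnatr_eq0 -lt0n.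
by congr (_ - _); rewrite -[m *+ n]mulr_natl mulKf.
Qed.

Let f (z : V) : R := dist_test z.1.

Let bf : bmeas f.
Proof. by apply: (bmeas_comp measurable_fst); exact/bmeas_taylor2/taylor2_dist_test. Qed.

Let trunc n := \int[F]_x (`|a x| * Num.min 1 (n%:R^-1 * `|a x|)).

Let trunc_cvg0 : trunc n @[n --> \oo] --> 0.
Proof.
apply: trunc_integral_cvg0 => //.
- exact: rint_norm.
- exact: measurableT_comp.
- apply/cvgrPdist_lt => e e0; near=> n.
  have n0 : (0 : R) < n%:R by rewrite ltr0n; near: n; exact: nbhs_infty_gt.
  rewrite sub0r normrN ger0_norm ?invr_ge0// -(invrK e) ltf_pV2 ?posrE ?invr_gt0//.
  by near: n; exact: nbhs_infty_gtr.
Unshelve. all: by end_near. Qed.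

(** Exchange against the point mass at 0, whose convolution is the identity: the [n] steps cost
    [n%:R^-1 * (C * trunc n)] each, and what remains is [dist_test 0 = 0]. *)
Let dist_test_mean_le (g1 : R -> R) (C : R) n : 0 <= C -> (0 < n)%N ->
  (forall s u, `|dist_test (s + u) - dist_test s - g1 s * u| <= C * (`|u| * Num.min 1 `|u|)) ->
  \int[P]_w dist_test (dev n w) <= C * trunc n.
Proof.
move=> C0 n0 gT.
have -> : \int[P]_w dist_test (dev n w) = iter n (conv (scaled_law F n%:R^-1 a b)) f 0.
  rewrite -(Rintegral_psum X_indep X_law (scaled_pair n%:R^-1 a b) n bf).
  by apply: eq_Rintegral => w _; rewrite /f devE.
have it0 k s : iter k (conv (\d_(0 : V))) f s = f s.
  elim: k s => //= k IH s; rewrite conv_dirac0 ?IH//.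
  by rewrite (_ : iter k _ _ = f)//; apply/funext.
have n0' : (0 : R) < n%:R by rewrite ltr0n.
have step s : `|conv (scaled_law F n%:R^-1 a b) f s - conv (\d_(0 : V)) f s| <=
    n%:R^-1 * (C * trunc n).
  rewrite conv_dirac0// conv_scaled_law//.
  have bfs : rint F (fun x => f (s + (n%:R^-1 * a x, n%:R^-1 * b x))).
    apply: bmeas_integrable; apply: (bmeas_comp (h := fun x => s + scaled_pair n%:R^-1 a b x)) bf.
    by apply: measurable_funDV => //; exact: measurable_scaled_pair.
  pose Q x := f s + (g1 s.1 * n%:R^-1) * a x.
  have rQ : rint F Q by apply: rintD; [exact: rint_cst|exact: rintZ].
  have -> : f s = \int[F]_x Q x.
    by rewrite rintegralD ?Rintegral_cst1 ?rintegralZ ?ia ?mulr0 ?addr0//;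
      [exact: rint_cst|exact: rintZ].
  rewrite -RintegralB//; apply: le_trans (le_normr_Rintegral measurableT (rintB bfs rQ)) _.
  have rt : rint F (fun x => `|a x| * Num.min 1 (n%:R^-1 * `|a x|)).
    have mn : measurable_fun setT (fun x => `|a x|) by exact: measurableT_comp.
    apply: rint_le (rint_norm ra) _.
      by apply: measurable_funM => //; apply: measurable_minr => //; exact: measurable_funM.
    move=> x; rewrite ger0_norm; first by rewrite ler_piMr// ge_min lexx.
    by rewrite mulr_ge0// le_min ler01 mulr_ge0// invr_ge0 ltW.
  rewrite mulrA -rintegralZ//; apply: Rintegral_le; first exact: rint_norm (rintB bfs rQ).
    exact: rintZ.
  move=> x; rewrite /Q /f /= opprD addrA -mulrA; apply: le_trans (gT _ _) _.
  by rewrite normrM (gtr0_norm (_ : 0 < n%:R^-1)) ?invr_gt0// !mulrA (mulrC C).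
have := iter_conv_dist n 0 bf step; rewrite it0 /f dist_test0 subr0 mulrA divff ?gt_eqF// mul1r.
by apply: le_trans; exact: ler_norm.
Qed.

Lemma measurable_dev n : measurable_fun setT
  (fun w => n%:R^-1 * \sum_(i < n) xi (X i w) - m).
Proof.
apply: measurable_funB => //; apply: measurable_funM => //.
by apply: measurable_sum => i; exact: measurableT_comp.
Qed.

Lemma weak_law (e : R) : 0 < e ->
  fine (P [set w | e <= `|n%:R^-1 * \sum_(i < n) xi (X i w) - m|]) @[n --> \oo] --> 0.
Proof.
move=> e0; have [g1 [C [C0 gT]]] := taylor2_first_order (@taylor2_dist_test R).
have de0 := dist_test_gt0 e0.
have L : (dist_test e)^-1 * C * trunc n @[n --> \oo] --> 0.
  by rewrite -[X in _ --> X](mulr0 ((dist_test e)^-1 * C)); apply: cvgMl_tmp.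
apply: squeeze_cvgr (cvg_cst 0) L; near=> n.
have n0 : (0 < n)%N by near: n; exact: nbhs_infty_gt.
rewrite fine_ge0//=.
have mn : measurable_fun setT (fun w => `|dev n w|).
  by apply: measurableT_comp => //; exact: measurable_dev.
have mb' : measurable_fun setT (fun w => e <= `|dev n w|) by apply: measurable_fun_ler.
rewrite -(Rintegral_bool P mb') -mulrA mulrC ler_pdivlMr// mulrC -rintegralZ; last first.
  exact/bmeas_integrable/bmeas_bool.
apply: le_trans (dist_test_mean_le C0 n0 gT).
apply: Rintegral_le.
- by apply: rintZ; exact/bmeas_integrable/bmeas_bool.
- apply: bmeas_integrable; apply: (bmeas_comp (h := dev n)); first exact: measurable_dev.
  exact/bmeas_taylor2/taylor2_dist_test.
- move=> w; case: (leP e `|dev n w|) => h; rewrite ?mulr1 ?mulr0; last exact: dist_test_ge0.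
  by apply: dist_test_mono => //; exact: ltW.
Unshelve. all: by end_near. Qed.

End weak_law.

(** * Expansion of the empirical likelihood *)

Section exp_log_bound.
Context {R : realType}.

(** A lower bound for the logarithm of [1 + t], stated through exponentials. The auxiliary [w] is
    the quotient of [1 + x] by [expR (x - x ^+ 2 / 2)]; its derivative is of order [x ^+ 2], so [w]
    stays within a cubic error of 1. *)
Lemma expR_quad_le1D (t : R) : `|t| <= 1 / 2 -> expR (t - t ^+ 2 / 2 - 6 * `|t| ^+ 3) <= 1 + t.
Proof.
move=> t2; pose w (x : R) := (1 + x) * expR (- x + x ^+ 2 / 2).
have dw (x : R) : is_derive x (1 : R) w (x ^+ 2 * expR (- x + x ^+ 2 / 2)).
  have D : is_derive x (1 : R) (fun y : R => - y + y ^+ 2 / 2) (- 1 + x).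
    by apply: is_derive_eq; rewrite /GRing.scale/=; field.
  have E := is_derive1_comp (is_derive_expR _) D.
  by apply: is_derive_eq; rewrite /GRing.scale/=; ring.
have wt := @derive_bound_increment _ w _ t (3 * `|t| ^+ 2) dw.
have {wt} : `|w t - w 0| <= 3 * `|t| ^+ 2 * `|t|.
  apply: wt => x xt; rewrite normrM normrX mulrC ler_pM ?exprn_ge0//.
    rewrite ger0_norm ?expR_ge0//.
    have xh : `|x| <= 1 / 2 by exact: le_trans t2.
    (* [5 / 8 = 1 / 2 + 1 / 8] bounds [- x + x ^+ 2 / 2] on the range of [x], and 3 becomes the
       coefficient of the cubic error of [w]. *)
    have e58 : expR (5 / 8 : R) <= 3.
      have := expR_ge1Dx (- (5 / 8) : R); rewrite expRN => h.
      rewrite -[leRHS]invrK -[leLHS]invrK lef_pV2 ?posrE ?invr_gt0 ?expR_gt0//; lra.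
    apply: le_trans e58; rewrite ler_expR.
    have x2 : x ^+ 2 <= 1 / 4.
      by rewrite -(real_normK (num_real x)); have := normr_ge0 x; nra.
    by move: xh; rewrite ler_norml => /andP[]; lra.
  by rewrite lerXn2r// nnegrE.
have -> : w 0 = 1 by rewrite /w addr0 mul1r oppr0 add0r expr0n mul0r expR0.
rewrite -mulrA -exprSr.
have y0 : 0 <= `|t| ^+ 3 by rewrite exprn_ge0.
have y8 : `|t| ^+ 3 <= 1 / 8.
  have := @lerXn2r R 3 `|t| (1 / 2); rewrite !nnegrE normr_ge0 => /(_ isT _ t2).
  by rewrite expr_div_n expr1n -natrX; apply.
set y := `|t| ^+ 3 in y0 y8 *; rewrite ler_norml => /andP[h _].
have wE : 1 + t = w t * expR (t - t ^+ 2 / 2).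
  rewrite /w -mulrA -expRD (_ : - t + _ + _ = 0) ?expR0 ?mulr1//; ring.
rewrite wE expRD mulrC ler_pM2r ?expR_gt0// expRN.
(* As [y <= 1 / 8], [(1 - 3 * y) * (1 + 6 * y) >= 1]; this is why the coefficient doubles from 3 to
   6. *)
apply: (@le_trans _ _ (1 - 3 * y)); last by lra.
rewrite -[leLHS]mul1r ler_pdivrMr ?expR_gt0//.
have := expR_ge1Dx (6 * y); set e := expR _ => he.
by nra.
Qed.

End exp_log_bound.

Section weights.
Context {R : realType} (n : nat).
Hypothesis n0 : (0 < n)%N.
Implicit Types (p t : 'I_n -> R).

Let nR : (0 : R) < n%:R. Proof. by rewrite ltr0n. Qed.

Lemma sum_abs_cube t (mu : R) : (forall i, `|t i| <= mu) ->
  \sum_i `|t i| ^+ 3 <= mu * \sum_i t i ^+ 2.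
Proof.
move=> tm; rewrite mulr_sumr; apply: ler_sum => i _.
by rewrite exprS -(real_normK (num_real (t i))) ler_wpM2r// exprn_ge0.
Qed.

Lemma prod_weights_le1 p : (forall i, 0 <= p i) -> \sum_i p i <= 1 ->
  \prod_i (n%:R * p i) <= 1.
Proof.
move=> p0 p1; have := @leif_AGM R 'I_n predT (fun i => n%:R * p i).
rewrite card_ord; case => [i _|h _]; first by rewrite mulr_ge0.
apply: le_trans h _; rewrite -mulr_sumr mulrC mulKf ?gt_eqF//.
by rewrite exprn_ile1// sumr_ge0.
Qed.

(* AM-GM for the perturbed weights [p i * (1 + t i)]. *)
Lemma prod_weights_ub p t (tau kappa mu : R) :
  (forall i, 0 <= p i) -> \sum_i p i = 1 -> \sum_i p i * t i <= 0 ->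
  (forall i, `|t i| <= mu) -> mu <= 1 / 2 -> \sum_i t i = tau ->
  \sum_i t i ^+ 2 <= tau + kappa ->
  \prod_i (n%:R * p i) <= expR (- (tau / 2 - kappa / 2 - 6 * mu * (tau + kappa))).
Proof.
move=> p0 p1 pt tm m2 st st2.
have t1 i : 0 < 1 + t i.
  by have := le_trans (tm i) m2; rewrite ler_norml => /andP[]; lra.
have h1 : \prod_i (n%:R * (p i * (1 + t i))) <= 1.
  apply: prod_weights_le1; first by move=> i; rewrite mulr_ge0// ltW.
  by under eq_bigr do rewrite mulrDr mulr1; rewrite big_split/= p1; lra.
pose E := \sum_i (t i - t i ^+ 2 / 2 - 6 * `|t i| ^+ 3).
have h2 : expR E <= \prod_i (1 + t i).
  rewrite expR_sum; apply: ler_prod => i _; rewrite expR_ge0/=.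
  by apply: expR_quad_le1D; exact: le_trans m2.
have h3 : \prod_i (n%:R * p i) * expR E <= 1.
  apply: le_trans h1; rewrite [leRHS](_ : _ = \prod_i (n%:R * p i) * \prod_i (1 + t i)).
    by rewrite ler_wpM2l// prodr_ge0// => i _; exact: mulr_ge0.
  by rewrite -big_split/=; apply: eq_bigr => i _; rewrite mulrA.
have EE : tau / 2 - kappa / 2 - 6 * mu * (tau + kappa) <= E.
  rewrite /E !sumrB -mulr_suml -mulr_sumr st.
  have c3 := sum_abs_cube tm.
  have mu0 : 0 <= mu.
    by apply: le_trans (normr_ge0 (t (Ordinal n0))) (tm _).
  have := ler_wpM2l mu0 st2; move: c3 st2.
  set S2 := \sum_i t i ^+ 2; set S3 := \sum_i `|t i| ^+ 3 => c3 st2 c4.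
  rewrite -mulrA; lra.
rewrite expRN -[leRHS]mul1r ler_pdivlMr ?expR_gt0//; apply: le_trans h3.
rewrite ler_wpM2l ?ler_expR// prodr_ge0// => i _; exact: mulr_ge0.
Qed.

(** Because the sum of [t] is 0, the first-order terms cancel and the exponent starts with the
    quadratic one. *)
Lemma prod_weights_lb t (mu : R) : (forall i, `|t i| <= mu) -> mu <= 1 / 2 ->
  \sum_i t i = 0 ->
  expR (- (1 / 2 + 6 * mu) * \sum_i t i ^+ 2) <= \prod_i (n%:R * (n%:R^-1 * (1 - t i))).
Proof.
move=> tm m2 st.
have -> : \prod_i (n%:R * (n%:R^-1 * (1 - t i))) = \prod_i (1 - t i).
  by apply: eq_bigr => i _; rewrite mulVKf ?gt_eqF.
pose E := \sum_i (- t i - (- t i) ^+ 2 / 2 - 6 * `|- t i| ^+ 3).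
apply: (@le_trans _ _ (expR E)).
  rewrite ler_expR /E !sumrB -mulr_suml -mulr_sumr sumrN st.
  have -> : \sum_i (- t i) ^+ 2 = \sum_i t i ^+ 2 by apply: eq_bigr => i _; rewrite sqrrN.
  have -> : \sum_i `|- t i| ^+ 3 = \sum_i `|t i| ^+ 3 by apply: eq_bigr => i _; rewrite normrN.
  have := sum_abs_cube tm; set S2 := \sum_i t i ^+ 2; set S3 := \sum_i `|t i| ^+ 3 => c3.
  rewrite mulNr mulrDl -mulrA; lra.
rewrite expR_sum; apply: ler_prod => i _; rewrite expR_ge0/=.
by apply: expR_quad_le1D; rewrite normrN; exact: le_trans m2.
Qed.

End weights.

Section empirical_bounds.
Context {R : realType} (n : nat) (a b : 'I_n -> R) (K eps : R).
Hypothesis n0 : (0 < n)%N.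
Hypotheses (K1 : 1 <= K) (eps0 : 0 < eps) (eps_small : 100 * K * eps <= 1).
Hypothesis n_large : K ^+ 2 <= eps * n%:R.

Let r : R := Num.sqrt n%:R.
Definition std_sum (c : 'I_n -> R) : R := r^-1 * \sum_i c i.
Definition emp_mean (c : 'I_n -> R) : R := n%:R^-1 * \sum_i c i.
Local Notation Z1 := (std_sum a).
Local Notation Z2 := (std_sum b).
Local Notation Saa := (emp_mean (fun i => a i ^+ 2)).
Local Notation Sbb := (emp_mean (fun i => b i ^+ 2)).
Local Notation Sab := (emp_mean (fun i => a i * b i)).

Hypotheses (Z1K : `|Z1| <= K) (Z2K : `|Z2| <= K).
Hypotheses (Saa1 : `|Saa - 1| <= eps) (Sbb1 : `|Sbb - 1| <= eps) (Sab0 : `|Sab| <= eps).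
Hypothesis ab_max : forall i, `|a i| + `|b i| <= eps * r.

Let nR : (0 : R) < n%:R. Proof. by rewrite ltr0n. Qed.
Let r0 : 0 < r. Proof. by rewrite sqrtr_gt0. Qed.
Let r2 : r ^+ 2 = n%:R. Proof. by rewrite sqr_sqrtr// ltW. Qed.
Let rn : r != 0. Proof. by rewrite gt_eqF. Qed.
Let nn : (n%:R : R) != 0. Proof. by rewrite gt_eqF. Qed.
Let SaE : \sum_i a i = r * Z1. Proof. by rewrite /std_sum mulVKf. Qed.
Let SbE : \sum_i b i = r * Z2. Proof. by rewrite /std_sum mulVKf. Qed.
Let SaaE : \sum_i a i ^+ 2 = r ^+ 2 * Saa. Proof. by rewrite r2 /emp_mean mulVKf. Qed.
Let SbbE : \sum_i b i ^+ 2 = r ^+ 2 * Sbb. Proof. by rewrite r2 /emp_mean mulVKf. Qed.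
Let SabE : \sum_i a i * b i = r ^+ 2 * Sab. Proof. by rewrite r2 /emp_mean mulVKf. Qed.

(** The sums of [t], of its square and of its products with the data are at most quadratic in the
    data, hence determined by five normalized moments; vanishing coefficients are written out below
    to fit this one formula. *)
Let sum_quad (k1 k2 k3 k4 k5 k6 : R) :
  \sum_i (k1 * a i ^+ 2 + k2 * (a i * b i) + k3 * b i ^+ 2 + k4 * a i + k5 * b i + k6) =
  k1 * (r ^+ 2 * Saa) + k2 * (r ^+ 2 * Sab) + k3 * (r ^+ 2 * Sbb) + k4 * (r * Z1) +
  k5 * (r * Z2) + k6 * r ^+ 2.
Proof.
by rewrite !big_split/= -!mulr_sumr SaE SbE SaaE SbbE SabE sumr_const card_ord r2 mulr_natr.
Qed.

(** The lower bound sets the constant: [10 * K ^+ 2 * eps] from the approximate quadratic form and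
    [108 * K ^+ 3 * eps] from the cubic terms. The upper bound has 2 and 18 in their place. *)
Let err : R := 120 * K ^+ 3 * eps.

Let K2 : 1 <= K ^+ 2. Proof. by rewrite exprn_ege1. Qed.
Let K3 : K ^+ 2 <= K ^+ 3. Proof. by rewrite (exprS K 2) ler_peMl// sqr_ge0. Qed.
Let eps1 : eps <= 1 / 100.
Proof. by have := ler_wpM2r (ltW eps0) K1; have := eps_small; lra. Qed.
Let Keps : K * eps <= 1 / 100. Proof. have := eps_small; lra. Qed.

Let sq_le (z : R) : `|z| <= K -> z ^+ 2 <= K ^+ 2.
Proof. by move=> zK; rewrite -(real_normK (num_real z)) lerXn2r// nnegrE ltW// (lt_le_trans ltr01). Qed.

(* [y] is [(Z1, Z2)] for the unconstrained problem and [(Z1, 0)] for the constrained one. *)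
Let ub_gen (y1 y2 : R) (p : 'I_n -> R) : `|y1| <= K -> `|y2| <= K ->
  y1 * Z1 = y1 ^+ 2 -> y2 * Z2 = y2 ^+ 2 ->
  (forall i, 0 <= p i) -> \sum_i p i = 1 -> y1 * \sum_i p i * a i + y2 * \sum_i p i * b i <= 0 ->
  \prod_i (n%:R * p i) <= expR (- ((y1 ^+ 2 + y2 ^+ 2) / 2 - err)).
Proof.
move=> y1K y2K yZ1 yZ2 p0 p1 pl.
(* The tilt along the first-order Lagrange multiplier. [y1 * Z1 = y1 ^+ 2] says that [y1] is 0 or
   [Z1], so the sum of [t] equals the squared length of [y]. *)
pose t i := r^-1 * (y1 * a i + y2 * b i).
have tm i : `|t i| <= K * eps.
  rewrite normrM ger0_norm ?invr_ge0 ?(ltW r0)// ler_pdivrMl//.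
  apply: le_trans (ler_normD _ _) _; rewrite !normrM.
  apply: (@le_trans _ _ (K * `|a i| + K * `|b i|)).
    by apply: lerD; rewrite ler_wpM2r.
  rewrite -mulrDr mulrCA ler_wpM2l//; first by have := K1; lra.
  by rewrite mulrC.
have pt : \sum_i p i * t i <= 0.
  rewrite (_ : \sum_i _ = r^-1 * (y1 * \sum_i p i * a i + y2 * \sum_i p i * b i)).
    by rewrite pmulr_rle0// invr_gt0.
  rewrite !mulr_sumr -big_split mulr_sumr/=; apply: eq_bigr => i _; rewrite /t; ring.
have st : \sum_i t i = y1 ^+ 2 + y2 ^+ 2.
  transitivity (\sum_i (0 * a i ^+ 2 + 0 * (a i * b i) + 0 * b i ^+ 2 + (r^-1 * y1) * a i +
     (r^-1 * y2) * b i + 0)); first by apply: eq_bigr => i _; rewrite /t; ring.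
  by rewrite sum_quad -yZ1 -yZ2; field.
have st2 : \sum_i t i ^+ 2 <= y1 ^+ 2 + y2 ^+ 2 + 4 * K ^+ 2 * eps.
  have -> : \sum_i t i ^+ 2 = y1 ^+ 2 * Saa + 2 * (y1 * y2) * Sab + y2 ^+ 2 * Sbb.
    transitivity (\sum_i ((r^-2 * y1 ^+ 2) * a i ^+ 2 + (r^-2 * (2 * y1 * y2)) * (a i * b i) +
     (r^-2 * y2 ^+ 2) * b i ^+ 2 + 0 * a i + 0 * b i + 0)).
      by apply: eq_bigr => i _; rewrite /t; field.
    by rewrite sum_quad; field.
  have q1 : y1 ^+ 2 * Saa <= y1 ^+ 2 + K ^+ 2 * eps.
    have := sq_le y1K; have := sqr_ge0 y1; move: Saa1; rewrite ler_norml => /andP[_].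
    by move: eps0; nra.
  have q2 : y2 ^+ 2 * Sbb <= y2 ^+ 2 + K ^+ 2 * eps.
    have := sq_le y2K; have := sqr_ge0 y2; move: Sbb1; rewrite ler_norml => /andP[_].
    by move: eps0; nra.
  have q3 : 2 * (y1 * y2) * Sab <= 2 * (K ^+ 2 * eps).
    have yy : `|y1 * y2| <= K ^+ 2 by rewrite normrM expr2 ler_pM.
    rewrite -mulrA ler_pM2l//; apply: le_trans (ler_norm _) _; rewrite normrM.
    by apply: ler_pM.
  lra.
apply: le_trans (prod_weights_ub n0 p0 p1 pt tm _ st st2) _; first by have := Keps; lra.
rewrite ler_expR lerN2 /err.
have := sq_le y1K; have := sq_le y2K; have := sqr_ge0 y1; have := sqr_ge0 y2.
set u1 := y1 ^+ 2; set u2 := y2 ^+ 2 => u2p u1p u2K u1K.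
have h : 6 * (K * eps) * (u1 + u2 + 4 * K ^+ 2 * eps) <= 18 * K ^+ 3 * eps.
  have -> : 18 * K ^+ 3 * eps = 6 * (K * eps) * (3 * K ^+ 2) by ring.
  apply: ler_wpM2l; first by rewrite !mulr_ge0// ltW// (lt_le_trans ltr01).
  have : 4 * K ^+ 2 * eps <= K ^+ 2 by have := eps1; have := eps0; have := K2; nra.
  lra.
have : K ^+ 2 * eps <= K ^+ 3 * eps by rewrite ler_pM2r.
have : 0 <= K ^+ 3 * eps by rewrite mulr_ge0 ?exprn_ge0// ltW// (lt_le_trans ltr01).
lra.
Qed.

(** Covariances about the empirical mean, whose coordinates are [Z1 / r] and [Z2 / r]; they arise
    because the tilt of the witnesses has to be centered. *)
Let Caa := Saa - Z1 ^+ 2 / r ^+ 2.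
Let Cbb := Sbb - Z2 ^+ 2 / r ^+ 2.
Let Cab := Sab - Z1 * Z2 / r ^+ 2.

(* The witnesses are [n^-1 * (1 - t i)] with [t] a centered linear form in [(a i, b i)]. *)
Let lb_gen (x1 x2 sigma : R) : `|x1| <= 2 * K -> `|x2| <= 2 * K ->
  x1 ^+ 2 * Caa + 2 * x1 * x2 * Cab + x2 ^+ 2 * Cbb <= sigma + 20 * eps * K ^+ 2 ->
  sigma <= 2 * K ^+ 2 ->
  exists p, [/\ forall i, 0 <= p i, \sum_i p i = 1,
    \sum_i p i * a i = r^-1 * (Z1 - (x1 * Caa + x2 * Cab)),
    \sum_i p i * b i = r^-1 * (Z2 - (x1 * Cab + x2 * Cbb)) &
    expR (- (sigma / 2 + err)) <= \prod_i (n%:R * p i)].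
Proof.
move=> x1K x2K xC sK.
pose t i := r^-1 * (x1 * (a i - Z1 / r) + x2 * (b i - Z2 / r)).
have K0 : 0 < K by exact: lt_le_trans K1.
have tm i : `|t i| <= 6 * K * eps.
  rewrite normrM ger0_norm ?invr_ge0 ?(ltW r0)// ler_pdivrMl//.
  apply: le_trans (ler_normD _ _) _; rewrite !normrM.
  have zr (z : R) : `|z| <= K -> `|z / r| <= K / r.
    by move=> zK; rewrite normrM normfV (gtr0_norm r0) ler_pM2r// invr_gt0.
  have Kr : K / r <= eps * r.
    rewrite ler_pdivrMr// -mulrA -expr2 r2; apply: le_trans n_large.
    by rewrite expr2 ler_peMl// ltW.
  have h1 : `|x1| * `|a i - Z1 / r| <= 2 * K * (`|a i| + K / r).
    by apply: ler_pM => //; apply: le_trans (ler_normB _ _) _; rewrite lerD2l zr.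
  have h2 : `|x2| * `|b i - Z2 / r| <= 2 * K * (`|b i| + K / r).
    by apply: ler_pM => //; apply: le_trans (ler_normB _ _) _; rewrite lerD2l zr.
  apply: le_trans (lerD h1 h2) _; rewrite -mulrDr.
  have -> : r * (6 * K * eps) = 2 * K * (3 * (eps * r)) by ring.
  rewrite ler_pM2l; last by rewrite mulr_gt0.
  by have := ab_max i; lra.
have st : \sum_i t i = 0.
  transitivity (\sum_i (0 * a i ^+ 2 + 0 * (a i * b i) + 0 * b i ^+ 2 + (r^-1 * x1) * a i +
     (r^-1 * x2) * b i + (- r^-1 * (x1 * Z1 / r + x2 * Z2 / r)))).
    by apply: eq_bigr => i _; rewrite /t; ring.
  by rewrite sum_quad; field.
have st2 : \sum_i t i ^+ 2 = x1 ^+ 2 * Caa + 2 * x1 * x2 * Cab + x2 ^+ 2 * Cbb.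
  pose c := x1 * Z1 / r + x2 * Z2 / r.
  transitivity (\sum_i ((r^-2 * x1 ^+ 2) * a i ^+ 2 + (r^-2 * (2 * x1 * x2)) * (a i * b i) +
     (r^-2 * x2 ^+ 2) * b i ^+ 2 + (r^-2 * (- 2 * c * x1)) * a i + (r^-2 * (- 2 * c * x2)) * b i +
     r^-2 * c ^+ 2)).
    by apply: eq_bigr => i _; rewrite /t /c; field.
  by rewrite sum_quad /c /Caa /Cbb /Cab; field.
have ta : \sum_i t i * a i = r * (x1 * Caa + x2 * Cab).
  transitivity (\sum_i ((r^-1 * x1) * a i ^+ 2 + (r^-1 * x2) * (a i * b i) + 0 * b i ^+ 2 +
     (- r^-1 * (x1 * Z1 / r + x2 * Z2 / r)) * a i + 0 * b i + 0)).
    by apply: eq_bigr => i _; rewrite /t; ring.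
  by rewrite sum_quad /Caa /Cab; field.
have tb : \sum_i t i * b i = r * (x1 * Cab + x2 * Cbb).
  transitivity (\sum_i (0 * a i ^+ 2 + (r^-1 * x1) * (a i * b i) + (r^-1 * x2) * b i ^+ 2 +
     0 * a i + (- r^-1 * (x1 * Z1 / r + x2 * Z2 / r)) * b i + 0)).
    by apply: eq_bigr => i _; rewrite /t; ring.
  by rewrite sum_quad /Cbb /Cab; field.
have mu2 : 6 * K * eps <= 1 / 2 by have := Keps; lra.
exists (fun i => n%:R^-1 * (1 - t i)); split.
- move=> i; rewrite mulr_ge0 ?invr_ge0 ?(ltW nR)//.
  by have := le_trans (tm i) mu2; rewrite ler_norml => /andP[]; lra.
- rewrite -mulr_sumr sumrB st subr0 sumr_const card_ord mulVf//.
- transitivity (n%:R^-1 * (\sum_i a i - \sum_i t i * a i)).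
    by rewrite -sumrB mulr_sumr; apply: eq_bigr => i _; ring.
  by rewrite SaE ta -r2; field.
- transitivity (n%:R^-1 * (\sum_i b i - \sum_i t i * b i)).
    by rewrite -sumrB mulr_sumr; apply: eq_bigr => i _; ring.
  by rewrite SbE tb -r2; field.
apply: le_trans (prod_weights_lb n0 tm mu2 st).
rewrite ler_expR st2 mulNr lerN2 /err.
set s := _ + x2 ^+ 2 * Cbb in xC st2 *.
have s3 : s <= 3 * K ^+ 2.
  apply: le_trans xC _; have : 20 * eps * K ^+ 2 <= K ^+ 2.
    by rewrite ler_piMl ?sqr_ge0//; have := eps1; lra.
  lra.
have h : 36 * (K * eps) * s <= 36 * (K * eps) * (3 * K ^+ 2).
  by rewrite ler_wpM2l// !mulr_ge0// ltW.
have -> : (1 / 2 + 6 * (6 * K * eps)) * s = s / 2 + 36 * (K * eps) * s by field.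
have h' : 36 * (K * eps) * (3 * K ^+ 2) = 108 * (K ^+ 3 * eps) by ring.
have h'' : K ^+ 2 * eps <= K ^+ 3 * eps by rewrite ler_pM2r.
have -> : 120 * K ^+ 3 * eps = 120 * (K ^+ 3 * eps) by ring.
have e' : 20 * eps * K ^+ 2 = 20 * (K ^+ 2 * eps) by ring.
rewrite e' in xC.
have k0 : 0 <= K ^+ 3 * eps by rewrite mulr_ge0 ?exprn_ge0// ltW.
move: xC h h' h'' k0; set A := K ^+ 3 * eps; set B := K ^+ 2 * eps.
set C1 := 36 * _ * s; set C2 := 36 * _ * (3 * _); lra.
Qed.

Let Kn : K ^+ 2 / r ^+ 2 <= eps.
Proof. by rewrite r2 ler_pdivrMr. Qed.

Let CaaE : `|Caa - 1| <= 2 * eps.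
Proof.
have h : 0 <= Z1 ^+ 2 / r ^+ 2 <= eps.
  rewrite divr_ge0 ?sqr_ge0//=; apply: le_trans Kn.
  by rewrite ler_pM2r ?sq_le// invr_gt0 exprn_gt0.
rewrite /Caa; move: Saa1 h; set v := Z1 ^+ 2 / _.
by rewrite !ler_norml => /andP[? ?] /andP[? ?]; apply/andP; split; lra.
Qed.

Let CbbE : `|Cbb - 1| <= 2 * eps.
Proof.
have h : 0 <= Z2 ^+ 2 / r ^+ 2 <= eps.
  rewrite divr_ge0 ?sqr_ge0//=; apply: le_trans Kn.
  by rewrite ler_pM2r ?sq_le// invr_gt0 exprn_gt0.
rewrite /Cbb; move: Sbb1 h; set v := Z2 ^+ 2 / _.
by rewrite !ler_norml => /andP[? ?] /andP[? ?]; apply/andP; split; lra.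
Qed.

Let CabE : `|Cab| <= 2 * eps.
Proof.
have h : `|Z1 * Z2 / r ^+ 2| <= eps.
  apply: le_trans Kn; rewrite normrM normfV (ger0_norm (sqr_ge0 r)) ler_pM2r ?invr_gt0 ?exprn_gt0//.
  by rewrite normrM expr2 ler_pM.
rewrite /Cab; move: Sab0 h; set v := Z1 * Z2 / _.
by rewrite !ler_norml => /andP[? ?] /andP[? ?]; apply/andP; split; lra.
Qed.

Lemma weights_ub2 (p : 'I_n -> R) : (forall i, 0 <= p i) -> \sum_i p i = 1 ->
  \sum_i p i * a i = 0 -> \sum_i p i * b i = 0 ->
  \prod_i (n%:R * p i) <= expR (- ((Z1 ^+ 2 + Z2 ^+ 2) / 2 - err)).
Proof.
by move=> p0 p1 pa pb; apply: ub_gen => //; rewrite pa pb !mulr0 addr0.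
Qed.

Lemma weights_ub1 (p : 'I_n -> R) : 0 <= Z1 -> (forall i, 0 <= p i) -> \sum_i p i = 1 ->
  \sum_i p i * a i <= 0 ->
  \prod_i (n%:R * p i) <= expR (- (Z1 ^+ 2 / 2 - err)).
Proof.
move=> z0 p0 p1 pa; rewrite (_ : Z1 ^+ 2 = Z1 ^+ 2 + 0 ^+ 2); last by rewrite expr0n addr0.
apply: ub_gen => //; first by rewrite normr0 (le_trans ler01).
  by rewrite mul0r expr0n.
by rewrite mul0r addr0 mulr_ge0_le0.
Qed.

Lemma weights_lb1 : exists p, [/\ forall i, 0 <= p i, \sum_i p i = 1,
    \sum_i p i * a i = 0 & expR (- (Z1 ^+ 2 / 2 + err)) <= \prod_i (n%:R * p i)].
Proof.
have K0 : 0 < K by exact: lt_le_trans K1.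
have e1 := eps1; have e0 := eps0.
have [C1 C2] : 1 - 2 * eps <= Caa /\ Caa <= 1 + 2 * eps.
  by move: CaaE; rewrite ler_norml => /andP[]; lra.
have C0 : 0 < Caa by lra.
have Cn : Caa != 0 by rewrite gt_eqF.
have i1 : Caa^-1 <= 1 + 10 * eps.
  rewrite -[leLHS]mul1r ler_pdivrMr//.
  have : (1 + 10 * eps) * (1 - 2 * eps) <= (1 + 10 * eps) * Caa by rewrite ler_pM2l//; lra.
  by apply: le_trans; nra.
have z2 := sq_le Z1K.
(* Only the first mean has to vanish, so the second multiplier is 0 and the first solves a single
   equation exactly. *)
have [||||p] := @lb_gen (Z1 / Caa) 0 (Z1 ^+ 2).
- rewrite normrM normfV (gtr0_norm C0) mulrC; apply: ler_pM => //; first by rewrite invr_ge0 ltW.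
  lra.
- by rewrite normr0 mulr_ge0// ltW.
- rewrite (_ : _ + _ = Z1 ^+ 2 * Caa^-1); last by field.
  apply: le_trans (ler_wpM2l (sqr_ge0 _) i1) _; rewrite mulrDr mulr1 lerD2l.
  have := sqr_ge0 Z1; move: z2 e0; set u := Z1 ^+ 2; nra.
- by apply: le_trans z2 _; have := K2; lra.
move=> [p0 p1 pa _ pb]; exists p; split => //.
by rewrite pa divfK// mul0r addr0 subrr mulr0.
Qed.

Lemma weights_lb2 : exists p, [/\ forall i, 0 <= p i, \sum_i p i = 1,
    \sum_i p i * a i = 0, \sum_i p i * b i = 0 &
    expR (- ((Z1 ^+ 2 + Z2 ^+ 2) / 2 + err)) <= \prod_i (n%:R * p i)].
Proof.
have K0 : 0 < K by exact: lt_le_trans K1.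
have e1 := eps1; have e0 := eps0.
have [A1 A2] : 1 - 2 * eps <= Caa /\ Caa <= 1 + 2 * eps.
  by move: CaaE; rewrite ler_norml => /andP[]; lra.
have [B1 B2] : 1 - 2 * eps <= Cbb /\ Cbb <= 1 + 2 * eps.
  by move: CbbE; rewrite ler_norml => /andP[]; lra.
have [G1 G2] : - (2 * eps) <= Cab /\ Cab <= 2 * eps.
  by move: CabE; rewrite ler_norml => /andP[].
pose D := Caa * Cbb - Cab ^+ 2.
have D1 : 1 - 4 * eps <= D.
  rewrite /D; have : (1 - 2 * eps) ^+ 2 <= Caa * Cbb by rewrite expr2 ler_pM; lra.
  have : Cab ^+ 2 <= (2 * eps) ^+ 2.
    rewrite -(real_normK (num_real Cab)) lerXn2r ?nnegrE//; lra.
  nra.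
have D0 : 0 < D by lra.
have Dn : D != 0 by rewrite gt_eqF.
have i1 : D^-1 <= 1 + 5 * eps.
  rewrite -[leLHS]mul1r ler_pdivrMr//.
  have : (1 + 5 * eps) * (1 - 4 * eps) <= (1 + 5 * eps) * D by rewrite ler_pM2l//; lra.
  by apply: le_trans; nra.
have iD : 0 <= D^-1 by rewrite invr_ge0 ltW.
have z1 := sq_le Z1K; have z2 := sq_le Z2K.
have solve (u v w y : R) : `|u| <= 1 + 2 * eps -> `|v| <= 2 * eps -> `|w| <= K -> `|y| <= K ->
    `|(u * w - v * y) / D| <= 2 * K.
  move=> *; rewrite normrM (ger0_norm iD).
  have : `|u * w - v * y| <= (1 + 4 * eps) * K.
    apply: le_trans (ler_normB _ _) _; rewrite !normrM.
    rewrite (_ : _ * K = (1 + 2 * eps) * K + 2 * eps * K); last by ring.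
    by apply: lerD; apply: ler_pM.
  move=> h; apply: (@le_trans _ _ ((1 + 4 * eps) * K * (1 + 5 * eps))).
    by apply: ler_pM.
  rewrite mulrAC ler_pM2r//; nra.
(* Cramer's rule for the 2 by 2 system that makes both weighted means vanish exactly, not just to
   first order. *)
pose x1 := (Cbb * Z1 - Cab * Z2) / D; pose x2 := (Caa * Z2 - Cab * Z1) / D.
have Ca : `|Caa| <= 1 + 2 * eps by rewrite ger0_norm; lra.
have Cb : `|Cbb| <= 1 + 2 * eps by rewrite ger0_norm; lra.
have E1 : x1 * Caa + x2 * Cab = Z1 by rewrite /x1 /x2 -[RHS](mulfK Dn) /D; field.
have E2 : x1 * Cab + x2 * Cbb = Z2 by rewrite /x1 /x2 -[RHS](mulfK Dn) /D; field.
have [||||p] := @lb_gen x1 x2 (Z1 ^+ 2 + Z2 ^+ 2).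
- exact: solve.
- exact: solve.
- rewrite (_ : _ + _ = x1 * (x1 * Caa + x2 * Cab) + x2 * (x1 * Cab + x2 * Cbb)); last by ring.
  rewrite E1 E2 (_ : _ + _ = (Cbb * Z1 ^+ 2 - 2 * Cab * (Z1 * Z2) + Caa * Z2 ^+ 2) * D^-1); last first.
    by rewrite /x1 /x2; ring.
  have u1 := sqr_ge0 Z1; have u2 := sqr_ge0 Z2.
  set tau := Z1 ^+ 2 + Z2 ^+ 2.
  have num : Cbb * Z1 ^+ 2 - 2 * Cab * (Z1 * Z2) + Caa * Z2 ^+ 2 <= (1 + 4 * eps) * tau.
    have q1 : Cbb * Z1 ^+ 2 <= (1 + 2 * eps) * Z1 ^+ 2 by rewrite ler_wpM2r.
    have q2 : Caa * Z2 ^+ 2 <= (1 + 2 * eps) * Z2 ^+ 2 by rewrite ler_wpM2r.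
    have q3 : - (2 * Cab * (Z1 * Z2)) <= 2 * eps * tau.
      have h : `|2 * (Z1 * Z2)| <= tau.
        rewrite ler_norml /tau; have := sqr_ge0 (Z1 - Z2); have := sqr_ge0 (Z1 + Z2).
        by rewrite !expr2 => *; apply/andP; split; lra.
      apply: le_trans (ler_norm _) _; rewrite normrN (_ : 2 * Cab * _ = Cab * (2 * (Z1 * Z2))); last by ring.
      by rewrite normrM ler_pM.
    by rewrite /tau; move: q1 q2 q3; rewrite /tau; lra.
  have t0 : 0 <= tau by rewrite addr_ge0.
  have tK : tau <= 2 * K ^+ 2 by rewrite /tau; lra.
  apply: (@le_trans _ _ ((1 + 4 * eps) * tau * (1 + 5 * eps))).
    apply: (@le_trans _ _ ((1 + 4 * eps) * tau * D^-1)); first by rewrite ler_wpM2r.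
    by rewrite ler_wpM2l// mulr_ge0//; lra.
  (* As [tau <= 2 * K ^+ 2], the excess [10 * eps * tau] fits the allowance [20 * eps * K ^+ 2] of
     [lb_gen]. *)
  have : (1 + 4 * eps) * (1 + 5 * eps) <= 1 + 10 * eps by nra.
  move=> /(ler_wpM2r t0); rewrite mulrAC => /le_trans; apply.
  rewrite mulrDl mul1r lerD2l; move: tK e0; nra.
- lra.
move=> [p0 p1 pa pb pp]; exists p; split => //.
- by rewrite pa E1 subrr mulr0.
- by rewrite pb E2 subrr mulr0.
Qed.

End empirical_bounds.

(** * Measurability of the empirical likelihood *)

Section sup_unit.
Context {R : realType}.
Implicit Types S : set R.

Lemma sup_ge0 S : (forall r, S r -> 0 <= r <= 1) -> 0 <= sup S.
Proof.
move=> S01; have [->|/set0P[r Sr]] := eqVneq S set0; first by rewrite sup0.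
have /andP[r0 _] := S01 r Sr; apply: le_trans r0 _.
by apply: ub_le_sup => //; exists 1 => x /S01 /andP[].
Qed.

Lemma le_sup1 S r : (forall r, S r -> 0 <= r <= 1) -> S r -> r <= sup S.
Proof. by move=> S01 Sr; apply: ub_le_sup => //; exists 1 => x /S01 /andP[]. Qed.

(** [0 <= u] covers the empty set, whose supremum is 0 by convention. *)
Lemma sup_le S u : 0 <= u -> (forall r, S r -> r <= u) -> sup S <= u.
Proof.
move=> u0 Su; have [->|/set0P S0] := eqVneq S set0; first by rewrite sup0.
exact: ge_sup.
Qed.

End sup_unit.

Section zero_in_box.
Context {R : realType} d (Omega : measurableType d) (n : nat).
Variable G : ('I_n -> R) -> Omega -> R.
Hypothesis G0 : forall p w, 0 <= G p w.
Hypothesis cG : forall w, continuous (fun v : 'rV[R]_n => G (fun i => v ord0 i) w).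
Hypothesis mG : forall p, measurable_fun setT (G p).

Let box : set 'rV[R]_n := [set v | forall i, `[0, 1]%classic (v ord0 i)].

Let rv (q : {ffun 'I_n -> rat}) (i : 'I_n) : R := ratr (q i).

(* By compactness of the box a zero exists as soon as there are approximate
   zeros, and those may be taken rational. *)
Let zero_boxE : [set w | exists p : 'I_n -> R, (forall i, 0 <= p i <= 1) /\ G p w = 0] =
  \bigcap_k \bigcup_(q : {ffun 'I_n -> rat})
    [set w | [forall i, 0 <= rv q i <= 1] && (G (rv q) w < k.+1%:R^-1)].
Proof.
have Erow (p : 'I_n -> R) w : G (fun i => (\row_j p j) ord0 i) w = G p w.
  by congr (G _ _); apply/funext => i; rewrite mxE.
apply/seteqP; split => w /=.
  move=> [p [p01 Gp]] k _.
  have k0 : 0 < k.+1%:R^-1 :> R by rewrite invr_gt0.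
  have /cvgrPdist_lt/(_ _ k0) := @cG w (\row_i p i).
  rewrite Erow Gp => /nbhs_ballP[e /= e0 be].
  have H i : exists q : rat, 0 <= (ratr q : R) <= 1 /\ `|p i - ratr q| < e.
    have /andP[p0 p1] := p01 i.
    (* Cutting the interval to the unit interval keeps the rational admissible even when [p i] is 0
       or 1. *)
    have lt : Num.max (p i - e) 0 < Num.min (p i + e) 1.
      by rewrite gt_max !lt_min; apply/andP; split; apply/andP; split; lra.
    have [q] := rat_in_itvoo lt.
    rewrite in_itv/= gt_max lt_min => /andP[/andP[h1 h2] /andP[h3 h4]].
    exists q; split; first by rewrite !ltW.
    by rewrite ltr_norml; apply/andP; split; lra.
  have {}H i := cid (H i).
  exists [ffun i => sval (H i)] => //=.
  have rvE i : rv [ffun i => sval (H i)] i = ratr (sval (H i)) by rewrite /rv ffunE.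
  apply/andP; split.
    by apply/forallP => i; rewrite rvE; case: (svalP (H i)).
  have := be (\row_i rv [ffun i => sval (H i)] i).
  rewrite /= sub0r normrN Erow ger0_norm//; apply.
  by split => // i j; rewrite !mxE /ball /= rvE; case: (svalP (H j)).
move=> H.
have cb : compact box.
  by apply: (@rV_compact _ _ (fun=> `[(0 : R), 1]%classic)) => i; exact: segment_compact.
have b0 : box !=set0.
  by exists (\row_i 0) => i; rewrite mxE /= in_itv/= lexx ler01.
have [v bv vmin] := compact_EVT_min b0 cb (continuous_subspaceT (@cG w)).
exists (fun i => v ord0 i); split.
  by move=> i; have := set_mem bv i; rewrite /= in_itv.
apply/eqP; rewrite eq_le G0 andbT leNgt; apply/negP => g0.
have /cvgrPdist_lt/(_ _ g0) [N _ NH] := @cvg_harmonic R.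
have [q _ /= /andP[/forallP q01 Gq]] := H N I.
have := vmin (\row_i rv q i); rewrite Erow.
have qb : \row_i rv q i \in box by apply/mem_set => i; rewrite mxE /= in_itv/=.
move=> /(_ qb) /le_lt_trans/(_ Gq); have := NH N (leqnn N).
rewrite /harmonic /= sub0r normrN ger0_norm// => h1 h2.
by have := lt_trans h1 h2; rewrite ltxx.
Qed.

Lemma measurable_zero_in_box :
  measurable [set w | exists p : 'I_n -> R, (forall i, 0 <= p i <= 1) /\ G p w = 0].
Proof.
rewrite zero_boxE; apply: bigcapT_measurable => k.
apply: countable_bigcupT_measurable; first exact: countableP.
move=> q; apply: measurable_boolset; case: [forall i, _]; last exact: measurable_cst.
exact: measurable_fun_ltr.
Qed.

End zero_in_box.

Lemma measurable_fun_superlevel (R : realType) d (T : measurableType d) (f : T -> R) :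
  (forall c, measurable [set t | c <= f t]) -> measurable_fun setT f.
Proof.
move=> mf; apply: (measurability (@RGenCInfty.G R)) => [|/= _ [_] [c] -> <-].
  exact: RGenCInfty.measurableE.
rewrite setTI (_ : _ @^-1` _ = [set t | c <= f t])//.
by apply/seteqP; split => t /=; rewrite in_itv/= andbT.
Qed.

Section sup_weights.
Context {R : realType} d (Omega : measurableType d) (n : nat).
Hypothesis n0 : (0 < n)%N.
Variables (C : ('I_n -> R) -> Omega -> Prop) (h : ('I_n -> R) -> Omega -> R).
Hypothesis hC : forall p w, C p w <-> h p w = 0.
Hypothesis h0 : forall p w, 0 <= h p w.
Hypothesis ch : forall w, continuous (fun v : 'rV[R]_n => h (fun i => v ord0 i) w).
Hypothesis mh : forall p, measurable_fun setT (h p).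

Definition weight_products (w : Omega) : set R :=
  [set r | exists p : 'I_n -> R, [/\ forall i, 0 <= p i, \sum_i p i = 1, C p w
     & r = \prod_i (n%:R * p i)]].

Lemma weight_products01 w r : weight_products w r -> 0 <= r <= 1.
Proof.
move=> [p [p0 p1 _ ->]]; apply/andP; split.
  by apply: prodr_ge0 => i _; exact: mulr_ge0.
by apply: prod_weights_le1 => //; rewrite p1.
Qed.

(** A penalty that, for nonnegative weights, vanishes exactly when the constraints hold and the
    product is at least [c]; attaining the level [c] thus becomes the existence of a zero. The bound
    [p i <= 1] of the box follows from the sum. *)
Let G (c : R) (p : 'I_n -> R) (w : Omega) : R :=
  `|\sum_i p i - 1| + h p w + Num.max 0 (c - \prod_i (n%:R * p i)).

Let max0 (x y : R) : 0 <= Num.max 0 (x - y).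
Proof. by rewrite le_max lexx. Qed.

Let G_zero c p w : G c p w = 0 <->
  [/\ \sum_i p i = 1, C p w & c <= \prod_i (n%:R * p i)].
Proof.
have z3 (x y z : R) : 0 <= x -> 0 <= y -> 0 <= z -> x + y + z = 0 -> [/\ x = 0, y = 0 & z = 0].
  by move=> *; split; lra.
rewrite /G; split => [E|[-> /hC -> cp]].
  have [E1 E2 E3] := z3 _ _ _ (normr_ge0 _) (h0 p w) (max0 c _) E.
  split; last by rewrite -subr_le0 -E3 le_max lexx orbT.
    by apply/eqP; rewrite -subr_eq0 -normr_eq0 E1.
  exact/hC.
by rewrite subrr normr0 !add0r; apply/max_idPl; rewrite subr_le0.
Qed.

Let measurable_attained c : measurable [set w | exists p : 'I_n -> R,
  [/\ forall i, 0 <= p i, \sum_i p i = 1, C p w & c <= \prod_i (n%:R * p i)]].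
Proof.
rewrite (_ : [set w | _] =
  [set w | exists p : 'I_n -> R, (forall i, 0 <= p i <= 1) /\ G c p w = 0]).
  apply: measurable_zero_in_box.
  - by move=> p w; rewrite /G !addr_ge0.
  - move=> w v.
    have FF : Filter (nbhs v) := nbhs_filter v.
    have c1 : (fun v' : 'rV[R]_n => `|\sum_i v' ord0 i - 1|) @ v --> `|\sum_i v ord0 i - 1|.
      apply: cvg_norm.
      have c0 : (fun v' : 'rV[R]_n => \sum_i v' ord0 i) @ v --> \sum_i v ord0 i.
        exact: (continuous_big (@add_continuous _) (fun i _ => @coord_continuous _ _ _ ord0 i)).
      exact: (cvgB c0 (cvg_cst (1 : R))).
    have c2 : (fun v' : 'rV[R]_n => c - \prod_i (n%:R * v' ord0 i)) @ v -->
        c - \prod_i (n%:R * v ord0 i).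
      have c0 : (fun v' : 'rV[R]_n => \prod_i (n%:R * v' ord0 i)) @ v --> \prod_i (n%:R * v ord0 i).
        have cm i : true -> continuous (fun v' : 'rV[R]_n => n%:R * v' ord0 i).
          move=> _ v'.
          have cc : (fun u : 'rV[R]_n => u ord0 i) @ v' --> v' ord0 i by exact: coord_continuous.
          have FF' : Filter (nbhs v') := nbhs_filter v'.
          exact: (@cvgMl_tmp _ _ (nbhs v') FF' (fun u : 'rV[R]_n => u ord0 i) n%:R (v' ord0 i) cc).
        exact: (continuous_big (@mul_continuous _) cm).
      exact: (cvgB (cvg_cst c) c0).
    have c3 : (fun v' : 'rV[R]_n => Num.max 0 (c - \prod_i (n%:R * v' ord0 i))) @ v -->
        Num.max 0 (c - \prod_i (n%:R * v ord0 i)).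
      by apply: (continuous_max (f := fun _ => 0) (g := fun v' : 'rV[R]_n => c - \prod_i (n%:R * v' ord0 i)));
        [exact: cvg_cst|exact: c2].
    exact: (cvgD (cvgD c1 (@ch w v)) c3).
  - move=> p; apply: measurable_funD => //; apply: measurable_funD => //.
apply/seteqP; split => w /=.
  move=> [p [p0 p1 Cp cp]]; exists p; split; last exact/G_zero.
  move=> i; rewrite p0/= -p1 (bigD1 i)//= lerDl sumr_ge0//.
move=> [p [p01 /G_zero[p1 Cp cp]]]; exists p; split => // i.
by have /andP[] := p01 i.
Qed.

Lemma measurable_sup_weights : measurable_fun setT (fun w => sup (weight_products w)).
Proof.
apply: measurable_fun_superlevel => c.
(* A nonpositive level is always reached, also where no weights are admissible and the supremum is 0
   by convention; a positive level forces admissible weights to exist. *)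
have [c0|c0] := leP c 0.
  rewrite (_ : [set t | _] = setT)//; apply/seteqP; split => // w _ /=.
  by apply: le_trans c0 _; apply: sup_ge0 => r; exact: weight_products01.
rewrite (_ : [set w | _] = \bigcap_k [set w | exists p : 'I_n -> R,
  [/\ forall i, 0 <= p i, \sum_i p i = 1, C p w & c - k.+1%:R^-1 <= \prod_i (n%:R * p i)]]).
  exact: bigcapT_measurable.
apply/seteqP; split => w /=.
  move=> cs k _ /=.
  have S0 : weight_products w !=set0.
    by apply/set0P/negP => /eqP S0; move: cs; rewrite S0 sup0 leNgt c0.
  have hs : has_sup (weight_products w).
    by split => //; exists 1 => r /weight_products01 /andP[].
  have k0 : 0 < k.+1%:R^-1 :> R by rewrite invr_gt0.
  have [_ [p [p0 p1 Cp ->]] pr] := sup_adherent k0 hs.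
  exists p; split => //; apply: le_trans (ltW pr); exact: lerB.
move=> H; apply/ler_addgt0Pr => e e0.
have /cvgrPdist_lt/(_ _ e0) [N _ NH] := @cvg_harmonic R.
have [p [p0 p1 Cp cp]] := H N I.
have := NH N (leqnn N); rewrite /harmonic /= sub0r normrN ger0_norm// => he.
have : \prod_i (n%:R * p i) <= sup (weight_products w).
  by apply: le_sup1 => [r|]; [exact: weight_products01|exists p].
rewrite -lerBlDr; apply: le_trans; apply: le_trans cp.
by rewrite lerD2l lerN2 ltW.
Qed.

End sup_weights.

Section empirical_likelihood.
Context {R : realType}.
Local Notation V := (R * R)%type.

Lemma sum_scale_pair n (p : 'I_n -> R) (z : 'I_n -> V) :
  \sum_i p i *: z i = (\sum_i p i * (z i).1, \sum_i p i * (z i).2).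
Proof.
elim: n p z => [|n IH] p z; first by rewrite !big_ord0.
by rewrite !big_ord_recr IH.
Qed.

Definition EL_set n (x : 'I_n -> V) (mu : V) : set R :=
  [set r | exists p : 'I_n -> R, [/\ forall i, 0 <= p i, \sum_i p i = 1,
     \sum_i p i *: (x i - mu) = 0 & r = \prod_i (n%:R * p i)]].

Definition half_set n (x : 'I_n -> V) : set R :=
  [set r | exists p : 'I_n -> R, [/\ forall i, 0 <= p i, \sum_i p i = 1,
     \sum_i p i * ((x i).1 - (x i).2) <= 0 & r = \prod_i (n%:R * p i)]].

Lemma EL_set01 n (n0 : (0 < n)%N) (x : 'I_n -> V) mu r : EL_set x mu r -> 0 <= r <= 1.
Proof.
move=> [p [p0 p1 _ ->]]; apply/andP; split.
  by apply: prodr_ge0 => i _; exact: mulr_ge0.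
by apply: prod_weights_le1 => //; rewrite p1.
Qed.

Lemma half_set01 n (n0 : (0 < n)%N) (x : 'I_n -> V) r : half_set x r -> 0 <= r <= 1.
Proof.
move=> [p [p0 p1 _ ->]]; apply/andP; split.
  by apply: prodr_ge0 => i _; exact: mulr_ge0.
by apply: prod_weights_le1 => //; rewrite p1.
Qed.

Lemma EL01 n (n0 : (0 < n)%N) (x : 'I_n -> V) mu : 0 <= EL x mu <= 1.
Proof.
apply/andP; split; first by apply: sup_ge0 => r; exact: EL_set01.
by apply: sup_le => // r /(EL_set01 n0) /andP[].
Qed.

(* Over the half plane the profile likelihood is a one-dimensional problem. *)
Lemma max_ELE n (n0 : (0 < n)%N) (x : 'I_n -> V) : max_EL x Theta = sup (half_set x).
Proof.
have M01 r : [set EL x nu | nu in Theta] r -> 0 <= r <= 1.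
  by move=> [nu _ <-]; exact: EL01.
have H01 r := @half_set01 n n0 x r.
have lin (p : 'I_n -> R) nu : \sum_i p i = 1 -> \sum_i p i *: (x i - nu) = 0 ->
    nu = \sum_i p i *: x i.
  move=> p1; under eq_bigr do rewrite scalerBr.
  by rewrite sumrB -scaler_suml p1 scale1r => /eqP; rewrite subr_eq0 => /eqP.
have half (p : 'I_n -> R) : (\sum_i p i *: x i).1 - (\sum_i p i *: x i).2 =
    \sum_i p i * ((x i).1 - (x i).2).
  by rewrite sum_scale_pair /= -sumrB; apply: eq_bigr => i _; rewrite mulrBr.
apply/eqP; rewrite eq_le; apply/andP; split.
- apply: sup_le => [|_ [nu nuT <-]]; first exact: sup_ge0.
  apply: sup_le => [|r [p [p0 p1 px ->]]]; first exact: sup_ge0.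
  apply: le_sup1 => //; exists p; split => //.
  by rewrite -half -(lin _ _ p1 px) subr_le0.
- apply: sup_le => [|r [p [p0 p1 px ->]]]; first exact: sup_ge0.
  apply: (@le_trans _ _ (EL x (\sum_i p i *: x i))).
    apply: le_sup1; first by move=> r'; exact: EL_set01.
    exists p; split => //; under eq_bigr do rewrite scalerBr.
    by rewrite sumrB -scaler_suml p1 scale1r subrr.
  apply: le_sup1 => //; exists (\sum_i p i *: x i) => //.
  by rewrite /Theta /= -subr_le0 half.
Qed.

(** The form without logarithm absorbs the conventions: if only [EL] vanishes both sides fail, and
    if [max_EL] vanishes both hold because [0 <= q]. It also turns coverage into a comparison of
    measurable functions. *)
Lemma ELR_le n (n0 : (0 < n)%N) (x : 'I_n -> V) (mu : V) (q : R) : 0 <= q ->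
  (constrained_ELR x Theta mu <= q%:E)%E = (expR (- (q / 2)) * max_EL x Theta <= EL x mu).
Proof.
move=> q0; rewrite /constrained_ELR.
have /andP[e0 _] := EL01 n0 x mu.
have m0 : 0 <= max_EL x Theta.
  by rewrite max_ELE//; apply: sup_ge0 => r; exact: half_set01.
case: ltP => m1.
  have M0 : max_EL x Theta != 0 by rewrite gt_eqF.
  rewrite /neg2log -ler_pdivlMr//; set r := EL x mu / _.
  have r0 : 0 <= r by rewrite divr_ge0.
  move: r0; rewrite le_eqVlt => /predU1P[<-|r0].
    rewrite [RHS]leNgt expR_gt0 le0_lneNy//.
    by rewrite lt0_muleNy// lte_fin; lra.
  rewrite lne_EFin// -EFinM lee_fin -[r in RHS]lnK ?posrE// ler_expR.
  by apply/idP/idP => ?; lra.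
have -> : max_EL x Theta = 0 by apply/eqP; rewrite eq_le m0 m1.
by rewrite mulr0 e0 lee_fin q0.
Qed.

Section measurability.
Context d (Omega : measurableType d) n (n0 : (0 < n)%N).
Variables (X : 'I_n -> Omega -> V) (mX : forall i, measurable_fun setT (X i)).

Let mX1 i : measurable_fun setT (fun w => (X i w).1).
Proof. exact: (measurableT_comp measurable_fst (mX i)). Qed.
Let mX2 i : measurable_fun setT (fun w => (X i w).2).
Proof. exact: (measurableT_comp measurable_snd (mX i)). Qed.

Let clin (c : 'I_n -> R) : continuous (fun v : 'rV[R]_n => \sum_i v ord0 i * c i).
Proof.
have cm i : true -> continuous (fun v' : 'rV[R]_n => v' ord0 i * c i).
  move=> _ v'.
  have cc : (fun u : 'rV[R]_n => u ord0 i) @ v' --> v' ord0 i by exact: coord_continuous.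
  have FF' : Filter (nbhs v') := nbhs_filter v'.
  exact: (@cvgMr_tmp _ _ (nbhs v') FF' (fun u : 'rV[R]_n => u ord0 i) (v' ord0 i) (c i) cc).
exact: (continuous_big (@add_continuous _) cm).
Qed.

Lemma measurable_EL (mu : V) : measurable_fun setT (fun w => EL (X^~ w) mu).
Proof.
pose C (p : 'I_n -> R) w := \sum_i p i *: (X i w - mu) = 0.
pose h (p : 'I_n -> R) w := `|\sum_i p i * ((X i w).1 - mu.1)| + `|\sum_i p i * ((X i w).2 - mu.2)|.
apply: (@measurable_sup_weights _ _ _ n n0 C h).
- move=> p w; rewrite /C /h sum_scale_pair; split.
    by move=> [-> ->]; rewrite normr0 addr0.
  by move=> /eqP; rewrite paddr_eq0// !normr_eq0 => /andP[/eqP -> /eqP ->].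
- by move=> p w; rewrite addr_ge0.
- move=> w v.
  exact: (@cvgD _ _ _ _ _ _ _ _ _ (cvg_norm (@clin (fun i => (X i w).1 - mu.1) v))
    (cvg_norm (@clin (fun i => (X i w).2 - mu.2) v))).
- move=> p; apply: measurable_funD; apply: measurableT_comp => //;
  apply: measurable_sum => i; apply: measurable_funM => //; exact: measurable_funB.
Qed.

Lemma measurable_max_EL : measurable_fun setT (fun w => max_EL (X^~ w) Theta).
Proof.
under [X in measurable_fun _ X]eq_fun do rewrite max_ELE//.
pose C (p : 'I_n -> R) w := \sum_i p i * ((X i w).1 - (X i w).2) <= 0.
pose h (p : 'I_n -> R) w := Num.max 0 (\sum_i p i * ((X i w).1 - (X i w).2)).
apply: (@measurable_sup_weights _ _ _ n n0 C h).
- by move=> p w; rewrite /C /h; split => [/max_idPl //|/max_idPl].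
- by move=> p w; rewrite le_max lexx.
- move=> w v.
  exact: (continuous_max (f := fun _ => 0) (cvg_cst 0) (@clin _ v)).
- move=> p; apply: measurable_maxr => //.
  apply: measurable_sum => i; apply: measurable_funM => //; exact: measurable_funB.
Qed.

End measurability.
End empirical_likelihood.

(** * Coverage *)

Section maximum.
Context {R : realType} d (Omega : measurableType d) (P : probability Omega R).
Local Notation V := (R * R)%type.
Variables (X : nat -> {RV P >-> V}) (F : probability V R).
Hypothesis X_law : forall (i : nat) (A : set V),
  measurable A -> distribution P (X i) A = F A.
Variables a b : {mfun V >-> R}.
Hypothesis ab_std : standard_pair F a b.

Definition exceed (e : R) n (x : V) : bool := e * Num.sqrt n%:R < `|a x| + `|b x|.

Lemma measurable_exceed e n : measurable_fun setT (exceed e n).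
Proof. by apply: measurable_fun_ltr => //; exact: measurable_norm_add. Qed.

Lemma measurable_count_exceed e n :
  measurable_fun setT (fun w => 1 <= \sum_(i < n) (exceed e n (X i w))%:R :> R).
Proof.
apply: measurable_fun_ler => //; apply: measurable_sum => i.
have [mE _] := bmeas_bool (R := R) (measurable_exceed e n).
exact: (measurableT_comp mE (measurable_funPT (X i))).
Qed.

(** Markov's inequality adapted to [lind]: on exceedance the squared size is at least
    [e ^+ 2 * n%:R] and the truncation factor at least [Num.min 1 e]. *)
Lemma exceed_le (e : R) n x : 0 < e -> (0 < n)%N ->
  (exceed e n x)%:R <= (e ^+ 2 * Num.min 1 e)^-1 * n%:R^-1 *
    ((`|a x| + `|b x|) ^+ 2 * Num.min 1 ((Num.sqrt n%:R)^-1 * (`|a x| + `|b x|))).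
Proof.
move=> e0 n0; rewrite /exceed; set m := `|a x| + _.
have nR : (0 : R) < n%:R by rewrite ltr0n.
have r0 : (0 : R) < Num.sqrt n%:R by rewrite sqrtr_gt0.
have e1 : 0 < Num.min 1 e by rewrite lt_min ltr01.
have ee : 0 < e ^+ 2 * Num.min 1 e by rewrite mulr_gt0// exprn_gt0.
have m0 : 0 <= m by rewrite addr_ge0.
have [h|_] := ltP (e * Num.sqrt n%:R) m; last first.
  apply: mulr_ge0; first by rewrite mulr_ge0// invr_ge0 ltW.
  by rewrite mulr_ge0 ?sqr_ge0// le_min ler01 mulr_ge0// invr_ge0 ltW.
rewrite -invfM ler_pdivlMl ?mulr_gt0// mulr1.
rewrite mulrAC; apply: ler_pM; rewrite ?mulr_ge0 ?exprn_ge0 ?(ltW e0) ?(ltW e1) ?(ltW nR)//.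
  rewrite (_ : e ^+ 2 * n%:R = (e * Num.sqrt n%:R) ^+ 2); last first.
    by rewrite exprMn sqr_sqrtr// ltW.
  by rewrite lerXn2r ?nnegrE ?mulr_ge0 ?(ltW e0) ?(ltW r0) ?(ltW h).
rewrite le_min !ge_min lexx/=; apply/orP; right.
by rewrite ler_pdivlMl// mulrC ltW.
Qed.

(** A union bound over the [n] observations: the factor [n] cancels the [n%:R^-1] of [exceed_le],
    and [lind] tends to 0. Exceedance by the maximum is phrased as a count because sums are readily
    measurable. *)
Lemma max_small (e : R) : 0 < e ->
  fine (P [set w | 1 <= \sum_(i < n) (exceed e n (X i w))%:R :> R]) @[n --> \oo] --> 0.
Proof.
move=> e0; pose C := (e ^+ 2 * Num.min 1 e)^-1.
have L : C * lind F a b (Num.sqrt n%:R)^-1 @[n --> \oo] --> 0.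
  by rewrite -[X in _ --> X](mulr0 C); apply: cvgMl_tmp; exact: lind_cvg0.
apply: squeeze_cvgr (cvg_cst 0) L; near=> n.
have n0 : (0 < n)%N by near: n; exact: nbhs_infty_gt.
have nR : (0 : R) < n%:R by rewrite ltr0n.
rewrite fine_ge0//= -(Rintegral_bool P (measurable_count_exceed e n)).
pose f (x : V) : R := (exceed e n x)%:R.
have bf : bmeas f by exact: (bmeas_bool (measurable_exceed e n)).
have bfX i : bmeas (fun w => f (X i w)) by exact: bmeas_comp bf.
have rf i : rint P (fun w => f (X i w)) by exact/bmeas_integrable.
have [rS iS] := rintegral_sum n rf.
have law i : \int[P]_w f (X i w) = \int[F]_x f x.
  rewrite -Rintegral_distribution// /Rintegral; congr fine.
  by apply: eq_measure_integral => A mA _; exact: X_law.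
apply: (@le_trans _ _ (\int[P]_w \sum_(i < n) f (X i w))).
  apply: Rintegral_le => //.
    exact/bmeas_integrable/bmeas_bool/measurable_count_exceed.
  move=> w; case: (leP 1 _) => [//|_].
  by apply: sumr_ge0 => i _; exact: ler0n.
rewrite iS; under eq_bigr do rewrite law.
rewrite sumr_const card_ord -[leLHS]mulr_natl.
have r0 : (0 : R) <= (Num.sqrt n%:R)^-1 by rewrite invr_ge0.
have : \int[F]_x f x <= C * n%:R^-1 * lind F a b (Num.sqrt n%:R)^-1.
  rewrite /lind -rintegralZ; last exact: rint_lind.
  apply: Rintegral_le; first exact: bmeas_integrable.
    by apply: rintZ; exact: rint_lind.
  by move=> x; exact: exceed_le.
move=> h; apply: le_trans (ler_wpM2l (ltW nR) h) _.
by rewrite mulrA [n%:R * _]mulrC divfK ?gt_eqF.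
Unshelve. all: by end_near. Qed.

End maximum.

Section empirical_likelihood_bounds.
Context {R : realType} (n : nat) (x : 'I_n -> R * R) (mu : R * R) (s1 s2 kappa : R).
Variables (a b : 'I_n -> R) (K eps : R).
Hypotheses (s1_gt0 : 0 < s1) (s2_gt0 : 0 < s2).
Hypothesis x_diff : forall i, ((x i).1 - mu.1) - ((x i).2 - mu.2) = s1 * a i.
Hypothesis x_snd : forall i, (x i).2 - mu.2 = kappa * a i + s2 * b i.
Hypothesis mu_Theta : mu.1 <= mu.2.
Hypothesis n0 : (0 < n)%N.
Hypotheses (K1 : 1 <= K) (eps0 : 0 < eps) (eps_small : 100 * K * eps <= 1).
Hypothesis n_large : K ^+ 2 <= eps * n%:R.
Local Notation Z1 := (std_sum a).
Local Notation Z2 := (std_sum b).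
Hypotheses (Z1K : `|Z1| <= K) (Z2K : `|Z2| <= K).
Hypothesis Saa1 : `|emp_mean (fun i => a i ^+ 2) - 1| <= eps.
Hypothesis Sbb1 : `|emp_mean (fun i => b i ^+ 2) - 1| <= eps.
Hypothesis Sab0 : `|emp_mean (fun i => a i * b i)| <= eps.
Hypothesis ab_max : forall i, `|a i| + `|b i| <= eps * Num.sqrt n%:R.
Hypothesis mu_far : mu.1 < mu.2 -> s1 * K <= (mu.2 - mu.1) * Num.sqrt n%:R.

Let err : R := 120 * K ^+ 3 * eps.
Let err0 : 0 <= err.
Proof. by rewrite /err !mulr_ge0 ?exprn_ge0 ?(le_trans ler01 K1) ?(ltW eps0). Qed.

Let momentE p : \sum_i p i *: (x i - mu) = 0 <->
  \sum_i p i * a i = 0 /\ \sum_i p i * b i = 0.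
Proof.
rewrite sum_scale_pair.
have E2 : \sum_i p i * (x i - mu).2 = kappa * \sum_i p i * a i + s2 * \sum_i p i * b i.
  rewrite !mulr_sumr -big_split; apply: eq_bigr => i _.
  by rewrite /= x_snd; ring.
have E1 : \sum_i p i * (x i - mu).1 = s1 * \sum_i p i * a i + \sum_i p i * (x i - mu).2.
  rewrite !mulr_sumr -big_split; apply: eq_bigr => i _.
  by rewrite /= -[(x i).1 - mu.1](subrK ((x i).2 - mu.2)) x_diff; ring.
split=> [[e1 e2]|[pa pb]]; last by rewrite E1 E2 pa pb !mulr0 !addr0.
move: E1; rewrite e1 e2 addr0 => /esym/eqP; rewrite mulf_eq0 gt_eqF//= => /eqP pa.
move: E2; rewrite e2 pa mulr0 add0r => /esym/eqP.
by rewrite mulf_eq0 gt_eqF//= => /eqP pb.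
Qed.

Let halfE p : \sum_i p i = 1 ->
  \sum_i p i * ((x i).1 - (x i).2) = s1 * (\sum_i p i * a i) - (mu.2 - mu.1).
Proof.
move=> p1; rewrite -[X in _ - X]mul1r -p1 mulr_suml mulr_sumr -sumrB.
by apply: eq_bigr => i _; rewrite mulrCA -x_diff; ring.
Qed.

Let EL_bounds : expR (- ((Z1 ^+ 2 + Z2 ^+ 2) / 2 + err)) <= EL x mu <=
  expR (- ((Z1 ^+ 2 + Z2 ^+ 2) / 2 - err)).
Proof.
apply/andP; split.
  have [p [p0 p1 pa pb h]] :=
    weights_lb2 n0 K1 eps0 eps_small n_large Z1K Z2K Saa1 Sbb1 Sab0 ab_max.
  apply: le_trans h _; apply: le_sup1; first by move=> r; exact: EL_set01.
  by exists p; split => //; exact/momentE.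
apply: sup_le => [|_ [p [p0 p1 /momentE[pa pb] ->]]]; first exact: expR_ge0.
exact: (weights_ub2 n0 K1 eps0 eps_small Z1K Z2K Saa1 Sbb1 Sab0 ab_max).
Qed.

Definition limit_stat : R :=
  (if mu.1 == mu.2 then neg_sqr Z1 else sqr Z1) + sqr Z2.

(** The uniform weights attain the AM-GM bound 1, so the maximum is trivial once they are feasible:
    in the interior for large [n], and on the diagonal when [Z1 <= 0]. *)
Let half_uniform : s1 * Z1 <= (mu.2 - mu.1) * Num.sqrt n%:R -> max_EL x Theta = 1.
Proof.
move=> h; apply/eqP; rewrite eq_le max_ELE//; apply/andP; split.
  by apply: sup_le => // r /(half_set01 n0) /andP[].
apply: le_sup1; first by move=> r; exact: half_set01.
have nR : n%:R != 0 :> R by rewrite pnatr_eq0 -lt0n.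
have r0 : 0 < Num.sqrt n%:R :> R by rewrite sqrtr_gt0 ltr0n.
have p1 : \sum_(i < n) n%:R^-1 = 1 :> R.
  by rewrite sumr_const card_ord -[LHS]mulr_natl divff.
exists (fun=> n%:R^-1); split => //.
  rewrite halfE// -mulr_sumr subr_le0 -(ler_pM2r r0); apply: le_trans h.
  have rn : n%:R^-1 * Num.sqrt n%:R = (Num.sqrt n%:R)^-1 :> R.
    by rewrite -[n%:R in X in X * _](@sqr_sqrtr _ n%:R)// expr2 invfM mulfVK ?gt_eqF.
  by rewrite -mulrA mulrAC rn.
by rewrite big1 // => i _; rewrite divff.
Qed.

(** [m] is [Z1 ^+ 2] on the diagonal with [Z1 > 0], the only case in which the half-plane constraint
    is active, and 0 otherwise. *)
Let max_bounds : let m := Z1 ^+ 2 + Z2 ^+ 2 - limit_stat in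
  expR (- (m / 2 + err)) <= max_EL x Theta <= expR (- (m / 2 - err)).
Proof.
have trivial_case m : m = 0 -> max_EL x Theta = 1 ->
    expR (- (m / 2 + err)) <= max_EL x Theta <= expR (- (m / 2 - err)).
  by move=> -> ->; rewrite mul0r add0r sub0r opprK -expR0 !ler_expR oppr_le0 err0.
rewrite /limit_stat /sqr /=; case: eqVneq => mu12; last first.
  apply: trivial_case; first by ring.
  apply: half_uniform; apply: le_trans (mu_far _).
    by rewrite ler_pM2l//; apply: le_trans Z1K; exact: ler_norm.
  by rewrite lt_neqAle mu12.
have [z0|z0] := leP Z1 0.
  apply: trivial_case; first by rewrite /neg_sqr (min_idPl z0); ring.
  by apply: half_uniform; rewrite mu12 subrr mul0r pmulr_rle0.
rewrite /neg_sqr (min_idPr (ltW z0)) expr0n/= add0r addrK max_ELE//.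
have pE p : \sum_i p i = 1 ->
    (\sum_i p i * ((x i).1 - (x i).2) <= 0) = (\sum_i p i * a i <= 0).
  by move=> p1; rewrite halfE// mu12 subrr subr0 pmulr_rle0.
apply/andP; split.
  have [p [p0 p1 pa h]] :=
    weights_lb1 n0 K1 eps0 eps_small n_large Z1K Z2K Saa1 ab_max.
  apply: le_trans h _; apply: le_sup1; first by move=> r; exact: half_set01.
  by exists p; split => //; rewrite pE// pa.
apply: sup_le => [|_ [p [p0 p1 pa ->]]]; first exact: expR_ge0.
rewrite pE// in pa.
exact: (weights_ub1 n0 K1 eps0 eps_small Z1K Saa1 Sbb1 Sab0 ab_max (ltW z0)).
Qed.

(** Each of the two likelihoods contributes [err] to the exponent, and the halving in [q / 2]
    doubles the total to [4 * err]. *)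
Lemma ELR_stat_lb q : limit_stat <= q - 4 * err ->
  expR (- (q / 2)) * max_EL x Theta <= EL x mu.
Proof.
have /andP[h1 _] := EL_bounds; have /andP[_ h2] := max_bounds => h.
apply: le_trans h1; apply: le_trans (ler_wpM2l (expR_ge0 _) h2) _.
by rewrite -expRD ler_expR; lra.
Qed.

Lemma ELR_stat_ub q : expR (- (q / 2)) * max_EL x Theta <= EL x mu ->
  limit_stat <= q + 4 * err.
Proof.
have /andP[_ h1] := EL_bounds; have /andP[h2 _] := max_bounds => h.
have := le_trans (ler_wpM2l (expR_ge0 _) h2) (le_trans h h1).
by rewrite -expRD ler_expR; lra.
Qed.

End empirical_likelihood_bounds.

(** * Whitening of the observations *)

Section standardization.
Context {R : realType}.
Local Notation V := (R * R)%type.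

Definition centered_form (m : V) (c1 c2 : R) (x : V) : R :=
  c1 * (x.1 - m.1) + c2 * (x.2 - m.2).

Lemma measurable_centered_form m c1 c2 : measurable_fun setT (centered_form m c1 c2).
Proof.
apply: measurable_funD; apply: measurable_funM => //; exact: measurable_funB.
Qed.

HB.instance Definition _ m c1 c2 :=
  isMeasurableFun.Build _ _ _ _ (centered_form m c1 c2) (measurable_centered_form m c1 c2).

Lemma positive_definite2 (S : 'M[R]_2) (c1 c2 : R) : positive_definite S ->
  (c1 != 0) || (c2 != 0) ->
  0 < c1 ^+ 2 * S 0 0 + (c1 * c2) * S 0 1 *+ 2 + c2 ^+ 2 * S 1 1.
Proof.
move=> [sym pd] c0; pose v : 'cV[R]_2 := \col_i (if i == 0 then c1 else c2).
have v0 : v != 0.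
  apply: contraTneq c0 => v0.
  have := congr1 (fun M : 'cV[R]_2 => M 0 0) v0; have := congr1 (fun M : 'cV[R]_2 => M 1 0) v0.
  by rewrite !mxE/= => -> ->; rewrite eqxx.
have S10 : S 1 0 = S 0 1 by rewrite -{1}sym mxE.
have := pd v v0; rewrite mxE !big_ord_recl big_ord0 !mxE !big_ord_recl !big_ord0 !mxE/=.
rewrite (_ : lift ord0 ord0 = 1); last exact/val_inj.
rewrite (_ : ord0 = 0) ?S10; last exact/val_inj.
by congr (_ < _); ring.
Qed.

Variables (F : probability V R) (m : V) (S : 'M[R]_2).
Hypotheses (F_mean : is_mean F m) (F_cov : is_covariance_matrix F S).

Let Y (i : 'I_2) (x : V) : R := coord2 i x - coord2 i m.

Let mY i : measurable_fun setT (Y i).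
Proof.
apply: measurable_funB => //; rewrite /coord2; case: (i == 0);
  [exact: measurable_fst|exact: measurable_snd].
Qed.

Let covE i j : (\int[F]_x (Y i x * Y j x)%:E)%E = (S i j)%:E.
Proof.
have mE k : fine 'E_F[coord2 k] = coord2 k m by have [_ ->] := F_mean k.
by rewrite -(F_cov i j) covariance.unlock !mE expectation.unlock.
Qed.

Let rY i : rint F (Y i).
Proof. by apply: rintB; [have [] := F_mean i|exact: rint_cst]. Qed.

Let iY i : \int[F]_x Y i x = 0.
Proof.
have [rc] := F_mean i; rewrite expectation.unlock => mE.
rewrite (_ : Y i = fun x => coord2 i x + - coord2 i m)// rintegralD//; last exact: rint_cst.
by rewrite Rintegral_cst1 /Rintegral mE subrr.
Qed.

(** Finite diagonal covariances give integrable squares, and these dominate the products. *)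
Let rYY i j : rint F (fun x => Y i x * Y j x).
Proof.
have sq k : rint F (fun x => Y k x ^+ 2).
  apply/integrableP; split; first exact/measurable_EFinP/measurable_funX.
  under eq_integral do rewrite /= ger0_norm ?sqr_ge0// expr2.
  by rewrite covE ltry.
apply: rint_le (rintD (sq i) (sq j)) _; first exact: measurable_funM.
move=> x; rewrite normrM -(real_normK (num_real (Y i x))) -(real_normK (num_real (Y j x))).
by have := sqr_ge0 (`|Y i x| - `|Y j x|); have := sqr_ge0 (`|Y i x|);
  have := sqr_ge0 (`|Y j x|); nra.
Qed.

Let iYY i j : \int[F]_x (Y i x * Y j x) = S i j.
Proof. by rewrite /Rintegral covE. Qed.

Lemma integral_centered_form c1 c2 : \int[F]_x centered_form m c1 c2 x = 0.
Proof.
rewrite (_ : centered_form m c1 c2 = fun x => c1 * Y 0 x + c2 * Y 1 x)//.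
by rewrite rintegralD ?rintegralZ ?iY ?mulr0 ?addr0//; exact: rintZ.
Qed.

Lemma integral_centered_form2 c1 c2 e1 e2 : S 1 0 = S 0 1 ->
  rint F (fun x => centered_form m c1 c2 x * centered_form m e1 e2 x) /\
  \int[F]_x (centered_form m c1 c2 x * centered_form m e1 e2 x) =
    c1 * e1 * S 0 0 + (c1 * e2 + c2 * e1) * S 0 1 + c2 * e2 * S 1 1.
Proof.
move=> sym.
rewrite (_ : (fun x => _) = fun x => c1 * e1 * (Y 0 x * Y 0 x) +
    (c1 * e2 + c2 * e1) * (Y 0 x * Y 1 x) + c2 * e2 * (Y 1 x * Y 1 x)); last first.
  by apply/funext => x; rewrite /centered_form /Y/=; ring.
have r1 k i j : rint F (fun x => k * (Y i x * Y j x)) by exact: rintZ.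
have r2 k k' i j i' j' : rint F (fun x => k * (Y i x * Y j x) + k' * (Y i' x * Y j' x)).
  exact: rintD.
by split; [exact: rintD|rewrite !rintegralD ?rintegralZ ?iYY].
Qed.

(** Gram-Schmidt starting from the difference of the coordinates, because membership in [Theta]
    depends only on this difference; it then becomes a constraint on [a] alone. *)
Lemma standardization : positive_definite S ->
  exists (s1 s2 kappa : R) (a b : {mfun V >-> R}), [/\ 0 < s1, 0 < s2, standard_pair F a b,
    forall x, (x.1 - m.1) - (x.2 - m.2) = s1 * a x &
    forall x, x.2 - m.2 = kappa * a x + s2 * b x].
Proof.
move=> pd; have sym : S 1 0 = S 0 1 by have [sym _] := pd; rewrite -{1}sym mxE.
pose v1 := S 0 0 - S 0 1 *+ 2 + S 1 1.
have v1_gt0 : 0 < v1.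
  have := @positive_definite2 S 1 (-1) pd; rewrite oner_neq0 => /(_ isT).
  by congr (_ < _); rewrite /v1; ring.
(* The regression coefficient of the second coordinate on the difference; [b] is the normalized
   residual, hence uncorrelated with [a]. *)
pose k := (S 0 1 - S 1 1) / v1.
pose v2 := k ^+ 2 * S 0 0 - k * (1 + k) * S 0 1 *+ 2 + (1 + k) ^+ 2 * S 1 1.
have v2_gt0 : 0 < v2.
  have := @positive_definite2 S (- k) (1 + k) pd.
  have -> : (- k != 0) || (1 + k != 0).
    by rewrite oppr_eq0; case: eqVneq => //= ->; rewrite addr0 oner_neq0.
  by move=> /(_ isT); congr (_ < _); rewrite /v2; ring.
pose s1 := Num.sqrt v1; pose s2 := Num.sqrt v2.
have s1_gt0 : 0 < s1 by rewrite sqrtr_gt0.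
have s2_gt0 : 0 < s2 by rewrite sqrtr_gt0.
have s1n : s1 != 0 by rewrite gt_eqF.
have s2n : s2 != 0 by rewrite gt_eqF.
have s1E : s1 ^+ 2 = v1 by rewrite sqr_sqrtr// ltW.
have s2E : s2 ^+ 2 = v2 by rewrite sqr_sqrtr// ltW.
have split_fst (y1 y2 : R) : y1 - y2 = s1 * (s1^-1 * y1 + - s1^-1 * y2) by field.
have split_snd (y1 y2 : R) : y2 = k * s1 * (s1^-1 * y1 + - s1^-1 * y2) +
    s2 * (- k / s2 * y1 + (1 + k) / s2 * y2).
  by clearbody k; field; rewrite ?s1n ?s2n.
exists s1, s2, (k * s1), (centered_form m s1^-1 (- s1^-1)),
  (centered_form m (- k / s2) ((1 + k) / s2)).
have I2 c1 c2 e1 e2 := integral_centered_form2 c1 c2 e1 e2 sym.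
split => //.
- split; split.
  + by have [+ _] := I2 s1^-1 (- s1^-1) s1^-1 (- s1^-1).
  + by have [+ _] := I2 (- k / s2) ((1 + k) / s2) (- k / s2) ((1 + k) / s2).
  + exact: integral_centered_form.
  + exact: integral_centered_form.
  + have [_ ->] := I2 s1^-1 (- s1^-1) s1^-1 (- s1^-1).
    transitivity (v1 / s1 ^+ 2); last by rewrite s1E divff// gt_eqF.
    by rewrite /v1; field.
  + have [_ ->] := I2 (- k / s2) ((1 + k) / s2) (- k / s2) ((1 + k) / s2).
    transitivity (v2 / s2 ^+ 2); last by rewrite s2E divff// gt_eqF.
    by rewrite /v2; field.
  + have [_ ->] := I2 s1^-1 (- s1^-1) (- k / s2) ((1 + k) / s2).
    transitivity ((S 0 1 - S 1 1 - k * v1) / (s1 * s2)).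
      by rewrite /v1; field; rewrite ?s1n ?s2n.
    by rewrite /k divfK ?gt_eqF// subrr mul0r.
- by move=> x; exact: split_snd.
Qed.

End standardization.

Section boolean_events.
Context {R : realType} d (T : measurableType d) (P : probability T R).

Lemma event_le_add (b1 b2 b3 : T -> bool) : measurable_fun setT b1 ->
  measurable_fun setT b2 -> measurable_fun setT b3 ->
  (forall w, b1 w -> b2 w || b3 w) ->
  fine (P [set w | b1 w]) <= fine (P [set w | b2 w]) + fine (P [set w | b3 w]).
Proof.
move=> m1 m2 m3 b123; rewrite -!Rintegral_bool//.
have ri (b : T -> bool) : measurable_fun setT b -> rint P (fun w => (b w)%:R : R).
  by move=> mb; exact/bmeas_integrable/bmeas_bool.
rewrite -rintegralD; [|exact: ri..].
apply: Rintegral_le; [exact: ri|by apply: rintD; exact: ri|move=> w].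
rewrite -natrD ler_nat; have := b123 w.
by case: (b1 w) => [/(_ isT)|_]; case: (b2 w); case: (b3 w).
Qed.

Lemma event_neg (b : T -> bool) : measurable_fun setT b ->
  fine (P [set w | ~~ b w]) = 1 - fine (P [set w | b w]).
Proof.
move=> mb; rewrite -(Rintegral_bool P mb) -(@Rintegral_bool _ _ _ P (fun w => ~~ b w)); last first.
  exact: measurableT_comp.
have rb : rint P (fun w => (b w)%:R : R) by exact/bmeas_integrable/bmeas_bool.
rewrite -mulN1r -rintegralZ// -[X in _ = X + _](Rintegral_cst1 P 1) -rintegralD.
- by apply: eq_Rintegral => w _; case: (b w); rewrite /= ?mulr1 ?mulr0 ?addr0 ?subrr.
- exact: rint_cst.
- exact: rintZ.
Qed.

End boolean_events.

(** * The exceptional event *)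

Section good_event.
Context {R : realType} d (Omega : measurableType d) (P : probability Omega R).
Local Notation V := (R * R)%type.
Local Notation gauss2 := (@gauss2 R).
Variables (X : nat -> {RV P >-> V}) (F : probability V R).
Hypothesis X_indep : mutually_independent X.
Hypothesis X_law : forall (i : nat) (A : set V),
  measurable A -> distribution P (X i) A = F A.
Variables a b : {mfun V >-> R}.
Hypothesis ab_std : standard_pair F a b.

Definition prodf (u v : V -> R) (x : V) : R := u x * v x.
Lemma measurable_prodf (u v : {mfun V >-> R}) : measurable_fun setT (prodf u v).
Proof. exact: measurable_funM. Qed.
HB.instance Definition _ (u v : {mfun V >-> R}) :=
  isMeasurableFun.Build _ _ _ _ (prodf u v) (measurable_prodf u v).

Definition far (u : V -> R) (c e : R) n w : bool :=
  e <= `|n%:R^-1 * \sum_(i < n) u (X i w) - c|.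

(** Covers every failure of the sample-dependent hypotheses of the deterministic likelihood
    bounds. *)
Definition bad (K eps : R) n w : bool :=
  [|| ~~ (quad sqr (zsum X a b n w) < K ^+ 2), far (prodf a a) 1 eps n w,
      far (prodf b b) 1 eps n w, far (prodf a b) 0 eps n w |
      1 <= \sum_(i < n) (exceed a b eps n (X i w))%:R :> R].

Let measurable_far (u : {mfun V >-> R}) c e n : measurable_fun setT (far u c e n).
Proof.
apply: measurable_fun_ler => //; apply: measurableT_comp => //.
apply: measurable_funB => //; apply: measurable_funM => //.
by apply: measurable_sum => i; exact: measurableT_comp.
Qed.

Let measurable_central (K : R) n :
  measurable_fun setT (fun w => quad sqr (zsum X a b n w) < K ^+ 2).
Proof.
apply: measurable_fun_ltr => //; apply: (measurableT_comp (measurable_quad measurable_sqr)).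
exact: measurable_zsum.
Qed.

Lemma measurable_bad K eps n : measurable_fun setT (bad K eps n).
Proof.
have mnot : measurable_fun setT (fun w => ~~ (quad sqr (zsum X a b n w) < K ^+ 2)).
  by apply: measurableT_comp => //; exact: measurable_central.
have mc := measurable_count_exceed X a b eps n.
by do 4 (apply: measurable_or => //).
Qed.

Let arith (p0 p1 p2 p3 p4 T q g e : R) : T <= (1 - p0) + (p1 + (p2 + (p3 + p4))) ->
  q - e <= p0 -> g <= q -> 1 - e <= g -> p1 <= e -> p2 <= e -> p3 <= e -> p4 <= e -> T <= 6 * e.
Proof. by move=> *; lra. Qed.

(** The order of quantifiers matters: [K] is fixed by tightness of the normalized sums alone, so
    [eps] can afterwards be taken small relative to [K ^+ 3]. Of the [6 * e], two shares are for
    tightness and one for each remaining condition. *)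
Lemma bad_small (e : R) : 0 < e -> exists2 K : R, 1 <= K &
  forall eps, 0 < eps -> \forall n \near \oo, fine (P [set w | bad K eps n w]) <= 6 * e.
Proof.
move=> e0; have [k kP] := dfun_to1 gauss2 (measurable_quad (@measurable_sqr R)) e0.
(* Large enough for [k < K ^+ 2 - 1], where 1 is the loss [eta] accepted in [portmanteau]. *)
pose K := 2 + `|k|.
have K1 : 1 <= K by rewrite /K; have := normr_ge0 k; lra.
have kK : k < K ^+ 2 - 1.
  apply: le_lt_trans (ler_norm k) _; rewrite /K.
  by have := normr_ge0 k; set l := `|k|; nra.
exists K => // eps eps0.
have small (u : {mfun V >-> R}) c : rint F u -> \int[F]_x u x = c ->
    \forall n \near \oo, fine (P [set w | far u c eps n w]) <= e.
  move=> ru <-; have /cvgrPdist_le/(_ e e0) := weak_law X_indep X_law ru eps0.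
  apply: filterS => n; rewrite sub0r normrN; apply: le_trans; exact: ler_norm.
have [[ra rb ia ib] [iaa ibb iab]] := ab_std.
have s1 := small (prodf a a) 1 ra iaa.
have s2 := small (prodf b b) 1 rb ibb.
have s3 := small (prodf a b) 0 (rint_mul ra rb) iab.
have s4 : \forall n \near \oo,
    fine (P [set w | 1 <= \sum_(i < n) (exceed a b eps n (X i w))%:R :> R]) <= e.
  have /cvgrPdist_le/(_ e e0) := max_small X_law ab_std eps0.
  apply: filterS => n; rewrite sub0r normrN; apply: le_trans; exact: ler_norm.
have s0 := portmanteau X_indep X_law ab_std (@sqr_ge R) (@sqr_ge R) (@measurable_sqr R)
  (@measurable_sqr R) (@gapprox_sqr R) (@gapprox_sqr R) (K ^+ 2) ltr01 e0.
near=> n.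
have h1 : fine (P [set w | far (prodf a a) 1 eps n w]) <= e by near: n; exact: s1.
have h2 : fine (P [set w | far (prodf b b) 1 eps n w]) <= e by near: n; exact: s2.
have h3 : fine (P [set w | far (prodf a b) 0 eps n w]) <= e by near: n; exact: s3.
have h4 : fine (P [set w | 1 <= \sum_(i < n) (exceed a b eps n (X i w))%:R :> R]) <= e.
  by near: n; exact: s4.
have h0 : fine (gauss2 [set z | quad sqr z < K ^+ 2 - 1]) - e <=
    fine (P [set w | quad sqr (zsum X a b n w) < K ^+ 2]).
  by near: n; move: s0; apply: filterS => n /andP[].
have hk : dfun gauss2 (quad sqr) k <= fine (gauss2 [set z | quad sqr z < K ^+ 2 - 1]).
  have mq := measurable_quad (@measurable_sqr R).
  apply: fine_le_mu.
  - by apply: measurable_boolset; exact: measurable_fun_ler.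
  - by apply: measurable_boolset; exact: measurable_fun_ltr.
  - by move=> z /= h; exact: le_lt_trans kK.
apply: (arith _ h0 hk kP h1 h2 h3 h4).
have m1 := measurable_far (prodf a a : {mfun V >-> R}) 1 eps n.
have m2 := measurable_far (prodf b b : {mfun V >-> R}) 1 eps n.
have m3 := measurable_far (prodf a b : {mfun V >-> R}) 0 eps n.
have m4 := measurable_count_exceed X a b eps n.
have m0 := measurable_central K n.
have m0' : measurable_fun setT (fun w => ~~ (quad sqr (zsum X a b n w) < K ^+ 2)).
  by apply: measurableT_comp.
have m34 := measurable_or m3 m4.
have m234 := measurable_or m2 m34.
have m1234 := measurable_or m1 m234.
rewrite -event_neg//.
apply: le_trans (event_le_add P (measurable_bad K eps n) m0' m1234 (fun w h => h)) _.
apply: lerD => //; apply: le_trans (event_le_add P m1234 m1 m234 (fun w h => h)) _.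
apply: lerD => //; apply: le_trans (event_le_add P m234 m2 m34 (fun w h => h)) _.
by apply: lerD => //; exact: (event_le_add P m34 m3 m4 (fun w h => h)).
Unshelve. all: by end_near. Qed.

End good_event.

(** * Convergence of probabilities from the sandwich *)

Section coverage.
Context {R : realType} d (Omega : measurableType d) (P : probability Omega R).
Local Notation V := (R * R)%type.
Local Notation gauss2 := (@gauss2 R).
Variables (X : nat -> {RV P >-> V}) (F : probability V R).
Hypothesis X_indep : mutually_independent X.
Hypothesis X_law : forall (i : nat) (A : set V),
  measurable A -> distribution P (X i) A = F A.
Variables a b : {mfun V >-> R}.
Hypothesis ab_std : standard_pair F a b.
Variable psi : R -> R.
Hypotheses (psi0 : forall x, 0 <= psi x) (mpsi : measurable_fun setT psi).
Hypothesis gpsi : forall c, gapprox (fun x => (psi x < c)%R%:R).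
Variable q : R.

Let tolerance (K eta : R) : 1 <= K -> 0 < eta -> exists eps : R,
  [/\ 0 < eps, 100 * K * eps <= 1 & 4 * (120 * K ^+ 3 * eps) <= eta / 4].
Proof.
move=> K1 eta0; have K0 : 0 < K by exact: lt_le_trans K1.
have K3 : 0 < K ^+ 3 by rewrite exprn_gt0.
have KK : K <= K ^+ 3 by rewrite exprS ler_peMr ?exprn_ege1// ltW.
pose u := Num.min 1 eta; have u0 : 0 < u by rewrite lt_min ltr01.
have [u1 ue] : u <= 1 /\ u <= eta by rewrite /u !ge_min !lexx orbT.
(* [4 * 120 / 2000] is below [1 / 4], and [u <= 1] settles the condition on [100 * K * eps]. *)
exists (u / (2000 * K ^+ 3)).
have eE : K ^+ 3 * (u / (2000 * K ^+ 3)) = u / 2000 by field; rewrite gt_eqF.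
have c0 : (0 : R) < 2000 by rewrite ltr0n.
have e0 : 0 < u / (2000 * K ^+ 3) by exact: divr_gt0 u0 (mulr_gt0 c0 K3).
split; [exact: e0| |by rewrite -mulrA eE; lra].
rewrite -mulrA; apply: (@le_trans _ _ (100 * (K ^+ 3 * (u / (2000 * K ^+ 3))))).
  have c1 : (0 : R) < 100 by rewrite ltr0n.
  by rewrite (ler_pM2l c1) (ler_pM2r e0).
by rewrite eE; lra.
Qed.

Let arith_lb (D D' g t p c e : R) : D - e <= D' -> D' <= g -> g - e <= t -> t <= p + c ->
  c <= 6 * e -> D - p <= 8 * e.
Proof. by move=> *; lra. Qed.

Let arith_ub (D D' g t p c e : R) : D' <= D + e -> g <= D' -> t <= g + e -> p <= t + c ->
  c <= 6 * e -> p - D <= 8 * e.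
Proof. by move=> *; lra. Qed.

Let arith_eta (eta eta1 eta2 del : R) : 0 < eta -> eta <= eta1 -> eta <= eta2 -> del <= eta / 4 ->
  [/\ q + eta / 2 + eta / 4 <= q + eta1, q - eta2 < q - eta / 2 - eta / 4,
      q + del < q + eta / 2 & q - eta / 2 <= q - del].
Proof. by move=> *; split; lra. Qed.

(** Outside [bad], the event [E n] lies between two sublevel sets of the statistic at levels close
    to [q]; without atoms, their limit probabilities are close to the one at [q]. *)
Lemma coverage_cvg (E : nat -> Omega -> bool) :
  (\forall n \near \oo, measurable_fun setT (E n)) ->
  (forall K eps : R, 1 <= K -> 0 < eps -> 100 * K * eps <= 1 ->
    \forall n \near \oo, forall w, ~~ bad X a b K eps n w ->
      (quad psi (zsum X a b n w) <= q - 4 * (120 * K ^+ 3 * eps) -> E n w) /\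
      (E n w -> quad psi (zsum X a b n w) <= q + 4 * (120 * K ^+ 3 * eps))) ->
  fine (P [set w | E n w]) @[n --> \oo] --> dfun gauss2 (quad psi) q.
Proof.
move=> mE sandwich; apply/cvgrPdist_le => e' e'0.
(* Six shares for [bad], one for [portmanteau] and one for the continuity of the limit cdf at
   [q]. *)
pose e := e' / 8; have e0 : 0 < e by rewrite divr_gt0.
have e8 : 8 * e = e' by rewrite /e; field.
have mq := measurable_quad mpsi.
have [eta1 eta1_gt0 right1] := dfun_right gauss2 mq q e0.
have [eta2 eta2_gt0] := dfun_left gauss2 mq q e0.
rewrite (fine_lt_dfun mq (quad_atomless psi)) => left2.
pose eta := Num.min eta1 eta2.
have eta_gt0 : 0 < eta by rewrite lt_min eta1_gt0.
have [le1 le2] : eta <= eta1 /\ eta <= eta2 by rewrite /eta !ge_min !lexx orbT.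
have eta4 : 0 < eta / 4 by rewrite divr_gt0.
have [K K1 badK] := bad_small X_indep X_law ab_std e0.
have [eps [eps0 epsK epsE]] := tolerance K1 eta_gt0.
set del := 4 * _ in epsE.
have [q1 q2 q3 q4] := arith_eta eta_gt0 le1 le2 epsE.
have bad_e := badK eps eps0.
have sw := sandwich K eps K1 eps0 epsK.
have pl := portmanteau X_indep X_law ab_std psi0 (@sqr_ge R) mpsi (@measurable_sqr R)
  gpsi (@gapprox_sqr R) (q - eta / 2) eta4 e0.
have pu := portmanteau X_indep X_law ab_std psi0 (@sqr_ge R) mpsi (@measurable_sqr R)
  gpsi (@gapprox_sqr R) (q + eta / 2) eta4 e0.
have mlt x : measurable [set z | quad psi z < x].
  by apply: measurable_boolset; exact: measurable_fun_ltr.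
have mle x : measurable [set z | quad psi z <= x].
  by apply: measurable_boolset; exact: measurable_fun_ler.
near=> n.
have mEn : measurable_fun setT (E n) by near: n.
have mbad := measurable_bad X a b K eps n.
have bn : fine (P [set w | bad X a b K eps n w]) <= 6 * e by near: n.
have swn w : ~~ bad X a b K eps n w ->
      (quad psi (zsum X a b n w) <= q - del -> E n w) /\
      (E n w -> quad psi (zsum X a b n w) <= q + del).
  by move: w; near: n.
have mt x : measurable_fun setT (fun w => quad psi (zsum X a b n w) < x).
  apply: measurable_fun_ltr => //; apply: (measurableT_comp mq).
  exact: measurable_zsum.
rewrite -e8 ler_norml lerNl opprB; apply/andP; split.
- have h1 : fine (P [set w | quad psi (zsum X a b n w) < q + eta / 2]) <=
      fine (gauss2 [set z | quad psi z < q + eta / 2 + eta / 4]) + e.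
    by near: n; move: pu; apply: filterS => n /andP[].
  have h2 : fine (gauss2 [set z | quad psi z < q + eta / 2 + eta / 4]) <=
      dfun gauss2 (quad psi) (q + eta1).
    by apply: fine_le_mu => // z /= /ltW h; exact: le_trans h q1.
  have h3 := event_le_add P mEn (mt (q + eta / 2)) mbad.
  have {}h3 : fine (P [set w | E n w]) <=
      fine (P [set w | quad psi (zsum X a b n w) < q + eta / 2]) +
      fine (P [set w | bad X a b K eps n w]).
    apply: h3 => w Ew; apply/orP; have [|/swn[_ /(_ Ew) h]] := boolP (bad _ _ _ _ _ _ w); [by right|left].
    exact: le_lt_trans h q3.
  exact: (arith_ub right1 h2 h1 h3 bn).
- have h1 : fine (gauss2 [set z | quad psi z < q - eta / 2 - eta / 4]) - e <=
      fine (P [set w | quad psi (zsum X a b n w) < q - eta / 2]).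
    by near: n; move: pl; apply: filterS => n /andP[].
  have h2 : dfun gauss2 (quad psi) (q - eta2) <=
      fine (gauss2 [set z | quad psi z < q - eta / 2 - eta / 4]).
    by apply: fine_le_mu => // z /= h; exact: le_lt_trans h q2.
  have h3 := event_le_add P (mt (q - eta / 2)) mEn mbad.
  have {}h3 : fine (P [set w | quad psi (zsum X a b n w) < q - eta / 2]) <=
      fine (P [set w | E n w]) + fine (P [set w | bad X a b K eps n w]).
    apply: h3 => w Zw; apply/orP; have [|/swn[h _]] := boolP (bad _ _ _ _ _ _ w); [by right|left].
    by apply: h; exact: le_trans (ltW Zw) q4.
  exact: (arith_lb left2 h2 h1 h3 bn).
Unshelve. all: by end_near. Qed.

End coverage.

Section half_plane.
Context {R : realType}.

Lemma interior_Theta (mu : R * R) : interior Theta mu <-> mu.1 < mu.2.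
Proof.
split=> [/nbhs_ballP[e /= e0 eT]|mu12].
  have := eT (mu.1 + e / 2, mu.2); rewrite /Theta/= => h.
  apply: lt_le_trans (h _); first by rewrite ltrDl divr_gt0.
  split => /=; last exact: ballxx.
  rewrite -ball_normE/= opprD addrA subrr sub0r normrN gtr0_norm ?divr_gt0//.
  by rewrite ltr_pdivrMr// ltr_pMr// ltr1n.
apply/nbhs_ballP; exists ((mu.2 - mu.1) / 2) => /=; first by rewrite divr_gt0// subr_gt0.
move=> z [/=]; rewrite -!ball_normE/= !ltr_norml => /andP[h1 h2] /andP[h3 h4].
by rewrite /Theta/=; lra.
Qed.

End half_plane.

Section sandwich.
Context {R : realType} d (Omega : measurableType d) (P : probability Omega R).
Local Notation V := (R * R)%type.
Variables (X : nat -> {RV P >-> V}) (a b : {mfun V >-> R}) (mu : V) (s1 s2 kappa : R).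
Hypotheses (s1_gt0 : 0 < s1) (s2_gt0 : 0 < s2) (mu_Theta : mu.1 <= mu.2).
Hypothesis x_diff : forall x, (x.1 - mu.1) - (x.2 - mu.2) = s1 * a x.
Hypothesis x_snd : forall x, x.2 - mu.2 = kappa * a x + s2 * b x.

Definition limit_fun : R -> R := if mu.1 == mu.2 then neg_sqr else sqr.

Definition ELR_small (q : R) n w : bool :=
  expR (- (q / 2)) * max_EL (fun i : 'I_n => X i w) Theta <= EL (fun i : 'I_n => X i w) mu.

Lemma measurable_ELR_small q n : (0 < n)%N -> measurable_fun setT (ELR_small q n).
Proof.
move=> n0; apply: measurable_fun_ler.
  by apply: measurable_funM => //; exact: (@measurable_max_EL _ _ _ n n0 (fun i => X i)).
exact: (@measurable_EL _ _ _ n n0 (fun i => X i)).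
Qed.

(** [n] is chosen before [w]: it has to make [K ^+ 2 / n%:R] at most [eps] and, in the interior, to
    let the gap between the coordinates of [mu] exceed [s1 * K] over the square root of [n]. The
    conditions on the sample are all in [bad]. *)
Lemma sandwich_near (q K eps : R) : 1 <= K -> 0 < eps -> 100 * K * eps <= 1 ->
  \forall n \near \oo, forall w, ~~ bad X a b K eps n w ->
    (quad limit_fun (zsum X a b n w) <= q - 4 * (120 * K ^+ 3 * eps) -> ELR_small q n w) /\
    (ELR_small q n w -> quad limit_fun (zsum X a b n w) <= q + 4 * (120 * K ^+ 3 * eps)).
Proof.
move=> K1 eps0 epsK; near=> n => w.
have n0 : (0 < n)%N by near: n; exact: nbhs_infty_gt.
have n_large : K ^+ 2 <= eps * n%:R.
  by rewrite -ler_pdivrMl//; near: n; exact: nbhs_infty_ger.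
have mu_far : mu.1 < mu.2 -> s1 * K <= (mu.2 - mu.1) * Num.sqrt n%:R.
  move=> mu12; have del0 : 0 < mu.2 - mu.1 by rewrite subr_gt0.
  rewrite -ler_pdivrMl//; set t := _ * _; apply: le_trans (ler_norm t) _.
  by rewrite -sqrtr_sqr ler_wsqrtr//; near: n; exact: nbhs_infty_ger.
rewrite /bad !negb_or negbK => /and5P[h0 h1 h2 h3 h4].
pose A (i : 'I_n) := a (X i w); pose B (i : 'I_n) := b (X i w).
have ZE : zsum X a b n w = (std_sum A, std_sum B) by rewrite /zsum psum_scaled_pair.
have QE : quad limit_fun (zsum X a b n w) = limit_stat mu A B.
  by rewrite ZE /quad /limit_stat /limit_fun /=; case: (_ == _).
rewrite QE; rewrite ZE /quad/sqr/= in h0.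
have K0 : 0 <= K by apply: le_trans K1.
have Z1K : `|std_sum A| <= K.
  rewrite -ler_sqr ?nnegrE// real_normK ?num_real//; apply: le_trans (ltW h0).
  by rewrite lerDl sqr_ge0.
have Z2K : `|std_sum B| <= K.
  rewrite -ler_sqr ?nnegrE// real_normK ?num_real//; apply: le_trans (ltW h0).
  by rewrite lerDr sqr_ge0.
have Saa : `|emp_mean (fun i => A i ^+ 2) - 1| <= eps by move: h1; rewrite -ltNge => /ltW.
have Sbb : `|emp_mean (fun i => B i ^+ 2) - 1| <= eps by move: h2; rewrite -ltNge => /ltW.
have Sab : `|emp_mean (fun i => A i * B i)| <= eps by move: h3; rewrite -ltNge subr0 => /ltW.
have AB i : `|A i| + `|B i| <= eps * Num.sqrt n%:R.
  rewrite leNgt; apply: contra h4 => h4.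
  rewrite (bigD1 i)//= (_ : exceed _ _ _ _ _ = true)// lerDl.
  by apply: sumr_ge0 => j _; exact: ler0n.
split.
- exact: (ELR_stat_lb s1_gt0 s2_gt0 (fun i => x_diff (X i w)) (fun i => x_snd (X i w))
    mu_Theta n0 K1 eps0 epsK n_large Z1K Z2K Saa Sbb Sab AB mu_far).
- exact: (ELR_stat_ub s1_gt0 s2_gt0 (fun i => x_diff (X i w)) (fun i => x_snd (X i w))
    mu_Theta n0 K1 eps0 epsK n_large Z1K Z2K Saa Sbb Sab AB mu_far).
Unshelve. all: by end_near. Qed.

End sandwich.

Theorem mainTheorem7 (R : realType) (alpha : R)
    (alpha_gt0 : 0 < alpha) (alpha_lt1 : alpha < 1)
    (d : measure_display) (Omega : measurableType d)
    (P : probability Omega R) (X : nat -> {RV P >-> (R * R)%type})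
    (F : probability (R * R)%type R) (mu0 : R * R) (Sigma : 'M[R]_2)
    (X_indep : mutually_independent X)
    (X_law : forall (i : nat) (A : set (R * R)),
       measurable A -> distribution P (X i) A = F A)
    (F_mean : is_mean F mu0) (mu0_Theta : Theta mu0)
    (F_cov : is_covariance_matrix F Sigma)
    (Sigma_pd : positive_definite Sigma)
    (moment_int : interior Theta mu0 ->
       forall i : nat, ('E_P[(fun w => enorm (X i w) ^+ 2)%R] < +oo)%E)
    (moment_bd : Hdiag mu0 ->
       forall i : nat, ('E_P[(fun w => enorm (X i w - mu0) ^+ 3)%R] < +oo)%E)
    (hull_bd : Hdiag mu0 -> forall M : R,
       P [set w | [set mu0 + (Num.sqrt n%:R)^-1 *: h | h in
                     [set h : R * R | enorm h <= M]] `<=`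
                  interior (conv_hull [set X i w | i in [set i | (i < n)%N]])]
         @[n --> \oo] --> 1%E) :
  P [set w | C_pt (fun i : 'I_n => X i w) alpha mu0]
    @[n --> \oo] --> (1 - alpha)%:E.
Proof.
have [s1 [s2 [kappa [a [b [s1_gt0 s2_gt0 ab_std x_diff x_snd]]]]]] :=
  standardization F_mean F_cov Sigma_pd.
pose psi := limit_fun mu0.
have [psi0 mpsi gpsi] : [/\ forall x, 0 <= psi x, measurable_fun setT psi &
    forall c, gapprox (fun x => (psi x < c)%R%:R)].
  rewrite /psi /limit_fun; case: (_ == _); split.
  - exact: neg_sqr_ge.
  - exact: measurable_neg_sqr.
  - exact: gapprox_neg_sqr.
  - exact: sqr_ge.
  - exact: measurable_sqr.
  - exact: gapprox_sqr.
(* [mu0] satisfies the location condition of exactly one of the two pieces of [C_pt], so a single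
   cutoff decides and both cases are treated at once. *)
pose cdf : R -> \bar R := if mu0.1 == mu0.2 then chibar12_cdf else chi2_cdf 2.
pose q := quantile cdf (1 - alpha).
have cdfE x : cdf x = (dfun gauss2 (quad psi) x)%:E.
  by rewrite /cdf /psi /limit_fun; case: (_ == _); [exact: chibar12_cdfE|exact: chi2_cdf2E].
have alpha01 : 0 < 1 - alpha < 1 by rewrite subr_gt0 alpha_lt1 ltrBlDr ltrDl.
have [q0 qE] : 0 <= q /\ dfun gauss2 (quad psi) q = 1 - alpha.
  exact: (quantileP (measurable_quad mpsi) (quad_ge0 psi0) (quad_atomless psi) alpha01 cdfE).
have CE n : (0 < n)%N ->
    [set w | C_pt (fun i : 'I_n => X i w) alpha mu0] = [set w | ELR_small X mu0 q n w].
  move=> n0; apply/seteqP; split => w.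
    rewrite /C_pt/= /ELR_small -ELR_le// /q /cdf => -[[/interior_Theta mu12]|[->]].
      by rewrite lt_eqF.
    by rewrite eqxx.
  rewrite /C_pt/= /ELR_small -ELR_le// /q /cdf; case: eqVneq => [mu12|mu12] h; [right|left] => //.
  by split => //; apply/interior_Theta; rewrite lt_neqAle mu12.
have mE n : (0 < n)%N -> measurable_fun setT (ELR_small X mu0 q n).
  exact: measurable_ELR_small.
have cv : fine (P [set w | ELR_small X mu0 q n w]) @[n --> \oo] --> 1 - alpha.
  rewrite -qE; apply: (coverage_cvg X_indep X_law ab_std psi0 mpsi gpsi).
    by near=> n; apply: mE; near: n; exact: nbhs_infty_gt.
  by move=> K eps K1 eps0 epsK; exact: (sandwich_near X s1_gt0 s2_gt0 mu0_Theta x_diff x_snd q).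
(* Back to extended reals: the probabilities are finite once the event is measurable, which is known
   for [n > 0]. *)
apply/fine_cvgP; split.
  near=> n; have n0 : (0 < n)%N by near: n; exact: nbhs_infty_gt.
  by rewrite CE//; apply: fin_num_measure; exact/measurable_boolset/mE.
apply: cvg_trans cv; apply: near_eq_cvg; near=> n => /=.
by rewrite CE//; near: n; exact: nbhs_infty_gt.
Unshelve. all: by end_near. Qed.
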